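(* The smooth Toeplitz algebra $\mathcal{T}^\infty$ is closed under the holomorphic functional calculus: for any $a\in\mathcal{T}^\infty$ and any function $f$ that is holomorphic on an open domain containing the spectrum of $a$, we have $f(a)\in\mathcal{T}^\infty$.
   Context: $H$ is a separable infinite-dimensional complex Hilbert space with a fixed orthonormal basis $\{E_k\}_{k\ge0}$; $P_{k,l}$ is the operator with $P_{k,l}E_l=E_k$ and $P_{k,l}E_m=0$ for $m\ne l$. $\mathcal{K}^\infty$ is the set of operators $c=\sum_{k,l\ge0}c_{k,l}P_{k,l}$ with rapidly decaying coefficients: $\sup_{k,l}(1+k)^M(1+l)^N|c_{k,l}|<\infty$ for all $M,N\ge0$. $U$ is the unilateral shift $UE_k=E_{k+1}$; the Toeplitz algebra $\mathcal{T}$ is the C$^*$-algebra generated by $U$ in $B(H)$. For $f\in C^\infty(\mathbb{R}/\mathbb{Z})$ with Fourier series $\sum_nf_ne^{2\pi inx}$, $T(f)=\sum_{n\ge0}f_nU^n+\sum_{n<0}f_n(U^* )^{-n}$. The smooth Toeplitz algebra is $\mathcal{T}^\infty=\{T(f)+c:f\in C^\infty(\mathbb{R}/\mathbb{Z}),\ c\in\mathcal{K}^\infty\}\subset\mathcal{T}$. The spectrum is taken in $\mathcal{T}$ (equivalently in $B(H)$) and $f(a)$ is defined by the Cauchy integral $\frac1{2\pi i}\int_Cf(\zeta)(\zeta-a)^{-1}d\zeta$ over a contour $C$ around the spectrum of $a$. *)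

(* Defs.v *)
From Stdlib Require Import Reals Lra ZArith List.
From Stdlib Require Import FunctionalExtensionality ProofIrrelevance.
From Coquelicot Require Import Coquelicot.

Open Scope R_scope.

(** * Hilbert spaces *)

(** The inner product is conjugate-linear in the first argument and linear in
    the second; [inner_norm] says that the norm of the underlying Banach space
    is the one induced by it (so that the form is positive definite). *)
Record HilbertSpace := {
  hilbert_module :> CompleteNormedModule C_AbsRing;
  inner : hilbert_module -> hilbert_module -> C;
  inner_plus_r : forall x y z, inner x (plus y z) = Cplus (inner x y) (inner x z);
  inner_scal_r : forall x (k : C) y, inner x (scal k y) = Cmult k (inner x y);
  inner_conj : forall x y, inner y x = Cconj (inner x y);
  inner_norm : forall x, inner x x = RtoC (norm x ^ 2)
}.

Arguments inner {_} _ _.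

Record is_orthonormal_basis {H : HilbertSpace} (E : nat -> H) : Prop := {
  basis_orthonormal : forall k l, inner (E k) (E l) = RtoC (if Nat.eqb k l then 1 else 0);
  basis_total : forall (x : H) (eps : posreal), exists (c : nat -> C) (n : nat),
    norm (minus x (sum_n (fun k => scal (c k) (E k)) n)) < eps
}.

Lemma inner_cauchy_schwarz {H : HilbertSpace} (x y : H) :
  Cmod (inner x y) <= norm x * norm y.
Proof.
  assert (Hsc : forall (k : C) (u : H), norm (scal k u) <= Cmod k * norm u)
    by (intros k u; exact (norm_scal k u)).
  assert (Htr : forall u v : H, norm (plus u v) <= norm u + norm v)
    by (intros u v; exact (norm_triangle u v)).
  assert (Hc : forall u v w : H, inner (plus u v) w = Cplus (inner u w) (inner v w)).
  { intros u v w. rewrite (inner_conj H w (plus u v)), inner_plus_r.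
    rewrite (inner_conj H w u), (inner_conj H w v).
    apply injective_projections; simpl; ring. }
  assert (Hs : forall k (u w : H), inner (scal k u) w = Cmult (Cconj k) (inner u w)).
  { intros k u w. rewrite (inner_conj H w (scal k u)), inner_scal_r, (inner_conj H w u).
    apply injective_projections; simpl; ring. }
  assert (Hz : (zero : H) = scal (RtoC 0 : C) (zero : H))
    by (symmetry; exact (scal_zero_l (zero : H))).
  assert (Hn0 : forall u : H, 0 <= norm u) by (intro u; apply norm_ge_0).
  destruct (Req_dec (norm x) 0) as [Hx|Hx].
  { assert (x = zero) as -> by exact (norm_eq_zero _ Hx).
    assert (inner (zero : H) y = RtoC 0) as ->.
    { rewrite Hz, Hs.
      apply injective_projections; simpl; ring. }
    rewrite Cmod_0. rewrite Hx. lra. }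
  destruct (Req_dec (norm y) 0) as [Hy|Hy].
  { assert (y = zero) as -> by exact (norm_eq_zero _ Hy).
    assert (inner x (zero : H) = RtoC 0) as ->.
    { rewrite Hz, inner_scal_r.
      apply injective_projections; simpl; ring. }
    rewrite Cmod_0. rewrite Hy. lra. }
  pose proof (Hn0 x) as Hx0. pose proof (Hn0 y) as Hy0.
  set (a := inner x y).
  destruct (Req_dec (Cmod a) 0) as [Ha|Ha].
  { rewrite Ha. apply Rmult_le_pos; lra. }
  pose proof (Cmod_ge_0 a) as Ha0.
  (* evaluate |t u x + y|^2 for t = norm y / norm x and u unimodular *)
  set (k := (RtoC (norm y / (norm x * Cmod a)) * a)%C : C).
  assert (Hk : Cmod k = norm y / norm x).
  { unfold k. rewrite Cmod_mult, Cmod_R, Rabs_pos_eq.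
    - field. split; lra.
    - apply Rle_mult_inv_pos; [lra|]. apply Rmult_lt_0_compat; lra. }
  assert (Hle : norm (plus (scal k x) y) <= 2 * norm y).
  { eapply Rle_trans; [apply Htr|].
    eapply Rle_trans; [apply Rplus_le_compat_r, Hsc|].
    rewrite Hk. right. field. lra. }
  assert (Heq : inner (plus (scal k x) y) (plus (scal k x) y)
            = RtoC (norm y ^ 2 + norm y ^ 2 + 2 * (norm y / norm x) * Cmod a)).
  { rewrite Hc, !inner_plus_r, !inner_scal_r, !Hs, !inner_norm.
    rewrite (inner_conj H x y). fold a.
    assert (Hm : Cmod a ^ 2 = fst a ^ 2 + snd a ^ 2).
    { unfold Cmod. rewrite pow2_sqrt; [reflexivity|].
      pose proof (pow2_ge_0 (fst a)). pose proof (pow2_ge_0 (snd a)). lra. }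
    assert (Hy2 : (norm y / (norm x * Cmod a)) * (fst a ^ 2 + snd a ^ 2)
                  = norm y / norm x * Cmod a).
    { rewrite <- Hm. field. split; lra. }
    assert (Hy3 : (norm y / (norm x * Cmod a)) ^ 2 * (fst a ^ 2 + snd a ^ 2) * norm x ^ 2
                  = norm y ^ 2).
    { rewrite <- Hm. field. split; lra. }
    unfold k. set (s := norm y / (norm x * Cmod a)) in *.
    apply injective_projections; simpl.
    - apply Rminus_diag_uniq.
      transitivity ((s ^ 2 * (fst a ^ 2 + snd a ^ 2) * norm x ^ 2 - norm y ^ 2)
        + 2 * (s * (fst a ^ 2 + snd a ^ 2) - norm y / norm x * Cmod a)).
      + ring.
      + rewrite Hy2, Hy3. ring.
    - ring. }
  rewrite inner_norm in Heq. apply RtoC_inj in Heq.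
  assert (Hsq : norm (plus (scal k x) y) ^ 2 <= (2 * norm y) ^ 2).
  { apply pow_incr. split; [apply Hn0 | exact Hle]. }
  rewrite Heq in Hsq.
  assert (H1 : norm y / norm x * Cmod a <= norm y ^ 2) by nra.
  apply Rmult_le_reg_l with (norm y / norm x).
  - apply Rdiv_lt_0_compat; lra.
  - eapply Rle_trans; [exact H1|]. right. field. lra.
Qed.

(** * Bounded operators *)

Record bounded_op (V : NormedModule C_AbsRing) := Bop {
  bop_fun :> V -> V;
  bop_linear : is_linear bop_fun
}.

Arguments Bop {V} _ _.
Arguments bop_linear {V} _.

Lemma bop_ext {V : NormedModule C_AbsRing} (S T : bounded_op V) :
  (forall x, S x = T x) -> S = T.
Proof.
  destruct S as [s Hs], T as [t Ht]; simpl; intro E.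
  assert (s = t) as -> by (apply functional_extensionality; exact E).
  f_equal. apply proof_irrelevance.
Qed.

Section BoundedOperators.

Context {V : NormedModule C_AbsRing}.

Lemma bop_plus_linear (S T : bounded_op V) : is_linear (fun x => plus (S x) (T x)).
Proof.
  apply (is_linear_comp (fun x => (S x, T x)) (fun p : V * V => plus (fst p) (snd p))).
  - apply is_linear_prod; apply bop_linear.
  - apply is_linear_plus.
Qed.

Lemma bop_opp_linear (S : bounded_op V) : is_linear (fun x => opp (S x)).
Proof. apply (is_linear_comp S opp); [apply bop_linear | apply is_linear_opp]. Qed.

Lemma bop_scal_linear (k : C) (S : bounded_op V) : is_linear (fun x => scal k (S x)).
Proof.
  apply (is_linear_comp S (fun x => scal k x)).
  - apply bop_linear.
  - apply (is_linear_scal_r (K := C_AbsRing) k). exact Cmult_comm.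
Qed.

Lemma bop_mult_linear (S T : bounded_op V) : is_linear (fun x => S (T x)).
Proof. apply (is_linear_comp T S); apply bop_linear. Qed.

Definition bop_plus (S T : bounded_op V) : bounded_op V := Bop _ (bop_plus_linear S T).
Definition bop_opp (S : bounded_op V) : bounded_op V := Bop _ (bop_opp_linear S).
Definition bop_zero : bounded_op V := Bop _ is_linear_zero.
Definition bop_scal (k : C) (S : bounded_op V) : bounded_op V := Bop _ (bop_scal_linear k S).
Definition bop_mult (S T : bounded_op V) : bounded_op V := Bop _ (bop_mult_linear S T).
Definition bop_one : bounded_op V := Bop _ is_linear_id.

Definition opnorm (T : bounded_op V) : R :=
  real (Lub_Rbar (fun r => exists x, norm x <= 1 /\ r = norm (T x))).

Lemma opnorm_spec (T : bounded_op V) :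
  is_lub_Rbar (fun r => exists x, norm x <= 1 /\ r = norm (T x)) (opnorm T).
Proof.
  destruct (linear_norm T (bop_linear T)) as [M [HM HT]].
  unfold opnorm. set (A := fun r : R => _). pose proof (Lub_Rbar_correct A) as [H1 H2].
  assert (HA0 : A 0).
  { exists zero. rewrite norm_zero. split; [lra|].
    rewrite (linear_zero T (bop_linear T)), norm_zero. reflexivity. }
  assert (HAM : is_ub_Rbar A M).
  { intros r [x [Hx ->]]. simpl. eapply Rle_trans; [apply HT|].
    pose proof (norm_ge_0 x). nra. }
  specialize (H1 _ HA0) as H10. specialize (H2 _ HAM) as H2M.
  destruct (Lub_Rbar A) as [r| |]; simpl in *; easy.
Qed.

Lemma opnorm_bound (T : bounded_op V) (x : V) : norm (T x) <= opnorm T * norm x.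
Proof.
  destruct (opnorm_spec T) as [Hub _].
  destruct (Req_dec (norm x) 0) as [Hx|Hx].
  { assert (x = zero) as -> by exact (norm_eq_zero _ Hx).
    rewrite (linear_zero T (bop_linear T)), norm_zero. lra. }
  pose proof (norm_ge_0 x).
  assert (Hi : 0 < / norm x) by (apply Rinv_0_lt_compat; lra).
  assert (Hab : abs (RtoC (/ norm x) : C_AbsRing) = / norm x).
  { change (Cmod (RtoC (/ norm x)) = / norm x). rewrite Cmod_R. apply Rabs_pos_eq; lra. }
  assert (Hab' : abs (RtoC (norm x) : C_AbsRing) = norm x).
  { change (Cmod (RtoC (norm x)) = norm x). rewrite Cmod_R. apply Rabs_pos_eq; lra. }
  assert (Hy : norm (T (scal (RtoC (/ norm x) : C_AbsRing) x)) <= opnorm T).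
  { apply (Hub (norm (T (scal (RtoC (/ norm x) : C_AbsRing) x)))).
    exists (scal (RtoC (/ norm x) : C_AbsRing) x). split; [|reflexivity].
    eapply Rle_trans; [apply norm_scal|]. rewrite Hab. right. field. lra. }
  rewrite (linear_scal T (bop_linear T)) in Hy.
  assert (HT : T x = scal (RtoC (norm x) : C_AbsRing) (scal (RtoC (/ norm x) : C_AbsRing) (T x))).
  { rewrite scal_assoc.
    transitivity (scal (one : C_AbsRing) (T x)); [symmetry; apply (scal_one (T x))|].
    f_equal. apply injective_projections; simpl; field; lra. }
  rewrite HT. eapply Rle_trans; [apply norm_scal|]. rewrite Hab'. nra.
Qed.

Lemma opnorm_le (T : bounded_op V) (M : R) :
  0 <= M -> (forall x, norm (T x) <= M * norm x) -> opnorm T <= M.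
Proof.
  intros HM HT. destruct (opnorm_spec T) as [_ Hl].
  apply (Hl M). intros r [x [Hx ->]]. simpl.
  eapply Rle_trans; [apply HT|]. pose proof (norm_ge_0 x). nra.
Qed.

Lemma opnorm_ge_0 (T : bounded_op V) : 0 <= opnorm T.
Proof.
  destruct (opnorm_spec T) as [Hub _]. apply (Hub 0).
  exists zero. rewrite norm_zero. split; [lra|].
  rewrite (linear_zero T (bop_linear T)), norm_zero. reflexivity.
Qed.

Lemma opnorm_zero : opnorm bop_zero = 0.
Proof.
  apply Rle_antisym; [|apply opnorm_ge_0].
  apply opnorm_le; [lra|]. intro x. simpl. rewrite norm_zero. lra.
Qed.

Lemma opnorm_plus (S T : bounded_op V) : opnorm (bop_plus S T) <= opnorm S + opnorm T.
Proof.
  pose proof (opnorm_ge_0 S). pose proof (opnorm_ge_0 T).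
  apply opnorm_le; [lra|]. intro x. simpl.
  eapply Rle_trans; [apply norm_triangle|].
  pose proof (opnorm_bound S x). pose proof (opnorm_bound T x). lra.
Qed.

Lemma opnorm_scal (k : C) (T : bounded_op V) : opnorm (bop_scal k T) <= Cmod k * opnorm T.
Proof.
  pose proof (opnorm_ge_0 T). pose proof (Cmod_ge_0 k).
  apply opnorm_le; [nra|]. intro x. simpl.
  eapply Rle_trans; [apply (norm_scal (K := C_AbsRing) k)|]. change (abs k) with (Cmod k).
  pose proof (opnorm_bound T x). nra.
Qed.

Lemma opnorm_opp (T : bounded_op V) : opnorm (bop_opp T) <= opnorm T.
Proof.
  apply opnorm_le; [apply opnorm_ge_0|]. intro x. simpl.
  rewrite norm_opp. apply opnorm_bound.
Qed.

Lemma opnorm_eq_0 (T : bounded_op V) : opnorm T = 0 -> T = bop_zero.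
Proof.
  intro H. apply bop_ext. intro x. simpl. apply norm_eq_zero.
  pose proof (opnorm_bound T x). pose proof (norm_ge_0 (T x)). rewrite H in H0. lra.
Qed.

Definition bop_AbelianMonoid_mixin : AbelianMonoid.mixin_of (bounded_op V).
Proof.
  apply (AbelianMonoid.Mixin _ bop_plus bop_zero);
    intros; apply bop_ext; intro; simpl.
  - apply plus_comm.
  - apply plus_assoc.
  - apply plus_zero_r.
Defined.

Canonical bop_AbelianMonoid := AbelianMonoid.Pack (bounded_op V) bop_AbelianMonoid_mixin (bounded_op V).

Definition bop_AbelianGroup_mixin : AbelianGroup.mixin_of bop_AbelianMonoid.
Proof.
  apply (AbelianGroup.Mixin _ bop_opp).
  intros; apply bop_ext; intro y; exact (plus_opp_r (x y)).
Defined.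

Canonical bop_AbelianGroup :=
  AbelianGroup.Pack (bounded_op V) (AbelianGroup.Class _ _ bop_AbelianGroup_mixin) (bounded_op V).

Definition bop_Ring_mixin : Ring.mixin_of bop_AbelianGroup.
Proof.
  apply (Ring.Mixin _ bop_mult bop_one);
    intros; apply bop_ext; intro; try reflexivity.
  apply (linear_plus x (bop_linear x)).
Defined.

Canonical bop_Ring := Ring.Pack (bounded_op V) (Ring.Class _ _ bop_Ring_mixin) (bounded_op V).

Definition bop_ModuleSpace_mixin : ModuleSpace.mixin_of C_Ring bop_AbelianGroup.
Proof.
  apply (ModuleSpace.Mixin C_Ring bop_AbelianGroup bop_scal);
    intros; apply bop_ext; intro; simpl.
  - apply (scal_assoc (V := NormedModule.ModuleSpace C_AbsRing V)).
  - apply (scal_one (V := NormedModule.ModuleSpace C_AbsRing V)).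
  - apply (scal_distr_l (V := NormedModule.ModuleSpace C_AbsRing V)).
  - apply (scal_distr_r (V := NormedModule.ModuleSpace C_AbsRing V)).
Defined.

Canonical bop_ModuleSpace :=
  ModuleSpace.Pack C_Ring (bounded_op V) (ModuleSpace.Class C_Ring _ _ bop_ModuleSpace_mixin) (bounded_op V).

Definition bop_UniformSpace_mixin : UniformSpace.mixin_of (bounded_op V).
Proof.
  apply (UniformSpace.Mixin _ bop_zero (fun S e T => opnorm (minus T S) < e)).
  - intros S e. rewrite minus_eq_zero.
    change (opnorm bop_zero < e). rewrite opnorm_zero. apply cond_pos.
  - intros S T e H. rewrite <- opp_minus.
    eapply Rle_lt_trans; [apply opnorm_opp | exact H].
  - intros S T W e1 e2 H1 H2. rewrite (minus_trans T).
    eapply Rle_lt_trans; [apply opnorm_plus|]. lra.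
Defined.

Canonical bop_UniformSpace := UniformSpace.Pack (bounded_op V) bop_UniformSpace_mixin (bounded_op V).

Canonical bop_NormedModuleAux :=
  NormedModuleAux.Pack C_AbsRing (bounded_op V)
    (NormedModuleAux.Class C_AbsRing _
      (ModuleSpace.class _ bop_ModuleSpace) bop_UniformSpace_mixin) (bounded_op V).

Definition bop_NormedModule_mixin : NormedModule.mixin_of C_AbsRing bop_NormedModuleAux.
Proof.
  apply (NormedModule.Mixin C_AbsRing bop_NormedModuleAux opnorm 1).
  - exact opnorm_plus.
  - exact opnorm_scal.
  - intros S T e H. exact H.
  - intros S T e H. rewrite Rmult_1_l. exact H.
  - exact opnorm_eq_0.
Defined.

Canonical bop_NormedModule :=
  NormedModule.Pack C_AbsRing (bounded_op V)
    (NormedModule.Class C_AbsRing _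
      (NormedModuleAux.class _ bop_NormedModuleAux) bop_NormedModule_mixin) (bounded_op V).

End BoundedOperators.

(** * Complex normed modules as real ones *)

Section RestrictScalars.

Context (V : NormedModule C_AbsRing).

Definition real_ModuleSpace_mixin : ModuleSpace.mixin_of R_Ring V.
Proof.
  apply (ModuleSpace.Mixin R_Ring V (fun (r : R) (x : V) => scal (RtoC r : C_AbsRing) x)).
  - intros x y u. rewrite scal_assoc. f_equal. symmetry. exact (RtoC_mult x y).
  - intro u. apply (scal_one u).
  - intros x u v. exact (scal_distr_l (V := NormedModule.ModuleSpace _ V) _ u v).
  - intros x y u. rewrite <- (scal_distr_r (V := NormedModule.ModuleSpace _ V)).
    f_equal. exact (RtoC_plus x y).
Defined.

Definition real_NormedModuleAux : NormedModuleAux R_AbsRing :=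
  NormedModuleAux.Pack R_AbsRing V
    (NormedModuleAux.Class R_AbsRing V
      (ModuleSpace.Class R_Ring V (AbelianGroup.class V) real_ModuleSpace_mixin)
      (UniformSpace.class V)) V.

Definition real_NormedModule_mixin : NormedModule.mixin_of R_AbsRing real_NormedModuleAux.
Proof.
  apply (NormedModule.Mixin R_AbsRing real_NormedModuleAux (@norm C_AbsRing V)
    (@norm_factor C_AbsRing V)).
  - exact (@norm_triangle _ V).
  - intros r x. eapply Rle_trans; [apply (norm_scal (RtoC r : C_AbsRing) x)|].
    apply Rmult_le_compat_r; [apply norm_ge_0|].
    right. exact (Cmod_R r).
  - exact (@norm_compat1 _ V).
  - exact (@norm_compat2 _ V).
  - exact (@norm_eq_zero _ V).
Defined.

Definition real_NormedModule : NormedModule R_AbsRing :=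
  NormedModule.Pack R_AbsRing V
    (NormedModule.Class R_AbsRing V
      (NormedModuleAux.class _ real_NormedModuleAux) real_NormedModule_mixin) V.

End RestrictScalars.

(** * Spectrum relative to an operator algebra *)

Definition is_inverse {K : Ring} (a b : K) : Prop :=
  mult a b = one /\ mult b a = one.

(** [spectrum A a] is the spectrum of [a] as an element of the algebra [A]. *)
Definition spectrum {V : NormedModule C_AbsRing} (A : bounded_op V -> Prop) (a : bounded_op V) (z : C) : Prop :=
  ~ exists b : bounded_op V, A b /\ is_inverse (minus (scal z (one : bounded_op V)) a) b.

Definition is_adjoint {H : HilbertSpace} (T S : bounded_op H) : Prop :=
  forall x y : H, inner (S x) y = inner x (T y).

Record is_Cstar_subalgebra {H : HilbertSpace} (A : bounded_op H -> Prop) : Prop := {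
  cstar_zero : A zero;
  cstar_plus : forall S T, A S -> A T -> A (plus S T);
  cstar_scal : forall (k : C) S, A S -> A (scal k S);
  cstar_mult : forall S T, A S -> A T -> A (mult S T);
  cstar_adjoint : forall S T, A S -> is_adjoint S T -> A T;
  cstar_closed : closed A
}.

Definition Cstar_generated {H : HilbertSpace} (U T : bounded_op H) : Prop :=
  forall A, is_Cstar_subalgebra A -> A U -> A T.

(** * The smooth Toeplitz algebra *)

Definition is_shift {H : HilbertSpace} (E : nat -> H) (U : bounded_op H) : Prop :=
  forall k, U (E k) = E (S k).

Lemma matrix_unit_linear {H : HilbertSpace} (E : nat -> H) (k l : nat) :
  is_linear (fun x : H => scal (inner (E l) x) (E k)).
Proof.
  apply (is_linear_comp (V := AbsRing_NormedModule C_AbsRing)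
    (fun x : H => inner (E l) x) (fun z : C => scal z (E k))).
  - split.
    + intros x y. apply inner_plus_r.
    + intros z x. apply inner_scal_r.
    + exists (norm (E l) + 1). pose proof (norm_ge_0 (E l : NormedModule.sort _ H)) as H0.
      split; [apply Rle_lt_0_plus_1, H0|]. intro x.
      pose proof (norm_ge_0 (x : NormedModule.sort _ H)) as H1.
      eapply Rle_trans; [exact (inner_cauchy_schwarz (E l) x)|].
      apply Rmult_le_compat_r; [exact H1|]. lra.
  - exact (is_linear_scal_l (E k : NormedModule.sort _ H)).
Qed.

(** The operator P_{k,l} sending [E l] to [E k] and the other [E m] to 0. *)
Definition matrix_unit {H : HilbertSpace} (E : nat -> H) (k l : nat) : bounded_op H :=
  Bop _ (matrix_unit_linear E k l).

Lemma matrix_unit_basis {H : HilbertSpace} (E : nat -> H) (k l m : nat) :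
  is_orthonormal_basis E ->
  matrix_unit E k l (E m) = if Nat.eqb l m then E k else zero.
Proof.
  intros [HE _]. simpl. rewrite HE. destruct (Nat.eqb l m).
  - exact (scal_one (E k : NormedModule.sort _ H)).
  - exact (scal_zero_l (E k : NormedModule.sort _ H)).
Qed.

Definition rapid_decay (c : nat -> nat -> C) : Prop :=
  forall M N : nat, exists B : R, forall k l : nat,
    (1 + INR k) ^ M * (1 + INR l) ^ N * Cmod (c k l) <= B.

Definition smooth_compact {H : HilbertSpace} (E : nat -> H) (T : bounded_op H) : Prop :=
  exists c : nat -> nat -> C, rapid_decay c /\
    filterlim
      (fun N => sum_n (fun k => sum_n (fun l => scal (c k l) (matrix_unit E k l)) N) N)
      eventually (locally T).

(** Smooth functions on R/Z, as smooth 1-periodic functions on R; [g n] is the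
    n-th derivative. *)
Definition smooth_periodic (f : R -> C) : Prop :=
  (forall x, f (x + 1) = f x) /\
  exists g : nat -> R -> C,
    (forall x, g 0%nat x = f x) /\
    (forall n x, is_derive (V := C_R_NormedModule) (g n) x (g (S n) x)).

Definition fourier_coeff (f : R -> C) (n : Z) : C :=
  RInt (V := C_R_CompleteNormedModule)
    (fun x => Cmult (f x) (cos (2 * PI * IZR n * x), - sin (2 * PI * IZR n * x))) 0 1.

(** [is_toeplitz U Us f T] means T = T(f), [Us] being the adjoint of [U]. *)
Definition is_toeplitz {V : NormedModule C_AbsRing} (U Us : bounded_op V) (f : R -> C) (T : bounded_op V) : Prop :=
  exists T1 T2 : bounded_op V,
    is_series (fun n => scal (fourier_coeff f (Z.of_nat n)) (pow_n U n)) T1 /\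
    is_series (fun n => scal (fourier_coeff f (- Z.of_nat (S n))) (pow_n Us (S n))) T2 /\
    T = plus T1 T2.

Definition smooth_toeplitz {H : HilbertSpace} (E : nat -> H) (U Us : bounded_op H) (a : bounded_op H) : Prop :=
  exists (f : R -> C) (T c : bounded_op H),
    smooth_periodic f /\ is_toeplitz U Us f T /\ smooth_compact E c /\ a = plus T c.

(** * Contour integrals *)

(** A C^1 arc, parametrized by [0,1]. Since C^1 functions on [0,1] extend to R,
    asking for two-sided derivatives at the end points loses no arcs. *)
Record arc := {
  arc_fun :> R -> C;
  arc_der : R -> C;
  arc_is_derive : forall t, 0 <= t <= 1 ->
    is_derive (V := C_R_NormedModule) arc_fun t (arc_der t);
  arc_der_continuous : forall t, 0 <= t <= 1 -> continuous arc_der t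
}.

(** A piecewise C^1 path is a list of consecutive arcs. *)
Fixpoint is_path (z : C) (p : list arc) (w : C) : Prop :=
  match p with
  | nil => z = w
  | g :: q => g 0 = z /\ is_path (g 1) q w
  end%list.

Definition closed_path (p : list arc) : Prop := exists z, is_path z p z.

(** A contour is a finite family of closed paths; it is traversed as the
    concatenation of the arcs of its paths. *)
Definition contour := list (list arc).

Definition on_contour (G : contour) (z : C) : Prop :=
  exists (g : arc) (t : R), In g (concat G) /\ 0 <= t <= 1 /\ z = g t.

Fixpoint is_arcs_integral {V : NormedModule C_AbsRing} (F : C -> V) (p : list arc) (I : V) : Prop :=
  match p with
  | nil => I = zero
  | g :: q => exists I1 I2 : V,
      is_RInt (V := real_NormedModule V) (fun t => scal (arc_der g t) (F (g t))) 0 1 I1 /\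
      is_arcs_integral F q I2 /\ I = plus I1 I2
  end%list.

Definition is_contour_integral {V : NormedModule C_AbsRing} (F : C -> V) (G : contour) (I : V) : Prop :=
  is_arcs_integral F (concat G) I.

Definition two_pi_i : C := Cmult (RtoC (2 * PI)) Ci.

Definition winding_number (G : contour) (z w : C) : Prop :=
  exists I : C, is_contour_integral (V := C_NormedModule) (fun zeta => Cinv (Cminus zeta z)) G I /\
    w = Cdiv I two_pi_i.

(** [G] is a contour around [K] inside [Omega]. *)
Record is_contour_around (G : contour) (K Omega : C -> Prop) : Prop := {
  contour_closed : forall p, In p G -> closed_path p;
  contour_in : forall z, on_contour G z -> Omega z /\ ~ K z;
  contour_winding_1 : forall z, K z -> winding_number G z (RtoC 1);
  contour_winding_0 : forall z, ~ Omega z -> winding_number G z (RtoC 0)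
}.

(** * Holomorphic functional calculus *)

Definition holomorphic_on (Omega : C -> Prop) (f : C -> C) : Prop :=
  forall z, Omega z -> ex_derive (K := C_AbsRing) (V := C_NormedModule) f z.

(** [b] is the integral (1 / 2 pi i) int_G f(zeta) (zeta - a)^{-1} dzeta, the
    integrand being the values of a function [r] that inverts [zeta - a]
    along [G]. *)
Definition is_cauchy_integral {V : NormedModule C_AbsRing}
    (f : C -> C) (a : bounded_op V) (G : contour) (b : bounded_op V) : Prop :=
  exists (r : C -> bounded_op V) (I : bounded_op V),
    (forall zeta, on_contour G zeta ->
      is_inverse (minus (scal zeta (one : bounded_op V)) a) (r zeta)) /\
    is_contour_integral (fun zeta => scal (f zeta) (r zeta)) G I /\
    b = scal (Cinv two_pi_i) I.

(* Main.v *)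
(** Write [[S, T]] for the commutator. An operator [b] lies in the smooth Toeplitz algebra exactly
    when [[U, b]] and [[Us, b]] have rapidly decaying matrices: the diagonals of the matrix of [b]
    then converge rapidly, and the limits are the Fourier coefficients of the symbol.
    This passes to an inverse [r] of [zeta - a] because [[w, r] = r [w, a] r] for every [w], once
    sandwiching between resolvents is known to preserve rapid decay. For the latter, let [W] be the
    diagonal operator with entries [1 + min (k, n)]. For [a] in the algebra, [[W^(i+1), a] W^(-i)]
    is bounded uniformly in [n], so
    [W^(i+1) r T = r W^(i+1) T - r ([W^(i+1), zeta - a] W^(-i)) W^i r T]
    bounds [W^i r T] by induction on [i], uniformly in [n] and in [zeta] as long as [r] stays
    bounded. The bounds on the matrix entries survive integration along the contour, where only
    continuity of [f] matters. *)
From Stdlib Require Import Reals Lra Lia ZArith List.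
From Stdlib Require Import FunctionalExtensionality PropExtensionality Classical ClassicalEpsilon.
Require Import Defs.
From Coquelicot Require Import Coquelicot.

Open Scope R_scope.

(** * Expansions in an orthonormal basis *)

(** The diagonal weight with entries [1 + k] is unbounded. Cut off at [n] it becomes a scalar plus a
    finite-rank operator, so every manipulation stays inside the bounded operators; the point is
    then that no constant depends on [n], since the entry [(k, l)] carries its full weight once
    [n >= max k l]. Commutators are the right quantity because they lose one order: shifting an
    index by [m] changes [(1 + k)^(i+1)] by at most a constant times [(1 + k)^i]. The recursion over
    [i] starts from the plain norm of [r], so neither a smallness condition on [zeta - a] nor an
    inversion of the symbol on the circle is involved. Both commutators are used: [[U, b]] contains
    the differences along diagonals and the zeroth row of [b], and [[Us, b]] its zeroth column, so
    Fourier coefficients of both signs are reached. Summing the differences from infinity, not from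
    the boundary, produces a rapidly decaying matrix; what is left of [b] is constant along
    diagonals. *)

Lemma linear_sum_n {K : AbsRing} {V W : NormedModule K} (L : V -> W) (a : nat -> V) (n : nat) :
  is_linear L -> L (sum_n a n) = sum_n (fun k => L (a k)) n.
Proof.
  intro HL. induction n as [|n IH].
  - now rewrite !sum_O.
  - now rewrite !sum_Sn, (linear_plus L HL), IH.
Qed.

Lemma sum_n_zero {G : AbelianMonoid} (a : nat -> G) (n : nat) :
  (forall k, (k <= n)%nat -> a k = zero) -> sum_n a n = zero.
Proof.
  intro Ha. rewrite (sum_n_ext_loc _ (fun _ => zero)) by exact Ha.
  apply sum_n_m_const_zero.
Qed.

Lemma plus_minus_cancel {G : AbelianGroup} (x y : G) : plus (minus x y) y = x.
Proof. unfold minus. now rewrite <- plus_assoc, plus_opp_l, plus_zero_r. Qed.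

Lemma eq_of_minus_zero {G : AbelianGroup} (x y : G) : minus x y = zero -> x = y.
Proof.
  intro Hm. pose proof (plus_minus_cancel x y) as Hp.
  rewrite Hm, plus_zero_l in Hp. now symmetry.
Qed.

Lemma norm_le_minus {K : AbsRing} {V : NormedModule K} (x y : V) :
  norm x <= norm (minus x y) + norm y.
Proof. rewrite <- (plus_minus_cancel x y) at 1. apply norm_triangle. Qed.

Section Basis.

Context {H : HilbertSpace}.
Implicit Types x y z : H.

Lemma inner_linear (e : H) :
  is_linear (U := H) (V := AbsRing_NormedModule C_AbsRing) (fun x : H => inner e x).
Proof.
  split.
  - intros x y. apply inner_plus_r.
  - intros z x. apply inner_scal_r.
  - exists (norm e + 1). pose proof (norm_ge_0 e).
    split; [lra|]. intro x. pose proof (norm_ge_0 x).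
    eapply Rle_trans; [exact (inner_cauchy_schwarz e x)|].
    apply Rmult_le_compat_r; [assumption|]. lra.
Qed.

Lemma inner_zero_r x : inner x (zero : H) = RtoC 0.
Proof. exact (linear_zero _ (inner_linear x)). Qed.

Lemma inner_zero_l x : inner (zero : H) x = RtoC 0.
Proof. rewrite inner_conj, inner_zero_r. apply injective_projections; simpl; ring. Qed.

Lemma inner_minus_r x y z : inner x (minus y z) = Cminus (inner x y) (inner x z).
Proof.
  unfold minus. rewrite inner_plus_r.
  now rewrite (linear_opp _ z (inner_linear x) : inner x (opp z) = Copp (inner x z)).
Qed.

Lemma inner_plus_l x y z : inner (plus x y) z = Cplus (inner x z) (inner y z).
Proof.
  rewrite inner_conj, inner_plus_r, (inner_conj _ x z), (inner_conj _ y z).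
  apply injective_projections; simpl; ring.
Qed.

Lemma inner_scal_l (k : C) x y : inner (scal k x) y = Cmult (Cconj k) (inner x y).
Proof.
  rewrite inner_conj, inner_scal_r, (inner_conj _ x y).
  apply injective_projections; simpl; ring.
Qed.

Lemma norm_sqr_eq_inner x y : inner x x = inner y y -> norm x = norm y.
Proof.
  rewrite !inner_norm. intro E. apply RtoC_inj in E.
  pose proof (norm_ge_0 x). pose proof (norm_ge_0 y).
  apply Rsqr_inj; auto. unfold Rsqr. lra.
Qed.

Lemma pythagoras x y :
  inner x y = RtoC 0 -> norm (plus x y) ^ 2 = norm x ^ 2 + norm y ^ 2.
Proof.
  intro E. apply RtoC_inj. rewrite RtoC_plus, <- !inner_norm.
  rewrite inner_plus_l, !inner_plus_r, (inner_conj _ x y), E.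
  apply injective_projections; simpl; ring.
Qed.

Lemma inner_sum_n_r x (a : nat -> H) n :
  inner x (sum_n a n) = sum_n (fun k => inner x (a k)) n.
Proof. exact (linear_sum_n (V := H) _ a n (inner_linear x)). Qed.

(** These restate linearity for the module structure that unification infers from [H] itself,
    which rewriting does not identify with the one of its underlying [NormedModule]. *)
Lemma bop_map_plus (T : bounded_op H) x y : (T (plus x y) : H) = plus (T x : H) (T y : H).
Proof. exact (linear_plus T (bop_linear T) x y). Qed.

Lemma bop_map_scal (T : bounded_op H) (k : C) x : (T (scal k x) : H) = scal k (T x : H).
Proof. exact (linear_scal T (bop_linear T) k x). Qed.

Lemma bop_map_zero (T : bounded_op H) : (T (zero : H) : H) = zero.
Proof. exact (linear_zero T (bop_linear T)). Qed.

Lemma bop_map_minus (T : bounded_op H) x y : (T (minus x y) : H) = minus (T x : H) (T y : H).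
Proof.
  unfold minus. rewrite bop_map_plus. f_equal. exact (linear_opp T y (bop_linear T)).
Qed.

Lemma bop_map_sum_n (T : bounded_op H) (a : nat -> H) n :
  (T (sum_n a n) : H) = sum_n (fun k => (T (a k) : H)) n.
Proof. exact (linear_sum_n T a n (bop_linear T)). Qed.

Context (E : nat -> H) (HE : is_orthonormal_basis E).

Lemma basis_norm k : norm (E k) = 1.
Proof.
  pose proof (basis_orthonormal E HE k k) as Hk.
  rewrite Nat.eqb_refl, inner_norm in Hk. apply RtoC_inj in Hk.
  pose proof (norm_ge_0 (E k)). nra.
Qed.

Lemma inner_basis_sum (c : nat -> C) (n k : nat) : (n < k)%nat ->
  inner (E k) (sum_n (fun j => scal (c j) (E j)) n) = RtoC 0.
Proof.
  intro Hk.
  rewrite inner_sum_n_r.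
  apply (sum_n_zero (G := C_AbelianGroup)). intros j Hj.
  rewrite inner_scal_r, (basis_orthonormal E HE).
  destruct (Nat.eqb_spec k j); [lia|]. apply injective_projections; simpl; ring.
Qed.

Lemma parseval_sum_n (c : nat -> C) (n : nat) :
  norm (sum_n (fun j => scal (c j) (E j)) n) ^ 2 = sum_n (fun j => Cmod (c j) ^ 2) n.
Proof.
  assert (Hs : forall (k : C) j, norm (scal k (E j)) ^ 2 = Cmod k ^ 2).
  { intros k j. apply RtoC_inj. rewrite <- inner_norm, inner_scal_l, inner_scal_r.
    rewrite inner_norm, basis_norm. rewrite Cmod2_conj.
    apply injective_projections; simpl; ring. }
  induction n as [|n IH].
  - now rewrite !sum_O, Hs.
  - rewrite !sum_Sn, pythagoras, IH, Hs; [reflexivity|].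
    rewrite inner_conj, inner_scal_l, inner_basis_sum by lia.
    apply injective_projections; simpl; ring.
Qed.

(** Testing against a finite combination [s] close to [x] gives [norm x ^ 2 = Cmod (inner x (minus x
    s)) <= norm x * norm (minus x s)], so [norm x] is below every positive [eps]. *)
Lemma eq_zero_of_basis x : (forall k, inner (E k) x = RtoC 0) -> x = zero.
Proof.
  intro Hx. refine (norm_eq_zero x _). apply Rle_antisym; [|exact (norm_ge_0 x)].
  apply le_epsilon. intros eps Heps.
  destruct (basis_total E HE x (mkposreal eps Heps)) as [c [n Hn]]. simpl in Hn.
  set (s := sum_n _ n) in Hn.
  assert (Hs : inner x s = RtoC 0).
  { unfold s.
    rewrite inner_sum_n_r.
    apply (sum_n_zero (G := C_AbelianGroup)). intros j _.
    rewrite inner_scal_r, inner_conj, Hx. apply injective_projections; simpl; ring. }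
  assert (Hxx : norm x ^ 2 = Cmod (inner x (minus x s))).
  { rewrite inner_minus_r, Hs, inner_norm. unfold Cminus.
    replace (RtoC (norm x ^ 2) + - RtoC 0)%C with (RtoC (norm x ^ 2))
      by (apply injective_projections; simpl; ring).
    rewrite Cmod_R, Rabs_pos_eq; [reflexivity|apply pow2_ge_0]. }
  pose proof (inner_cauchy_schwarz x (minus x s)). rewrite <- Hxx in H0.
  pose proof (norm_ge_0 x). pose proof (norm_ge_0 (minus x s)).
  destruct (Req_dec (norm x) 0); [lra|].
  assert (norm x <= norm (minus x s)) by nra. lra.
Qed.

Lemma eq_of_basis x y : (forall k, inner (E k) x = inner (E k) y) -> x = y.
Proof.
  intro Hxy. apply (eq_of_minus_zero (G := H)), eq_zero_of_basis.
  intro k. rewrite inner_minus_r, Hxy. apply injective_projections; simpl; ring.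
Qed.

(** Finite combinations are dense and [T] is already known to be bounded, so an estimate on them
    extends to the whole space with the same constant [M]. *)
Lemma opnorm_le_basis (T : bounded_op H) (M : R) : 0 <= M ->
  (forall c n, norm (T (sum_n (fun j => scal (c j) (E j)) n))
               <= M * norm (sum_n (fun j => scal (c j) (E j)) n)) ->
  opnorm T <= M.
Proof.
  intros HM HT. apply opnorm_le; [assumption|]. intro x.
  apply le_epsilon. intros eps Heps. pose proof (opnorm_ge_0 T) as HT0.
  (* Replacing [x] by [s] costs [norm (T t)] on the left and [M * norm t] on the right, hence the
     denominator; the summand 1 keeps it positive. *)
  assert (Hd : 0 < eps / (opnorm T + M + 1)) by (apply Rdiv_lt_0_compat; lra).
  destruct (basis_total E HE x (mkposreal _ Hd)) as [c [n Hn]]. simpl in Hn.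
  specialize (HT c n). set (s := sum_n _ n) in *.
  set (t := minus x s) in Hn.
  assert (Hsx : norm s <= norm t + norm x).
  { rewrite <- (norm_opp t). unfold t. rewrite opp_minus. exact (norm_le_minus s x). }
  assert (Htx : norm (T x) <= norm (T t) + norm (T s)).
  { unfold t. rewrite bop_map_minus. exact (norm_le_minus (T x) (T s)). }
  pose proof (opnorm_bound T t) as Ht. pose proof (norm_ge_0 t) as Ht0.
  assert (He : norm t * (opnorm T + M + 1) <= eps).
  { apply Rle_trans with (eps / (opnorm T + M + 1) * (opnorm T + M + 1)).
    - apply Rmult_le_compat_r; [lra|]. left. exact Hn.
    - right. field. lra. }
  nra.
Qed.

Lemma bop_eq_zero_basis (T : bounded_op H) : (forall k, T (E k) = (zero : H)) -> T = zero.
Proof.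
  intro HT. apply (opnorm_eq_0 T). apply Rle_antisym; [|apply opnorm_ge_0].
  apply opnorm_le_basis; [lra|]. intros c n.
  rewrite bop_map_sum_n, (sum_n_zero (G := H)).
  - right. rewrite Rmult_0_l. exact (@norm_zero C_AbsRing H).
  - intros j _. rewrite bop_map_scal, HT. exact (scal_zero_r (V := H) (c j)).
Qed.

Lemma bop_ext_basis (S T : bounded_op H) : (forall k, S (E k) = T (E k)) -> S = T.
Proof.
  intro HST. apply eq_of_minus_zero, bop_eq_zero_basis. intro k.
  change (minus (S (E k) : H) (T (E k) : H) = zero). rewrite HST. apply minus_eq_zero.
Qed.

(** By Parseval on finite combinations the squared norm is a sum of squares, in which each
    coefficient grows by a factor of at most [M]. *)
Lemma opnorm_diag (T : bounded_op H) (d : nat -> C) (M : R) :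
  0 <= M -> (forall k, T (E k) = scal (d k) (E k)) -> (forall k, Cmod (d k) <= M) ->
  opnorm T <= M.
Proof.
  intros HM HT Hd. apply opnorm_le_basis; [assumption|]. intros c n.
  assert (T (sum_n (fun j => scal (c j) (E j)) n)
          = sum_n (fun j => scal (Cmult (d j) (c j)) (E j)) n) as ->.
  { rewrite bop_map_sum_n.
    apply (sum_n_ext (G := H)). intro j. rewrite bop_map_scal, HT.
    transitivity (scal (mult (c j) (d j)) (E j));
      [exact (scal_assoc _ _ (E j : NormedModule.sort _ H))|].
    f_equal. apply Cmult_comm. }
  apply Rsqr_incr_0_var; [|apply Rmult_le_pos; [assumption|apply norm_ge_0]].
  rewrite Rsqr_mult, !Rsqr_pow2, !parseval_sum_n.
  rewrite <- (sum_n_mult_l (K := R_Ring) (M ^ 2)).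
  unfold sum_n. apply sum_n_m_le. intro k. rewrite Cmod_mult, Rpow_mult_distr.
  apply Rmult_le_compat_r; [apply pow2_ge_0|].
  apply pow_incr. split; [apply Cmod_ge_0|apply Hd].
Qed.

End Basis.

(** * Matrix entries and diagonal operators *)

Section Operators.

Context {H : HilbertSpace}.
Implicit Types S T : bounded_op H.

Lemma opnorm_mult S T : opnorm (mult S T) <= opnorm S * opnorm T.
Proof.
  pose proof (opnorm_ge_0 S). pose proof (opnorm_ge_0 T).
  apply opnorm_le; [nra|]. intro x.
  eapply Rle_trans; [apply (opnorm_bound S (T x))|].
  pose proof (opnorm_bound T x). nra.
Qed.

Lemma opnorm_mult_le S T s t : opnorm S <= s -> opnorm T <= t -> opnorm (mult S T) <= s * t.
Proof.
  intros HS HT. eapply Rle_trans; [apply opnorm_mult|].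
  apply Rmult_le_compat; auto using opnorm_ge_0.
Qed.

Lemma opnorm_plus_le S T s t : opnorm S <= s -> opnorm T <= t -> opnorm (plus S T) <= s + t.
Proof. intros HS HT. pose proof (opnorm_plus S T) as Hp.
  exact (Rle_trans _ _ _ Hp (Rplus_le_compat _ _ _ _ HS HT)). Qed.

Lemma opnorm_opp_le S s : opnorm S <= s -> opnorm (opp S) <= s.
Proof. intro HS. exact (Rle_trans _ _ _ (opnorm_opp S) HS). Qed.

Lemma opnorm_minus_le S T s t : opnorm S <= s -> opnorm T <= t -> opnorm (minus S T) <= s + t.
Proof. intros HS HT. apply opnorm_plus_le; [|apply opnorm_opp_le]; assumption. Qed.

Lemma opnorm_scal_le (k : C) S s : opnorm S <= s -> opnorm (scal k S) <= Cmod k * s.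
Proof.
  intro HS. eapply Rle_trans; [exact (opnorm_scal k S)|].
  apply Rmult_le_compat_l; [apply Cmod_ge_0|assumption].
Qed.

Lemma opnorm_one : opnorm (one : bounded_op H) <= 1.
Proof. apply opnorm_le; [lra|]. intro x. rewrite Rmult_1_l. apply Rle_refl. Qed.

Lemma opnorm_sum_n (a : nat -> bounded_op H) (b : nat -> R) n :
  (forall k, opnorm (a k) <= b k) -> opnorm (sum_n a n) <= sum_n b n.
Proof.
  intro Hab. induction n as [|n IH].
  - rewrite !sum_O. apply Hab.
  - rewrite !sum_Sn. apply opnorm_plus_le; auto.
Qed.

Lemma bop_sum_n_apply (a : nat -> bounded_op H) n (x : H) :
  (sum_n a n x : H) = sum_n (fun k => (a k x : H)) n.
Proof.
  induction n as [|n IH].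
  - now rewrite !sum_O.
  - rewrite !sum_Sn, <- IH. reflexivity.
Qed.

Lemma filterlim_opnorm (s : nat -> bounded_op H) T :
  filterlim s eventually (locally T) <->
  forall eps : posreal, eventually (fun n => opnorm (minus (s n) T) < eps).
Proof.
  split.
  - intros Hs eps. apply (Hs (ball T eps)). apply locally_ball.
  - intros Hs P [eps HP]. destruct (Hs eps) as [N HN]. exists N.
    intros n Hn. apply HP. apply HN, Hn.
Qed.

(** Lipschitz control makes [p] continuous enough for upper bounds to pass to the limit, and [C] is
    inherited without any loss from [K]. This matters because in the applications [K] depends on the
    cut-off [n] while [C] does not. *)
Lemma opnorm_limit_le (p : bounded_op H -> R) (K C : R) (s : nat -> bounded_op H) T :
  0 <= K -> (forall A B, p A <= p B + K * opnorm (minus B A)) ->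
  filterlim s eventually (locally T) -> (forall n, p (s n) <= C) -> p T <= C.
Proof.
  intros HK Hp Hs HC. apply le_epsilon. intros eps Heps.
  assert (Hd : 0 < eps / (K + 1)) by (apply Rdiv_lt_0_compat; lra).
  destruct (proj1 (filterlim_opnorm s T) Hs (mkposreal _ Hd)) as [N HN].
  specialize (HN N (Nat.le_refl N)). simpl in HN.
  specialize (Hp T (s N)). specialize (HC N).
  pose proof (opnorm_ge_0 (minus (s N) T)).
  assert (K * opnorm (minus (s N) T) <= eps).
  { apply Rle_trans with ((K + 1) * (eps / (K + 1))); [nra|]. right. field. lra. }
  lra.
Qed.

Context (E : nat -> H) (HE : is_orthonormal_basis E).

Definition entry (k l : nat) T : C := inner (E k) (T (E l)).

Lemma entry_linear k l :
  is_linear (U := bop_NormedModule) (V := C_NormedModule) (entry k l).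
Proof.
  split.
  - intros S T. apply inner_plus_r.
  - intros z T. apply inner_scal_r.
  - exists 1. split; [lra|]. intro T. rewrite Rmult_1_l.
    eapply Rle_trans; [exact (inner_cauchy_schwarz (E k) (T (E l)))|].
    rewrite basis_norm, Rmult_1_l by assumption.
    eapply Rle_trans; [apply (opnorm_bound T (E l))|].
    right. change (opnorm T * norm (E l) = opnorm T). rewrite basis_norm by assumption. ring.
Qed.

Lemma entry_bound k l T : Cmod (entry k l T) <= opnorm T.
Proof.
  eapply Rle_trans; [exact (inner_cauchy_schwarz (E k) (T (E l)))|].
  rewrite basis_norm, Rmult_1_l by assumption.
  eapply Rle_trans; [apply (opnorm_bound T (E l))|].
  right. change (opnorm T * norm (E l) = opnorm T). rewrite basis_norm by assumption. ring.
Qed.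

Lemma entry_plus k l S T : entry k l (plus S T) = Cplus (entry k l S) (entry k l T).
Proof. apply inner_plus_r. Qed.

Lemma entry_scal k l z T : entry k l (scal z T) = Cmult z (entry k l T).
Proof. apply inner_scal_r. Qed.

Lemma entry_minus k l S T : entry k l (minus S T) = Cminus (entry k l S) (entry k l T).
Proof. apply inner_minus_r. Qed.

Lemma entry_sum_n k l (a : nat -> bounded_op H) n :
  entry k l (sum_n a n) = sum_n (fun j => entry k l (a j)) n.
Proof. unfold entry. rewrite bop_sum_n_apply. apply inner_sum_n_r. Qed.

Lemma entry_limit k l (s : nat -> bounded_op H) T :
  filterlim s eventually (locally T) ->
  filterlim (fun n => entry k l (s n)) eventually (locally (T := C_UniformSpace) (entry k l T)).
Proof.
  intro Hs. eapply filterlim_comp; [exact Hs|].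
  exact (linear_cont (entry k l) T (entry_linear k l)).
Qed.

(** Identifies norm limits entrywise when each entry is eventually stationary, as for partial sums
    of matrix units or of powers of the shift. *)
Lemma entry_limit_const k l (s : nat -> bounded_op H) T z :
  filterlim s eventually (locally T) -> eventually (fun n => entry k l (s n) = z) ->
  entry k l T = z.
Proof.
  intros Hs Hz. apply (filterlim_locally_unique (V := C_NormedModule)
    (F := eventually) (fun n => entry k l (s n))).
  - exact (entry_limit k l s T Hs).
  - apply (filterlim_ext_loc (fun _ => z)); [|apply filterlim_const].
    destruct Hz as [N HN]. exists N. intros n Hn. symmetry. apply HN, Hn.
Qed.

Lemma bop_ext_entry S T : (forall k l, entry k l S = entry k l T) -> S = T.
Proof.
  intro HST. apply (bop_ext_basis E HE). intro l. apply (eq_of_basis E HE). intro k. apply HST.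
Qed.

Lemma entry_matrix_unit k l i j :
  entry k l (matrix_unit E i j) = if (Nat.eqb k i && Nat.eqb l j)%bool then RtoC 1 else RtoC 0.
Proof.
  unfold entry. rewrite (matrix_unit_basis E i j l HE), (Nat.eqb_sym l j).
  destruct (Nat.eqb j l).
  - rewrite (basis_orthonormal E HE), Bool.andb_true_r. destruct (Nat.eqb k i); reflexivity.
  - rewrite Bool.andb_false_r. exact (inner_zero_r (E k)).
Qed.

Lemma opnorm_matrix_unit i j : opnorm (matrix_unit E i j) <= 1.
Proof.
  apply opnorm_le; [lra|]. intro x.
  change (norm (scal (inner (E j) x) (E i)) <= 1 * norm x).
  eapply Rle_trans; [exact (norm_scal (V := H) (inner (E j) x) (E i))|].
  rewrite basis_norm, Rmult_1_r by assumption.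
  eapply Rle_trans; [exact (inner_cauchy_schwarz (E j) x)|].
  rewrite basis_norm by assumption. apply Rle_refl.
Qed.

(** Diagonal operator with entries [d 0, ..., d n, d n, d n, ...]; eventual constancy makes it
    a finite combination of the identity and matrix units. *)
Definition diag_op (n : nat) (d : nat -> R) : bounded_op H :=
  plus (scal (RtoC (d n)) (one : bounded_op H))
    (sum_n (fun k => scal (RtoC (d k - d n)) (matrix_unit E k k)) n).

Lemma scal_zero_hilbert (x : H) : scal (RtoC 0 : C) x = zero.
Proof. exact (scal_zero_l (x : NormedModule.sort _ H)). Qed.

Lemma scal_zero_r_hilbert (k : C) : scal k (zero : H) = zero.
Proof. exact (scal_zero_r (V := H) k). Qed.

Lemma scal_distr_hilbert (k j : C) (x : H) : plus (scal k x) (scal j x) = scal (Cplus k j) x.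
Proof. symmetry. exact (scal_distr_r k j (x : NormedModule.sort _ H)). Qed.

Lemma diag_op_basis n d l : (diag_op n d (E l) : H) = scal (RtoC (d (min l n))) (E l).
Proof.
  unfold diag_op.
  change (plus (scal (RtoC (d n)) (E l))
    (bop_fun H (sum_n (fun k => scal (RtoC (d k - d n)) (matrix_unit E k k)) n) (E l) : H)
    = scal (RtoC (d (min l n))) (E l)).
  rewrite bop_sum_n_apply.
  assert (Hs : forall m, sum_n (fun k => bop_fun H (scal (RtoC (d k - d n)) (matrix_unit E k k))
    (E l) : H) m
    = scal (RtoC (if Nat.leb l m then d l - d n else 0)) (E l)).
  { assert (Ht : forall k, (bop_fun H (scal (RtoC (d k - d n)) (matrix_unit E k k)) (E l) : H)
      = scal (RtoC (if Nat.eqb k l then d l - d n else 0)) (E l)).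
    { intro k. change (scal (RtoC (d k - d n)) (matrix_unit E k k (E l) : H)
        = scal (RtoC (if Nat.eqb k l then d l - d n else 0)) (E l)).
      rewrite (matrix_unit_basis E k k l HE).
      destruct (Nat.eqb_spec k l) as [->|_]; [reflexivity|].
      rewrite scal_zero_hilbert. exact (scal_zero_r_hilbert _). }
    induction m as [|m IH].
    - rewrite sum_O, Ht. destruct l; reflexivity.
    - rewrite sum_Sn, IH, Ht, scal_distr_hilbert, <- RtoC_plus. do 2 f_equal.
      destruct (Nat.leb_spec l m), (Nat.eqb_spec (S m) l), (Nat.leb_spec l (S m)); try lia; ring. }
  rewrite Hs, scal_distr_hilbert, <- RtoC_plus. do 2 f_equal.
  destruct (Nat.leb_spec l n).
  - rewrite Nat.min_l by assumption. ring.
  - rewrite Nat.min_r by lia. ring.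
Qed.

Lemma opnorm_diag_op n d M : 0 <= M -> (forall k, Rabs (d k) <= M) -> opnorm (diag_op n d) <= M.
Proof.
  intros HM Hd. apply (opnorm_diag E HE _ (fun k => RtoC (d (min k n)))); [assumption| |].
  - apply diag_op_basis.
  - intro k. rewrite Cmod_R. apply Hd.
Qed.

Lemma entry_mult_diag_op_r k l T n d :
  entry k l (mult T (diag_op n d)) = Cmult (RtoC (d (min l n))) (entry k l T).
Proof.
  unfold entry. change (inner (E k) (T (diag_op n d (E l)))
    = Cmult (RtoC (d (min l n))) (inner (E k) (T (E l)))).
  now rewrite diag_op_basis, bop_map_scal, inner_scal_r.
Qed.

(** Only the action of [diag_op] on basis vectors is known so far, so the functional [inner (E k)]
    is realised as the operator [matrix_unit E 0 k]. The claim becomes an identity of operators,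
    checked on entries and read back as the coefficient of [E 0]. *)
Lemma inner_diag_op n d k x : inner (E k) (diag_op n d x)
  = Cmult (RtoC (d (min k n))) (inner (E k) x).
Proof.
  assert (Hm : mult (matrix_unit E 0 k) (diag_op n d)
    = scal (RtoC (d (min k n))) (matrix_unit E 0 k)).
  { apply bop_ext_entry. intros i j. rewrite entry_mult_diag_op_r, entry_scal, !entry_matrix_unit.
    destruct (Nat.eqb_spec j k) as [->|_]; [reflexivity|].
    rewrite Bool.andb_false_r. apply injective_projections; simpl; ring. }
  assert (Hx : (mult (matrix_unit E 0 k) (diag_op n d) x : H)
    = scal (RtoC (d (min k n))) (matrix_unit E 0 k x : H))
    by (rewrite Hm; reflexivity).
  change (scal (inner (E k) (diag_op n d x)) (E 0%nat)
    = scal (RtoC (d (min k n))) (scal (inner (E k) x) (E 0%nat))) in Hx.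
  apply (f_equal (inner (E 0%nat))) in Hx.
  rewrite !inner_scal_r, (basis_orthonormal E HE) in Hx. simpl in Hx.
  now rewrite !Cmult_1_r in Hx.
Qed.

Lemma entry_mult_diag_op_l k l T n d :
  entry k l (mult (diag_op n d) T) = Cmult (RtoC (d (min k n))) (entry k l T).
Proof. apply inner_diag_op. Qed.

End Operators.

(** * Completeness of the space of bounded operators *)

Section Completeness.

Context {V : CompleteNormedModule C_AbsRing}.

(** The limit is taken pointwise in [V]; the Cauchy condition makes the convergence uniform relative
    to [norm x], which yields both boundedness of the limit and convergence in norm. Filters replace
    sequences because the completeness structure is formulated with them. *)
Lemma bop_complete (F : (bounded_op V -> Prop) -> Prop) :
  ProperFilter F -> cauchy F ->
  exists T : bounded_op V, forall eps : posreal, F (fun S => opnorm (minus S T) < eps).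
Proof.
  intros FF HF.
  assert (HFc : forall eps : posreal, exists S : bounded_op V, F (fun T => opnorm (minus T S) <
    eps)) by exact HF.
  set (Fx := fun (x : V) (P : V -> Prop) => F (fun S => P (S x : V))).
  assert (FFx : forall x, ProperFilter (Fx x)) by (intro x;
    exact (filtermap_proper_filter (bounded_op V) V (fun S : bounded_op V => (S x : V)) F FF)).
  assert (Hd : forall (S T : bounded_op V) (x : V),
    norm (minus (T x : V) (S x)) <= opnorm (minus T S) * norm x).
  { intros S T x. exact (opnorm_bound (minus T S) x). }
  assert (Hx : forall x, cauchy (T := CompleteNormedModule.UniformSpace _ V) (Fx x)).
  { intros x eps. pose proof (norm_ge_0 x).
    assert (He : 0 < eps / (norm x + 1)) by (apply Rdiv_lt_0_compat; [apply cond_pos|lra]).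
    destruct (HFc (mkposreal _ He)) as [S HS]. exists (S x).
    unfold Fx. revert HS. apply filter_imp. intros T HT. simpl in HT.
    apply (norm_compat1 (V := V)). eapply Rle_lt_trans; [apply Hd|].
    apply Rle_lt_trans with (eps / (norm x + 1) * norm x); [apply Rmult_le_compat_r; lra|].
    apply Rlt_le_trans with (eps / (norm x + 1) * (norm x + 1)); [apply Rmult_lt_compat_l; lra|].
    right. field. lra. }
  set (t := fun x : V => lim (Fx x) : V).
  assert (Ht : forall x (eps : posreal), F (fun S => norm (minus (S x : V) (t x)) < eps)).
  { intros x eps. pose proof (norm_factor_gt_0 (V := V)) as Hf.
    assert (He : 0 < eps / (@norm_factor _ V)) by (apply Rdiv_lt_0_compat;
      [apply cond_pos|assumption]).
    pose proof (complete_cauchy (Fx x) (FFx x) (Hx x) (mkposreal _ He)) as Hc.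
    change (F (fun S : bounded_op V => ball (t x) (mkposreal _ He) (S x : V))) in Hc.
    revert Hc. apply filter_imp. intros S HS. apply (norm_compat2 (V := V)) in HS. simpl in HS.
    apply Rlt_le_trans with (1 := HS). right. field. lra. }
  assert (Hlim : forall x, filterlim (fun S : bounded_op V => (S x : V)) F (locally (t x))).
  { intros x P HP. destruct (locally_norm_le_locally (V := V) (t x) P HP) as [eps HP'].
    unfold filtermap. generalize (Ht x eps). apply filter_imp. intros S HS. apply HP'. exact HS. }
  (* For each [x] an auxiliary [S'] is taken from the filter, close to [S0] in norm and close to
     [t x] at [x]. It depends on [x], but the resulting bound does not, so the estimate holds for
     all [x] at once. *)
  assert (Hclose : forall eps : posreal, F (fun S => forall x, norm (minus (S x : V) (t x))
    <= eps * norm x)).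
  { intro eps. destruct (HFc (pos_div_2 eps)) as [S0 HS0].
    generalize HS0. apply filter_imp. intros S HS x. simpl in HS.
    apply le_epsilon. intros d Hdp.
    destruct (filter_ex _ (filter_and _ _ HS0 (Ht x (mkposreal d Hdp)))) as [S' [H1 H2]].
    simpl in H1, H2. pose proof (norm_ge_0 x).
    rewrite (minus_trans (S' x : V)).
    eapply Rle_trans; [apply (norm_triangle (V := V))|]. apply Rplus_le_compat; [|left; exact H2].
    eapply Rle_trans; [apply Hd|]. apply Rmult_le_compat_r; [assumption|].
    rewrite (minus_trans S0). rewrite <- (opp_minus S' S0).
    eapply Rle_trans; [exact (opnorm_plus _ _)|].
    pose proof (opnorm_opp (minus S' S0)) as Ho.
    change (opnorm (opp (minus S' S0)) <= opnorm (minus S' S0)) in Ho.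
    lra. }
  assert (Hlin : is_linear t).
  { split.
    - intros x y. apply (filterlim_locally_unique (F := F) (fun S : bounded_op V => S (plus x y)
      : V)).
      + apply Hlim.
      + apply (filterlim_ext (fun S : bounded_op V => plus (S x) (S y))).
        * intro S. symmetry. apply (linear_plus S (bop_linear S)).
        * eapply filterlim_comp_2; [apply Hlim|apply Hlim|apply (filterlim_plus (V := V))].
    - intros k x. apply (filterlim_locally_unique (F := F) (fun S : bounded_op V => S (scal k x)
      : V)).
      + apply Hlim.
      + apply (filterlim_ext (fun S : bounded_op V => scal k (S x))).
        * intro S. symmetry. apply (linear_scal S (bop_linear S)).
        * eapply filterlim_comp; [apply Hlim|apply (filterlim_scal_r (V := V))].
    - destruct (filter_ex _ (Hclose (mkposreal 1 Rlt_0_1))) as [S HS]. simpl in HS.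
      pose proof (opnorm_ge_0 S).
      exists (opnorm S + 1). split; [lra|]. intro x. specialize (HS x).
      pose proof (opnorm_bound S x) as Hb.
      assert (Ht' : norm (t x) <= norm (minus (S x : V) (t x)) + norm (S x : V)).
      { rewrite <- (norm_opp (minus (S x : V) (t x))), opp_minus.
        exact (norm_le_minus (V := V) (t x) (S x)). }
      change (norm (t x) <= (opnorm S + 1) * norm x). lra. }
  exists (Bop _ Hlin). intro eps.
  generalize (Hclose (pos_div_2 eps)). apply filter_imp. intros S HS. simpl in HS.
  apply Rle_lt_trans with (eps / 2); [|pose proof (cond_pos eps); lra].
  apply opnorm_le; [pose proof (cond_pos eps); lra|]. intro x. exact (HS x).
Qed.

(** The structure demands a limit for every filter, so a choice operator supplies one, with an
    unspecified value where no limit exists. *)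
Definition bop_lim (F : (bounded_op V -> Prop) -> Prop) : bounded_op V :=
  epsilon (inhabits zero) (fun T => forall eps : posreal, F (fun S => opnorm (minus S T) < eps)).

Definition bop_CompleteSpace_mixin : CompleteSpace.mixin_of (bop_UniformSpace (V := V)).
Proof.
  apply (CompleteSpace.Mixin _ bop_lim).
  - intros F FF HF. exact (epsilon_spec _ _ (bop_complete F FF HF)).
  (* Filters included in each other are equal as predicates, so [epsilon] chooses the same limit for
     both. *)
  - intros F1 F2 H12 H21. assert (F1 = F2) as ->.
    { apply functional_extensionality. intro P. apply propositional_extensionality.
      split; [apply H21|apply H12]. }
    intro eps. apply ball_center.
Defined.

Definition bop_CompleteNormedModule : CompleteNormedModule C_AbsRing :=
  CompleteNormedModule.Pack C_AbsRing (bounded_op V)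
    (CompleteNormedModule.Class C_AbsRing (bounded_op V)
      (NormedModule.class _ (bop_NormedModule (V := V))) bop_CompleteSpace_mixin) (bounded_op V).

(** Existence of integrals over a real parameter is a statement about complete real normed modules;
    the scalars are restricted while norm and limits stay the same. *)
Definition bop_real_CompleteNormedModule : CompleteNormedModule R_AbsRing :=
  CompleteNormedModule.Pack R_AbsRing (bounded_op V)
    (CompleteNormedModule.Class R_AbsRing (bounded_op V)
      (NormedModule.class _ (real_NormedModule (bop_NormedModule (V := V))))
        bop_CompleteSpace_mixin)
    (bounded_op V).

End Completeness.

(** * Rapidly decaying matrices *)

Lemma minus_minus_cancel {G : AbelianGroup} (x y : G) : x = minus y (minus y x).
Proof.
  unfold minus at 1. rewrite (opp_minus y x), plus_comm. symmetry. apply plus_minus_cancel.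
Qed.

Lemma plus_plus_minus {G : AbelianGroup} (q x y : G) : minus (plus (plus q x) y) q = plus y x.
Proof.
  unfold minus. rewrite (plus_comm _ (opp q)), !plus_assoc, plus_opp_l, plus_zero_l.
  apply plus_comm.
Qed.

(** Comparison with telescoping differences gives [2 - / (1 + INR n)]. The factor 2 in
    [sum_n_sqr_bound] and in the bounds derived from it comes from here. *)
Lemma sum_n_inv_sqr_le n : sum_n (fun k => / (1 + INR k) ^ 2) n <= 2.
Proof.
  assert (Hs : sum_n (fun k => / (1 + INR k) ^ 2) n <= 2 - / (1 + INR n)).
  { induction n as [|n IH].
    - rewrite sum_O. simpl. lra.
    - rewrite sum_Sn. rewrite S_INR. pose proof (pos_INR n).
      change plus with Rplus.
      assert (/ (1 + (INR n + 1)) ^ 2 <= / (1 + INR n) - / (1 + (INR n + 1))); [|lra].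
      replace (/ (1 + INR n) - / (1 + (INR n + 1))) with (/ ((1 + INR n) * (1 + (INR n + 1)))) by
        (field; lra).
      apply Rinv_le_contravar; nra. }
  pose proof (pos_INR n). assert (0 < / (1 + INR n)) by (apply Rinv_0_lt_compat; lra). lra.
Qed.

Lemma ex_series_inv_sqr (B : R) : ex_series (fun k => B * / (1 + INR k) ^ 2).
Proof.
  apply (ex_series_scal (K := R_AbsRing) (V := R_NormedModule) B (fun k => / (1 + INR k) ^ 2)).
  apply (ex_finite_lim_seq_incr (sum_n (fun k => / (1 + INR k) ^ 2)) 2); [|exact sum_n_inv_sqr_le].
  intro n. rewrite sum_Sn. change plus with Rplus. pose proof (pos_INR (S n)).
  assert (0 < / (1 + INR (S n)) ^ 2) by (apply Rinv_0_lt_compat; nra). lra.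
Qed.

Lemma sum_n_Rle (u v : nat -> R) n : (forall k, u k <= v k) -> sum_n u n <= sum_n v n.
Proof. intro Huv. unfold sum_n. now apply sum_n_m_le. Qed.

Lemma sum_n_Rscal (c : R) (u : nat -> R) n : sum_n (fun k => c * u k) n = c * sum_n u n.
Proof. exact (sum_n_mult_l (K := R_Ring) c u n). Qed.

Lemma sum_n_sqr_bound (u : nat -> R) (B : R) n : 0 <= B ->
  (forall k, u k <= B * / (1 + INR k) ^ 2) -> sum_n u n <= 2 * B.
Proof.
  intros HB Hu. eapply Rle_trans; [apply sum_n_Rle, Hu|].
  rewrite sum_n_Rscal. pose proof (sum_n_inv_sqr_le n). nra.
Qed.

Lemma sum_n_const_R (c : R) n : sum_n (fun _ => c) n = (INR n + 1) * c.
Proof. rewrite sum_n_const. now rewrite S_INR. Qed.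

Lemma weight_pos k : 0 < 1 + INR k.
Proof. pose proof (pos_INR k). lra. Qed.

Lemma weight_pow_pos k M : 0 < (1 + INR k) ^ M.
Proof. apply pow_lt, weight_pos. Qed.

Lemma weight_pow_ge_1 k M : 1 <= (1 + INR k) ^ M.
Proof. apply pow_R1_Rle. pose proof (pos_INR k). lra. Qed.

Lemma rapid_decay_bound (c : nat -> nat -> C) M N : rapid_decay c ->
  exists B, 0 <= B /\ forall k l, (1 + INR k) ^ M * (1 + INR l) ^ N * Cmod (c k l) <= B.
Proof.
  intro Hc. destruct (Hc M N) as [B HB]. exists B. split; [|exact HB].
  eapply Rle_trans; [|apply (HB 0%nat 0%nat)].
  apply Rmult_le_pos; [|apply Cmod_ge_0].
  apply Rmult_le_pos; left; apply weight_pow_pos.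
Qed.

Lemma rapid_decay_plus c d : rapid_decay c -> rapid_decay d ->
  rapid_decay (fun k l => Cplus (c k l) (d k l)).
Proof.
  intros Hc Hd M N. destruct (Hc M N) as [B HB], (Hd M N) as [D HD].
  exists (B + D). intros k l. specialize (HB k l). specialize (HD k l).
  pose proof (weight_pow_pos k M). pose proof (weight_pow_pos l N).
  pose proof (Cmod_triangle (c k l) (d k l)).
  assert (0 < (1 + INR k) ^ M * (1 + INR l) ^ N) by now apply Rmult_lt_0_compat.
  nra.
Qed.

Lemma rapid_decay_scal z c : rapid_decay c -> rapid_decay (fun k l => Cmult z (c k l)).
Proof.
  intros Hc M N. destruct (Hc M N) as [B HB].
  exists (Cmod z * B). intros k l. specialize (HB k l).
  rewrite Cmod_mult. pose proof (Cmod_ge_0 z). nra.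
Qed.

Lemma rapid_decay_ext c d : (forall k l, c k l = d k l) -> rapid_decay c -> rapid_decay d.
Proof.
  intros Hcd Hc M N. destruct (Hc M N) as [B HB]. exists B. intros k l. rewrite <- Hcd. apply HB.
Qed.

Section RapidOperators.

Context {H : HilbertSpace} (E : nat -> H) (HE : is_orthonormal_basis E).
Implicit Types S T : bounded_op H.

Definition rapid_op T : Prop := rapid_decay (fun k l => entry E k l T).

(** The sums run over squares because [smooth_compact] takes the limit of exactly these. *)
Definition square_sum (c : nat -> nat -> C) (N : nat) : bounded_op H :=
  sum_n (fun k => (sum_n (fun l => (scal (c k l) (matrix_unit E k l) : bounded_op H)) N :
    bounded_op H)) N.

Lemma entry_square_sum c N k l :
  entry E k l (square_sum c N) = if (Nat.leb k N && Nat.leb l N)%bool then c k l else RtoC 0.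
Proof.
  assert (Hd : forall (u : nat -> C) j n,
    sum_n (fun i => if Nat.eqb j i then u i else RtoC 0) n = if Nat.leb j n then u j else RtoC 0).
  { intros u j. induction n as [|n IH].
    - rewrite sum_O. destruct j; reflexivity.
    - rewrite sum_Sn, IH.
      destruct (Nat.leb_spec j n), (Nat.eqb_spec j (S n)), (Nat.leb_spec j (S n)); try lia; subst.
      + apply Cplus_0_r.
      + apply Cplus_0_l.
      + apply Cplus_0_r. }
  unfold square_sum. rewrite entry_sum_n.
  transitivity (sum_n (fun i => if Nat.eqb k i then (if Nat.leb l N then c i l else RtoC 0) else
    RtoC 0) N).
  - apply sum_n_ext. intro i. rewrite entry_sum_n, <- Hd.
    destruct (Nat.eqb_spec k i) as [->|Hki].
    + apply sum_n_ext. intro j. rewrite entry_scal, entry_matrix_unit, Nat.eqb_refl by assumption.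
      simpl. destruct (Nat.eqb l j); [apply Cmult_1_r|apply Cmult_0_r].
    + apply (sum_n_zero (G := C_AbelianGroup)). intros j _.
      rewrite entry_scal, entry_matrix_unit by assumption.
      rewrite (proj2 (Nat.eqb_neq k i) Hki). apply Cmult_0_r.
  - rewrite Hd. destruct (Nat.leb k N), (Nat.leb l N); reflexivity.
Qed.

(** The next square adds one row and one column, fewer than [2 * w] matrix units of norm at most 1
    for [w = 1 + INR (S N)], each with a coefficient at most [B / w ^ 3]. Of the exponent 3, one
    power pays for the number of terms and two remain for summability. *)
Lemma square_sum_increment_bound c B N :
  (forall k l, (1 + INR k) ^ 3 * (1 + INR l) ^ 3 * Cmod (c k l) <= B) ->
  opnorm (minus (square_sum c (S N)) (square_sum c N)) <= 2 * B * / (1 + INR (S N)) ^ 2.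
Proof.
  intro Hc. set (w := 1 + INR (S N)).
  assert (Hw : 0 < w) by apply weight_pos.
  assert (Hb : forall k l, k = S N \/ l = S N -> Cmod (c k l) <= B * / w ^ 3).
  { intros k l Hkl. specialize (Hc k l).
    pose proof (weight_pow_ge_1 k 3). pose proof (weight_pow_ge_1 l 3).
      pose proof (Cmod_ge_0 (c k l)).
    assert (0 < w ^ 3) by now apply pow_lt.
    apply Rmult_le_reg_l with (w ^ 3); [assumption|].
    replace (w ^ 3 * (B * / w ^ 3)) with B by (field; lra).
    eapply Rle_trans; [|exact Hc]. apply Rmult_le_compat_r; [assumption|].
    unfold w. destruct Hkl as [->| ->]; nra. }
  assert (Hm : minus (square_sum c (S N)) (square_sum c N)
    = plus (sum_n (fun l => (scal (c (S N) l) (matrix_unit E (S N) l) : bounded_op H)) (S N))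
           (sum_n (fun k => (scal (c k (S N)) (matrix_unit E k (S N)) : bounded_op H)) N)).
  { unfold square_sum. rewrite sum_Sn.
    assert (Hs : sum_n (fun k => (sum_n (fun l => (scal (c k l) (matrix_unit E k l) : bounded_op
      H)) (S N) : bounded_op H)) N
      = plus (square_sum c N) (sum_n (fun k => (scal (c k (S N)) (matrix_unit E k (S N)) :
        bounded_op H)) N)).
    { unfold square_sum. rewrite <- sum_n_plus. apply sum_n_ext. intro k. apply sum_Sn. }
    rewrite Hs. exact (plus_plus_minus (G := bop_AbelianGroup) _ _ _). }
  assert (Ho : forall k l, k = S N \/ l = S N ->
    opnorm (scal (c k l) (matrix_unit E k l)) <= B * / w ^ 3).
  { intros k l Hkl. eapply Rle_trans; [apply opnorm_scal_le, (opnorm_matrix_unit E HE)|].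
    rewrite Rmult_1_r. now apply Hb. }
  rewrite Hm.
  assert (HB : 0 <= B * / w ^ 3) by (eapply Rle_trans; [apply Cmod_ge_0|apply (Hb (S N) (S N));
    auto]).
  replace (2 * B * / w ^ 2) with (w * (B * / w ^ 3) + w * (B * / w ^ 3)) by (field; lra).
  apply opnorm_plus_le.
  - eapply Rle_trans; [apply (opnorm_sum_n _ (fun _ => B * / w ^ 3)); intro; apply Ho; auto|].
    rewrite sum_n_const_R. right. unfold w. ring.
  - eapply Rle_trans; [apply (opnorm_sum_n _ (fun _ => B * / w ^ 3)); intro; apply Ho; auto|].
    rewrite sum_n_const_R. apply Rmult_le_compat_r; [assumption|]. unfold w. rewrite S_INR. lra.
Qed.

Lemma series_of_increments (s : nat -> bounded_op H) n :
  sum_n (fun k => match k with O => s O | S j => minus (s k) (s j) end) n = s n.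
Proof.
  induction n as [|n IH].
  - now rewrite sum_O.
  - rewrite sum_Sn, IH, plus_comm. exact (plus_minus_cancel (G := bop_AbelianGroup) _ _).
Qed.

(** The increments are absolutely summable, so completeness gives a norm limit; it has the entries
    of [T] because each entry of the partial sums is stationary from [max k l] on. *)
Lemma rapid_op_limit T : rapid_op T ->
  filterlim (square_sum (fun k l => entry E k l T)) eventually (locally T).
Proof.
  intro HT. set (c := fun k l => entry E k l T).
  destruct (rapid_decay_bound c 3 3 HT) as [B [HB0 HB]].
  set (a := fun k => match k with O => square_sum c O
    | S j => minus (square_sum c k) (square_sum c j) end).
  assert (Ha : ex_series (K := C_AbsRing) (V := bop_NormedModule) a).
  { apply (ex_series_le (V := bop_CompleteNormedModule) a
      (fun k => (2 * B + opnorm (a O)) * / (1 + INR k) ^ 2)); [|apply ex_series_inv_sqr].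
    intro n. change (opnorm (a n) <= (2 * B + opnorm (a O)) * / (1 + INR n) ^ 2).
    pose proof (opnorm_ge_0 (a O)).
    destruct n as [|n].
    - simpl INR. replace (/ (1 + 0) ^ 2) with 1 by field. lra.
    - eapply Rle_trans; [apply (square_sum_increment_bound c B n HB)|].
      apply Rmult_le_compat_r; [|lra].
      left. apply Rinv_0_lt_compat, weight_pow_pos. }
  destruct Ha as [T' HT'].
  assert (Hl : filterlim (square_sum c) eventually (locally T')).
  { eapply filterlim_ext; [|exact HT']. intro n. apply series_of_increments. }
  assert (T' = T) as <-; [|exact Hl].
  apply (bop_ext_entry E HE). intros k l. change (entry E k l T) with (c k l).
  apply (entry_limit_const E HE k l (square_sum c) T' (c k l) Hl).
  exists (max k l). intros n Hn. rewrite entry_square_sum.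
  rewrite !(proj2 (Nat.leb_le _ _)) by lia. reflexivity.
Qed.

Lemma rapid_op_smooth_compact T : rapid_op T -> smooth_compact E T.
Proof. intro HT. exists (fun k l => entry E k l T). split;
  [exact HT|exact (rapid_op_limit T HT)]. Qed.

Lemma smooth_compact_rapid_op T : smooth_compact E T -> rapid_op T.
Proof.
  intros [c [Hc HT]]. apply (rapid_decay_ext c); [|exact Hc].
  intros k l. symmetry. apply (entry_limit_const E HE k l (square_sum c) T (c k l) HT).
  exists (max k l). intros n Hn. rewrite entry_square_sum.
  rewrite !(proj2 (Nat.leb_le _ _)) by lia. reflexivity.
Qed.

(** * Truncated diagonal weights and their inverses *)

Definition weight (n i : nat) : bounded_op H := diag_op E n (fun k => (1 + INR k) ^ i).
Definition weight_inv (n i : nat) : bounded_op H := diag_op E n (fun k => / (1 + INR k) ^ i).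

Lemma entry_weight_l n i k l T :
  entry E k l (mult (weight n i) T) = Cmult (RtoC ((1 + INR (min k n)) ^ i)) (entry E k l T).
Proof. exact (entry_mult_diag_op_l E HE k l T n _). Qed.

Lemma entry_weight_r n i k l T :
  entry E k l (mult T (weight n i)) = Cmult (RtoC ((1 + INR (min l n)) ^ i)) (entry E k l T).
Proof. exact (entry_mult_diag_op_r E HE k l T n _). Qed.

Lemma entry_weight_inv_l n i k l T :
  entry E k l (mult (weight_inv n i) T) = Cmult (RtoC (/ (1 + INR (min k n)) ^ i)) (entry E k l T).
Proof. exact (entry_mult_diag_op_l E HE k l T n (fun k => / (1 + INR k) ^ i)). Qed.

Lemma entry_weight_inv_r n i k l T :
  entry E k l (mult T (weight_inv n i)) = Cmult (RtoC (/ (1 + INR (min l n)) ^ i)) (entry E k l T).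
Proof. exact (entry_mult_diag_op_r E HE k l T n (fun k => / (1 + INR k) ^ i)). Qed.

Lemma weight_0 n : weight n 0 = one.
Proof.
  apply (bop_ext_entry E HE). intros k l.
  rewrite <- (mult_one_r (weight n 0)), entry_weight_l. simpl. apply Cmult_1_l.
Qed.

Lemma weight_inv_weight n i : mult (weight_inv n i) (weight n i) = one.
Proof.
  apply (bop_ext_entry E HE). intros k l.
  rewrite <- (mult_one_r (mult _ _)), <- mult_assoc, entry_weight_inv_l, entry_weight_l.
  rewrite Cmult_assoc, <- RtoC_mult, Rinv_l; [apply Cmult_1_l|].
  pose proof (weight_pow_pos (min k n) i). lra.
Qed.

Lemma weight_weight_inv n i : mult (weight n i) (weight_inv n i) = one.
Proof.
  apply (bop_ext_entry E HE). intros k l.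
  rewrite <- (mult_one_r (mult _ _)), <- mult_assoc, entry_weight_l, entry_weight_inv_l.
  rewrite Cmult_assoc, <- RtoC_mult, Rinv_r; [apply Cmult_1_l|].
  pose proof (weight_pow_pos (min k n) i). lra.
Qed.

Lemma opnorm_weight_inv n i : opnorm (weight_inv n i) <= 1.
Proof.
  apply (opnorm_diag_op E HE); [lra|]. intro k.
  pose proof (weight_pow_ge_1 k i).
  rewrite Rabs_pos_eq; [|left; apply Rinv_0_lt_compat; lra].
  eapply Rle_trans; [apply (Rinv_le_contravar 1); lra|]. rewrite Rinv_1. apply Rle_refl.
Qed.

Lemma mult_minus_distr_l (S T W : bounded_op H)  :
  mult S (minus T W) = minus (mult S T : bounded_op H) (mult S W : bounded_op H).
Proof. apply bop_ext. intro x. exact (bop_map_minus S (T x) (W x)). Qed.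

Lemma mult_minus_distr_r (S T W : bounded_op H)  :
  mult (minus S T) W = minus (mult S W : bounded_op H) (mult T W : bounded_op H).
Proof. apply bop_ext. intro x. reflexivity. Qed.

(** Supplies the Lipschitz hypothesis of [opnorm_limit_le] for a norm weighted on both sides. *)
Lemma weighted_lipschitz (P Q : bounded_op H) A B :
  opnorm (mult P (mult A Q)) <= opnorm (mult P (mult B Q)) + opnorm P * opnorm Q * opnorm (minus
    B A).
Proof.
  assert (mult P (mult A Q) = minus (mult P (mult B Q) : bounded_op H)
    (mult P (mult (minus B A) Q) : bounded_op H)) as ->.
  { rewrite mult_minus_distr_r, mult_minus_distr_l.
    exact (minus_minus_cancel (G := bop_AbelianGroup) _ _). }
  apply opnorm_minus_le; [apply Rle_refl|].
  eapply Rle_trans; [apply opnorm_mult_le; [apply Rle_refl|apply opnorm_mult]|]. right. ring.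
Qed.

Lemma min_weight_le k n i : (1 + INR (min k n)) ^ i <= (1 + INR k) ^ i.
Proof.
  apply pow_incr. split; [left; apply weight_pos|]. apply Rplus_le_compat_l, le_INR. lia.
Qed.

(** Two surplus powers of each index are spent on summing the double series over matrix units,
    whence [M + 2], [N + 2] and the two factors 2. The bound is free of [n] because truncation only
    lowers a weight. *)
Lemma rapid_op_weighted_bound T M N : rapid_op T ->
  exists B, forall n, opnorm (mult (weight n M) (mult T (weight n N))) <= B.
Proof.
  intro HT. set (c := fun k l => entry E k l T).
  destruct (rapid_decay_bound c (M + 2) (N + 2) HT) as [B [HB0 HB]].
  exists (2 * (2 * B)). intro n. set (P := weight n M). set (Q := weight n N).
  apply (opnorm_limit_le (fun A => opnorm (mult P (mult A Q))) (opnorm P * opnorm Q) (2 * (2 * B))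
           (square_sum c) T).
  - apply Rmult_le_pos; apply opnorm_ge_0.
  - intros A A'. apply weighted_lipschitz.
  - now apply rapid_op_limit.
  - intro m.
    assert (Hu : forall k l, opnorm (mult P (mult (scal (c k l) (matrix_unit E k l)) Q))
      <= B * / (1 + INR k) ^ 2 * / (1 + INR l) ^ 2).
    { intros k l.
      assert (mult P (mult (scal (c k l) (matrix_unit E k l)) Q)
        = scal (Cmult (RtoC ((1 + INR (min k n)) ^ M * (1 + INR (min l n)) ^ N)) (c k l))
            (matrix_unit E k l)) as ->.
      { apply (bop_ext_entry E HE). intros i j. unfold P, Q.
        rewrite entry_weight_l, entry_weight_r, !entry_scal, entry_matrix_unit by assumption.
        destruct (Nat.eqb_spec i k) as [->|]; destruct (Nat.eqb_spec j l) as [->|]; simpl;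
          apply injective_projections; simpl; ring. }
      eapply Rle_trans; [apply opnorm_scal_le, (opnorm_matrix_unit E HE)|].
      rewrite Rmult_1_r, Cmod_mult, Cmod_R, Rabs_pos_eq
        by (apply Rmult_le_pos; left; apply weight_pow_pos).
      specialize (HB k l). rewrite !pow_add in HB.
      pose proof (weight_pow_pos k 2). pose proof (weight_pow_pos l 2).
      apply Rmult_le_reg_l with ((1 + INR k) ^ 2 * (1 + INR l) ^ 2);
        [now apply Rmult_lt_0_compat|].
      replace ((1 + INR k) ^ 2 * (1 + INR l) ^ 2 * (B * / (1 + INR k) ^ 2 * / (1 + INR l) ^ 2))
        with B by (field; split; apply Rgt_not_eq, weight_pos).
      eapply Rle_trans; [|exact HB].
      pose proof (min_weight_le k n M). pose proof (min_weight_le l n N).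
      pose proof (weight_pow_pos (min k n) M). pose proof (weight_pow_pos (min l n) N).
      pose proof (Cmod_ge_0 (c k l)).
      replace ((1 + INR k) ^ 2 * (1 + INR l) ^ 2 * ((1 + INR (min k n)) ^ M * (1 + INR (min l n))
        ^ N * Cmod (c k l)))
        with (((1 + INR (min k n)) ^ M * (1 + INR (min l n)) ^ N) * ((1 + INR k) ^ 2 * (1 + INR
          l) ^ 2 * Cmod (c k l))) by ring.
      replace ((1 + INR k) ^ M * (1 + INR k) ^ 2 * ((1 + INR l) ^ N * (1 + INR l) ^ 2) * Cmod (c
        k l))
        with (((1 + INR k) ^ M * (1 + INR l) ^ N) * ((1 + INR k) ^ 2 * (1 + INR l) ^ 2 * Cmod (c
          k l))) by ring.
      apply Rmult_le_compat_r.
      - apply Rmult_le_pos; [left; now apply Rmult_lt_0_compat|assumption].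
      - apply Rmult_le_compat; lra. }
    assert (Hdist : forall (a : nat -> bounded_op H) k,
      mult P (mult (sum_n a k) Q) = sum_n (fun j => mult P (mult (a j) Q)) k).
    { intros a k. transitivity (mult P (sum_n (fun j => mult (a j) Q) k)).
      - f_equal. symmetry. exact (sum_n_mult_r (K := bop_Ring) Q a k).
      - symmetry. exact (sum_n_mult_l (K := bop_Ring) P (fun j => mult (a j) Q) k). }
    unfold square_sum. rewrite Hdist.
    eapply Rle_trans; [apply opnorm_sum_n|].
    { intro k. rewrite Hdist. eapply Rle_trans; [apply opnorm_sum_n; intro l; apply Hu|].
      apply (sum_n_sqr_bound _ (B * / (1 + INR k) ^ 2)); [|intro; apply Rle_refl].
      apply Rmult_le_pos; [assumption|left; apply Rinv_0_lt_compat, weight_pow_pos]. }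
    apply sum_n_sqr_bound; [lra|]. intro k. right. ring.
Qed.

(** With [n = max k l] neither weight is truncated at this entry, so a bound uniform in [n] recovers
    the full polynomial weights. *)
Lemma entry_bound_of_weighted T M N B k l :
  (forall n, opnorm (mult (weight n M) (mult T (weight n N))) <= B) ->
  (1 + INR k) ^ M * (1 + INR l) ^ N * Cmod (entry E k l T) <= B.
Proof.
  intro HB. eapply Rle_trans; [|apply (HB (max k l))].
  eapply Rle_trans; [|apply (entry_bound E HE k l)].
  rewrite entry_weight_l, entry_weight_r, !Cmod_mult, !Cmod_R.
  rewrite !Nat.min_l by lia.
  rewrite !Rabs_pos_eq by (left; apply weight_pow_pos). right. ring.
Qed.

End RapidOperators.

(** * Weights and inverses *)

Lemma minus_plus_plus {G : AbelianGroup} (a b c d : G) :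
  minus (plus a b) (plus c d) = plus (minus a c) (minus b d).
Proof.
  unfold minus. rewrite opp_plus, <- !plus_assoc. f_equal.
  rewrite !plus_assoc. f_equal. apply plus_comm.
Qed.

(** The loss of one order behind all commutator estimates: moving the base by at most [m] changes
    the power [i + 1] only by a multiple of the power [i]. *)
Lemma pow_shift_bound (a b m : R) i : 1 <= a -> a <= b -> b <= a + m ->
  0 <= b ^ S i - a ^ S i <= (1 + m) ^ S i * a ^ i.
Proof.
  intros Ha Hab Hb. assert (Hm : 0 <= m) by lra. split.
  { assert (a ^ S i <= b ^ S i) by (apply pow_incr; lra). lra. }
  (* Lowering the constant by 1 closes the induction exactly: with [q = (1 + m) ^ S i],
     [(1 + m) * (q - 1) + m = (1 + m) * q - 1]. The split is [b * (b ^ S i - a ^ S i) + (b - a) * a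
     ^ S i], and [b <= (1 + m) * a] comes from [1 <= a]. *)
  assert (Hi : b ^ S i - a ^ S i <= ((1 + m) ^ S i - 1) * a ^ i).
  { induction i as [|i IH].
    - simpl. lra.
    - change (b ^ S (S i)) with (b * b ^ S i). change (a ^ S (S i)) with (a * a ^ S i).
      change ((1 + m) ^ S (S i)) with ((1 + m) * (1 + m) ^ S i).
      set (q := (1 + m) ^ S i) in *. set (p := b ^ S i) in *.
      assert (Hq : 1 <= q) by (apply pow_R1_Rle; lra).
      change (a ^ S i) with (a * a ^ i) in *. set (t := a ^ i) in *.
      assert (Ht : 0 < t) by (apply pow_lt; lra).
      apply Rle_trans with (b * ((q - 1) * t) + (b - a) * (a * t)).
      + assert (b * (p - a * t) <= b * ((q - 1) * t)) by (apply Rmult_le_compat_l; lra). lra.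
      + assert (b <= (1 + m) * a) by nra.
        assert (b * ((q - 1) * t) <= ((1 + m) * a) * ((q - 1) * t))
          by (apply Rmult_le_compat_r; [apply Rmult_le_pos; lra|assumption]).
        assert ((b - a) * (a * t) <= m * (a * t)) by (apply Rmult_le_compat_r; nra).
        lra. }
  pose proof (pow_lt a i ltac:(lra)). lra.
Qed.

Section Tame.

Context {H : HilbertSpace} (E : nat -> H) (HE : is_orthonormal_basis E).
Implicit Types S T x r : bounded_op H.

Definition commutator S T : bounded_op H := minus (mult S T : bounded_op H) (mult T S :
  bounded_op H).

(** In use [w], [wi], [vi] are the weights of exponents [i + 1], [i], [- i]. Inserting the
    cancelling pair [vi], [wi] isolates the factor [mult wi (mult r k)], to which the induction
    hypothesis applies. *)
Lemma weighted_inverse_step_l (w wi vi x r k : bounded_op H) :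
  is_inverse x r -> mult vi wi = one ->
  mult w (mult r k)
  = minus (mult r (mult w k) : bounded_op H)
      (mult r (mult (mult (commutator w x) vi) (mult wi (mult r k))) : bounded_op H).
Proof.
  intros [Hxr Hrx] Hv. unfold commutator.
  assert (mult (mult (minus (mult w x : bounded_op H) (mult x w : bounded_op H)) vi) (mult wi
    (mult r k))
    = minus (mult w k : bounded_op H) (mult x (mult w (mult r k)) : bounded_op H)) as ->.
  { transitivity (mult (minus (mult w x : bounded_op H) (mult x w : bounded_op H)) (mult (mult vi
    wi) (mult r k))); [now apply bop_ext|].
    rewrite Hv, mult_one_l, mult_minus_distr_r. apply f_equal2; [|now apply bop_ext].
    transitivity (mult w (mult (mult x r) k)); [now apply bop_ext|].
    now rewrite Hxr, mult_one_l. }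
  rewrite mult_minus_distr_l.
  assert (mult r (mult x (mult w (mult r k))) = mult w (mult r k)) as ->.
  { transitivity (mult (mult r x) (mult w (mult r k))); [now apply bop_ext|].
    now rewrite Hrx, mult_one_l. }
  exact (minus_minus_cancel (G := bop_AbelianGroup) _ _).
Qed.

(** The mirror image, for decay in the column index: [k r w - k w r = k r [w, x] r], so the
    correction now enters with a plus sign. *)
Lemma weighted_inverse_step_r (w wi vi x r k : bounded_op H) :
  is_inverse x r -> mult wi vi = one ->
  mult (mult k r) w
  = plus (mult (mult k w) r : bounded_op H)
      (mult (mult (mult k r) wi) (mult (mult vi (commutator w x)) r) : bounded_op H).
Proof.
  intros [Hxr Hrx] Hv. unfold commutator.
  assert (mult (mult (mult k r) wi) (mult (mult vi (minus (mult w x : bounded_op H) (mult x w :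
    bounded_op H))) r)
    = minus (mult (mult k r) w : bounded_op H) (mult (mult k w) r : bounded_op H)) as ->.
  { transitivity (mult (mult k r) (mult (mult wi vi) (mult (minus (mult w x : bounded_op H) (mult
    x w : bounded_op H)) r))); [now apply bop_ext|].
    rewrite Hv, mult_one_l, mult_minus_distr_r, mult_minus_distr_l. apply f_equal2.
    - transitivity (mult (mult k r) (mult w (mult x r))); [now apply bop_ext|]. rewrite Hxr.
      now rewrite mult_one_r.
    - transitivity (mult k (mult (mult r x) (mult w r))); [now apply bop_ext|].
      rewrite Hrx, mult_one_l. now apply bop_ext. }
  rewrite plus_comm. symmetry. exact (plus_minus_cancel (G := bop_AbelianGroup) _ _).
Qed.

(** The recursion obtained by iterating either step: [rho] bounds the inverse, [beta j] the
    commutator with the weight of exponent [j + 1] divided by that of exponent [j], and [kap i] the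
    given operator under the weight of exponent [i]. *)
Fixpoint weighted_bound (rho : R) (beta kap : nat -> R) (i : nat) : R :=
  match i with
  | O => rho * kap O
  | S j => rho * kap i + rho * (beta j * weighted_bound rho beta kap j)
  end.

Lemma weighted_inverse_l rho beta kap n x r T :
  is_inverse x r -> opnorm r <= rho ->
  (forall i, opnorm (mult (commutator (weight E n (S i)) x) (weight_inv E n i)) <= beta i) ->
  (forall i, opnorm (mult (weight E n i) T) <= kap i) ->
  forall i, opnorm (mult (weight E n i) (mult r T)) <= weighted_bound rho beta kap i.
Proof.
  intros Hr Hrho Hb Hk. induction i as [|i IH].
  - simpl. rewrite weight_0 by assumption. rewrite mult_one_l.
    apply opnorm_mult_le; [assumption|].
    specialize (Hk O). rewrite weight_0 in Hk by assumption. now rewrite mult_one_l in Hk.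
  - rewrite (weighted_inverse_step_l _ (weight E n i) (weight_inv E n i) x r T Hr)
      by (now apply weight_inv_weight).
    apply opnorm_minus_le; apply opnorm_mult_le; auto using opnorm_mult_le.
Qed.

Lemma weighted_inverse_r rho beta kap n x r T :
  is_inverse x r -> opnorm r <= rho ->
  (forall i, opnorm (mult (weight_inv E n i) (commutator (weight E n (S i)) x)) <= beta i) ->
  (forall i, opnorm (mult T (weight E n i)) <= kap i) ->
  forall i, opnorm (mult (mult T r) (weight E n i)) <= weighted_bound rho beta kap i.
Proof.
  intros Hr Hrho Hb Hk. induction i as [|i IH].
  - simpl. rewrite weight_0 by assumption. rewrite mult_one_r, Rmult_comm.
    apply opnorm_mult_le; [|assumption].
    specialize (Hk O). rewrite weight_0 in Hk by assumption. now rewrite mult_one_r in Hk.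
  - rewrite (weighted_inverse_step_r _ (weight E n i) (weight_inv E n i) x r T Hr)
      by (now apply weight_weight_inv).
    simpl weighted_bound.
    replace (rho * kap (S i) + rho * (beta i * weighted_bound rho beta kap i))
      with (kap (S i) * rho + weighted_bound rho beta kap i * (beta i * rho)) by ring.
    apply opnorm_plus_le; apply opnorm_mult_le; auto using opnorm_mult_le.
Qed.

(** The first product serves decay in the row index, the second decay in the column index; [beta] is
    chosen before [n]. *)
Definition tame T : Prop := exists beta : nat -> R, forall i n,
  opnorm (mult (commutator (weight E n (S i)) T) (weight_inv E n i)) <= beta i /\
  opnorm (mult (weight_inv E n i) (commutator (weight E n (S i)) T)) <= beta i.

(** [B] is fixed before [r] and [y], so one constant serves all resolvents along an arc. Of [y] only
    its commutators are prescribed, and for [y = zeta - x] these are the same for every [zeta]. *)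
Lemma tame_inverse_rapid x T M N rho : tame x -> rapid_op E T ->
  exists B, forall r y, is_inverse y r -> opnorm r <= rho ->
    (forall w : bounded_op H, commutator w y = opp (commutator w x)) ->
    forall k l, (1 + INR k) ^ M * (1 + INR l) ^ N * Cmod (entry E k l (mult r (mult T r))) <= B.
Proof.
  intros [beta Hbeta] HT.
  assert (HK : forall i j, exists B, forall n, opnorm (mult (weight E n i) (mult T (weight E n
    j))) <= B)
    by (intros; now apply rapid_op_weighted_bound).
  set (kap := fun i j => proj1_sig (constructive_indefinite_description _ (HK i j))).
  assert (Hkap : forall i j n, opnorm (mult (weight E n i) (mult T (weight E n j))) <= kap i j).
  { intros i j n. unfold kap. destruct constructive_indefinite_description as [B HB]. apply HB. }
  (* The column estimate for [mult T r] under the row weight of exponent [i] is the input sequence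
     of the row estimate, hence the nested recursion. *)
  exists (weighted_bound rho beta (fun i => weighted_bound rho beta (kap i) N) M).
  intros r y Hr Hrho Hy k l. apply entry_bound_of_weighted; [assumption|]. intro n.
  assert (Hbl : forall i, opnorm (mult (commutator (weight E n (S i)) y) (weight_inv E n i))
    <= beta i).
  { intro i. rewrite Hy.
    change (opnorm (opp (mult (commutator (weight E n (S i)) x) (weight_inv E n i))) <= beta i).
    exact (opnorm_opp_le _ _ (proj1 (Hbeta i n))). }
  assert (Hbr : forall i, opnorm (mult (weight_inv E n i) (commutator (weight E n (S i)) y))
    <= beta i).
  { intro i. rewrite Hy.
    assert (mult (weight_inv E n i) (opp (commutator (weight E n (S i)) x))
      = opp (mult (weight_inv E n i) (commutator (weight E n (S i)) x))) as ->.
    { apply bop_ext. intro z. exact (linear_opp _ _ (bop_linear (weight_inv E n i))). }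
    exact (opnorm_opp_le _ _ (proj2 (Hbeta i n))). }
  change (opnorm (mult (weight E n M) (mult r (mult (mult T r) (weight E n N))))
    <= weighted_bound rho beta (fun i => weighted_bound rho beta (kap i) N) M).
  apply (weighted_inverse_l rho beta (fun i => weighted_bound rho beta (kap i) N) n y r); auto.
  intro i. change (opnorm (mult (mult (mult (weight E n i) T) r) (weight E n N))
    <= weighted_bound rho beta (kap i) N).
  apply (weighted_inverse_r rho beta (kap i) n y r); auto.
  intro j. apply (Hkap i j n).
Qed.

Lemma commutator_plus w S T : commutator w (plus S T) = plus (commutator w S) (commutator w T).
Proof.
  unfold commutator. apply bop_ext. intro z.
  change (minus (w (plus (S z : H) (T z : H)) : H) (plus (S (w z) : H) (T (w z) : H))
    = plus (minus (w (S z) : H) (S (w z) : H)) (minus (w (T z) : H) (T (w z) : H))).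
  rewrite bop_map_plus. exact (minus_plus_plus (G := H) _ _ _ _).
Qed.

Lemma commutator_scal w (k : C) S : commutator w (scal k S) = scal k (commutator w S).
Proof.
  unfold commutator. apply bop_ext. intro z.
  change (minus (w (scal k (S z : H)) : H) (scal k (S (w z) : H))
    = scal k (minus (w (S z) : H) (S (w z)))).
  rewrite bop_map_scal. symmetry. exact (scal_minus_distr_l (V := H) k _ _).
Qed.

Lemma tame_plus S T : tame S -> tame T -> tame (plus S T).
Proof.
  intros [b Hb] [c Hc]. exists (fun i => b i + c i). intros i n.
  rewrite commutator_plus. destruct (Hb i n), (Hc i n). split.
  - assert (mult (plus (commutator (weight E n (Datatypes.S i)) S) (commutator (weight E n
    (Datatypes.S i)) T)) (weight_inv E n i)
      = plus (mult (commutator (weight E n (Datatypes.S i)) S) (weight_inv E n i))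
             (mult (commutator (weight E n (Datatypes.S i)) T) (weight_inv E n i))) as ->
      by (apply bop_ext; reflexivity).
    now apply opnorm_plus_le.
  - assert (mult (weight_inv E n i) (plus (commutator (weight E n (Datatypes.S i)) S) (commutator
    (weight E n (Datatypes.S i)) T))
      = plus (mult (weight_inv E n i) (commutator (weight E n (Datatypes.S i)) S))
             (mult (weight_inv E n i) (commutator (weight E n (Datatypes.S i)) T))) as ->
      by (apply bop_ext; intro; exact (bop_map_plus (weight_inv E n i) _ _)).
    now apply opnorm_plus_le.
Qed.

(** No cancellation is involved: both terms of the commutator are bounded separately, and inverse
    weights are contractions. *)
Lemma rapid_op_tame T : rapid_op E T -> tame T.
Proof.
  intro HT.
  assert (HK : forall i, exists B, forall n,
    opnorm (mult (weight E n i) T) <= B /\ opnorm (mult T (weight E n i)) <= B).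
  { intro i. destruct (rapid_op_weighted_bound E HE T i 0 HT) as [B HB].
    destruct (rapid_op_weighted_bound E HE T 0 i HT) as [D HD].
    exists (Rmax B D). intro n. specialize (HB n). specialize (HD n).
    rewrite weight_0, mult_one_r in HB by assumption.
    rewrite weight_0, mult_one_l in HD by assumption.
    split; eapply Rle_trans; eauto using Rmax_l, Rmax_r. }
  set (kap := fun i => proj1_sig (constructive_indefinite_description _ (HK i))).
  exists (fun i => (kap (S i) + kap (S i)) * 1). intros i n.
  assert (Hk : opnorm (commutator (weight E n (S i)) T) <= kap (S i) + kap (S i)).
  { unfold kap. destruct constructive_indefinite_description as [B HB].
    apply opnorm_minus_le; apply HB. }
  split.
  - apply opnorm_mult_le; [assumption|now apply opnorm_weight_inv].
  - rewrite Rmult_comm. apply opnorm_mult_le; [now apply opnorm_weight_inv|assumption].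
Qed.

(** * Commutator bounds for norm-convergent series of operators *)

Lemma mult_l_linear (P : bounded_op H) :
  is_linear (U := bop_NormedModule) (V := bop_NormedModule) (fun A : bounded_op H => mult P A).
Proof.
  split.
  - intros A B. apply bop_ext. intro z. exact (bop_map_plus P (A z) (B z)).
  - intros k A. apply bop_ext. intro z. exact (bop_map_scal P k (A z)).
  - exists (opnorm P + 1). pose proof (opnorm_ge_0 P). split; [lra|]. intro A.
    eapply Rle_trans; [apply (opnorm_mult P A)|].
    apply Rmult_le_compat_r; [apply (opnorm_ge_0 A)|lra].
Qed.

Lemma mult_r_linear (P : bounded_op H) :
  is_linear (U := bop_NormedModule) (V := bop_NormedModule) (fun A : bounded_op H => mult A P).
Proof.
  split.
  - intros A B. now apply bop_ext.
  - intros k A. now apply bop_ext.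
  - exists (opnorm P + 1). pose proof (opnorm_ge_0 P). split; [lra|]. intro A.
    eapply Rle_trans; [apply (opnorm_mult A P)|].
    rewrite Rmult_comm. apply Rmult_le_compat_r; [apply (opnorm_ge_0 A)|lra].
Qed.

Lemma commutator_linear (P : bounded_op H) :
  is_linear (U := bop_NormedModule) (V := bop_NormedModule) (commutator P).
Proof.
  split.
  - exact (commutator_plus P).
  - exact (commutator_scal P).
  - exists (2 * opnorm P + 1). pose proof (opnorm_ge_0 P). split; [lra|]. intro A.
    apply Rle_trans with (opnorm P * opnorm A + opnorm A * opnorm P).
    + apply opnorm_minus_le; apply opnorm_mult.
    + pose proof (opnorm_ge_0 A). change (norm A) with (opnorm A). lra.
Qed.

(** The decay of [c] beats the polynomial growth of [L (X m)]: [p] powers absorb the growth, at the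
    cost of [2 ^ p] for comparing [2 + INR m] with [1 + INR m], and two powers make the series
    summable. The norm of [L], which varies with the cut-off, serves only for continuity. *)
Lemma linear_series_bound (L : bounded_op H -> bounded_op H) (X : nat -> bounded_op H)
    (c : nat -> C) (p : nat) (B : R) T :
  is_linear (U := bop_NormedModule) (V := bop_NormedModule) L ->
  (forall m, opnorm (L (X m)) <= (2 + INR m) ^ p) ->
  (forall m, (1 + INR m) ^ (p + 2) * Cmod (c m) <= B) ->
  is_series (fun m => scal (c m) (X m)) T -> opnorm (L T) <= 2 * (2 ^ p * B).
Proof.
  intros HL HX Hc HT. destruct (linear_norm L HL) as [K [HK HLK]].
  apply (opnorm_limit_le (fun A => opnorm (L A)) K _ (sum_n (fun m => scal (c m) (X m))) T);
    [lra| |exact HT|].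
  - intros A A'. eapply Rle_trans; [|apply Rplus_le_compat_l, (HLK (minus A' A))].
    assert (Hn : opnorm (L A) <= opnorm (minus (L A) (L A')) + opnorm (L A'))
      by exact (norm_le_minus (V := bop_NormedModule) (L A) (L A')).
    assert (Ho' : opnorm (minus (L A) (L A')) <= opnorm (minus (L A') (L A))).
    { rewrite <- opp_minus. apply opnorm_opp_le, Rle_refl. }
    assert (Hm : L (minus A' A) = minus (L A') (L A)).
    { unfold minus. etransitivity; [exact (linear_plus L HL _ _)|]. f_equal.
      exact (linear_opp L A HL). }
    change (opnorm (L A) <= opnorm (L A') + opnorm (L (minus A' A))). rewrite Hm. lra.
  - intro m.
    assert (Hs : L (sum_n (fun m => scal (c m) (X m)) m) = sum_n (fun m => scal (c m) (L (X m))) m).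
    { etransitivity; [exact (linear_sum_n L _ m HL)|]. apply sum_n_ext. intro j.
      exact (linear_scal L HL _ _). }
    rewrite Hs.
    eapply Rle_trans.
    { apply (opnorm_sum_n _ (fun m => Cmod (c m) * (2 + INR m) ^ p)). intro j.
      apply opnorm_scal_le, HX. }
    apply sum_n_sqr_bound.
    + apply Rmult_le_pos; [apply pow_le; lra|].
      eapply Rle_trans; [|apply (Hc O)]. apply Rmult_le_pos; [left;
        apply weight_pow_pos|apply Cmod_ge_0].
    + intro k. specialize (Hc k). rewrite pow_add in Hc.
      pose proof (weight_pow_pos k 2). pose proof (Cmod_ge_0 (c k)).
      apply Rmult_le_reg_r with ((1 + INR k) ^ 2); [assumption|].
      rewrite (Rmult_assoc (2 ^ p * B)), Rinv_l, Rmult_1_r by lra.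
      assert (H2 : (2 + INR k) ^ p <= 2 ^ p * (1 + INR k) ^ p).
      { rewrite <- Rpow_mult_distr. apply pow_incr. pose proof (pos_INR k). lra. }
      assert (Hq : 0 < 2 ^ p) by (apply pow_lt; lra).
      apply Rle_trans with (2 ^ p * ((1 + INR k) ^ p * (1 + INR k) ^ 2 * Cmod (c k))).
      * assert (0 <= Cmod (c k) * (1 + INR k) ^ 2) by (apply Rmult_le_pos; lra). nra.
      * apply Rmult_le_compat_l; lra.
Qed.

(** The base [2 + INR m] accommodates both series of a Toeplitz operator, the one in [pow_n U m] and
    the one in [pow_n Us (S m)]. *)
Lemma tame_series (X : nat -> bounded_op H) (c : nat -> C) T :
  (forall i n m,
    opnorm (mult (commutator (weight E n (S i)) (X m)) (weight_inv E n i)) <= (2 + INR m) ^ S i /\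
    opnorm (mult (weight_inv E n i) (commutator (weight E n (S i)) (X m))) <= (2 + INR m) ^ S i) ->
  (forall M, exists B, forall m, (1 + INR m) ^ M * Cmod (c m) <= B) ->
  is_series (fun m => scal (c m) (X m)) T -> tame T.
Proof.
  intros HX Hc HT.
  set (kap := fun M => proj1_sig (constructive_indefinite_description _ (Hc M))).
  assert (Hkap : forall M m, (1 + INR m) ^ M * Cmod (c m) <= kap M).
  { intro M. unfold kap. destruct constructive_indefinite_description as [B HB]. exact HB. }
  exists (fun i => 2 * (2 ^ S i * kap (S i + 2)%nat)). intros i n.
  pose proof (commutator_linear (weight E n (S i))) as Hl.
  split.
  - refine (linear_series_bound (fun A => mult (commutator (weight E n (S i)) A) (weight_inv E n i))
      X c (S i) _ T (is_linear_comp _ _ Hl (mult_r_linear (weight_inv E n i))) _ (Hkap _) HT).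
    intro m. exact (proj1 (HX i n m)).
  - refine (linear_series_bound (fun A => mult (weight_inv E n i) (commutator (weight E n (S i)) A))
      X c (S i) _ T (is_linear_comp _ _ Hl (mult_l_linear (weight_inv E n i))) _ (Hkap _) HT).
    intro m. exact (proj2 (HX i n m)).
Qed.

End Tame.

(** * Toeplitz operators *)

Section Shift.

Context {H : HilbertSpace} (E : nat -> H) (HE : is_orthonormal_basis E).
Context (U Us : bounded_op H) (HU : is_shift E U) (HUs : is_adjoint U Us).
Implicit Types S T : bounded_op H.

Lemma inner_shift_l k (x : H) : inner (E (S k)) x = inner (E k) (Us x).
Proof. rewrite <- HU, (inner_conj _ x), (inner_conj _ (Us x)). now rewrite HUs. Qed.

Lemma adjoint_shift_basis l :
  (Us (E l) : H) = match l with O => zero | S j => E j end.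
Proof.
  apply (eq_of_basis E HE). intro k.
  rewrite <- inner_shift_l, (basis_orthonormal E HE).
  destruct l as [|j]; simpl.
  - now rewrite inner_zero_r.
  - now rewrite (basis_orthonormal E HE).
Qed.

Lemma inner_shift k (x : H) :
  inner (E k) (U x) = match k with O => RtoC 0 | S j => inner (E j) x end.
Proof.
  rewrite <- HUs. rewrite (adjoint_shift_basis k). destruct k; [apply inner_zero_l|reflexivity].
Qed.

Lemma opnorm_shift : opnorm U <= 1.
Proof.
  apply opnorm_le; [lra|]. intro x. right. rewrite Rmult_1_l.
  apply norm_sqr_eq_inner. rewrite <- HUs.
  assert (HI : mult Us U = one).
  { apply (bop_ext_basis E HE). intro k. change (Us (U (E k)) = E k).
    rewrite HU. exact (adjoint_shift_basis (S k)). }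
  change (inner ((mult Us U : bounded_op H) x) x = inner x x). now rewrite HI.
Qed.

(** From [norm (Us x) ^ 2 = Cmod (inner x (U (Us x)))] and the bound on [U], after division by
    [norm (Us x)]. *)
Lemma opnorm_adjoint_shift : opnorm Us <= 1.
Proof.
  apply opnorm_le; [lra|]. intro x. rewrite Rmult_1_l.
  assert (Hx : norm (Us x) ^ 2 = Cmod (inner x (U (Us x)))).
  { rewrite <- HUs, inner_norm, Cmod_R, Rabs_pos_eq; [reflexivity|apply pow2_ge_0]. }
  pose proof (inner_cauchy_schwarz x (U (Us x))) as Hc. rewrite <- Hx in Hc.
  pose proof (opnorm_bound U (Us x)) as Hb. pose proof opnorm_shift as H1.
  pose proof (norm_ge_0 x) as H2. pose proof (norm_ge_0 (Us x)) as H3.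
  assert (Hq : norm (U (Us x)) <= norm (Us x)) by nra.
  destruct (Req_dec (norm (Us x)) 0) as [H0|H0]; [rewrite H0; exact H2|].
  assert (Hn : norm (Us x) * norm (Us x) <= norm x * norm (Us x)).
  { replace (norm (Us x) * norm (Us x)) with (norm (Us x) ^ 2) by ring.
    eapply Rle_trans; [exact Hc|]. apply Rmult_le_compat_l; assumption. }
  apply Rmult_le_reg_r with (norm (Us x)); [lra|exact Hn].
Qed.

Lemma opnorm_pow_n T m : opnorm T <= 1 -> opnorm (pow_n T m) <= 1.
Proof.
  intro HT. induction m as [|m IH].
  - apply opnorm_one.
  - simpl. rewrite <- (Rmult_1_l 1). now apply opnorm_mult_le.
Qed.

Lemma entry_mult_shift_r k l T : entry E k l (mult T U) = entry E k (S l) T.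
Proof. unfold entry. change (inner (E k) (T (U (E l))) = inner (E k) (T (E (S l)))).
  now rewrite HU. Qed.

Lemma entry_mult_shift_l k l T :
  entry E k l (mult U T) = match k with O => RtoC 0 | S j => entry E j l T end.
Proof. apply inner_shift. Qed.

Lemma entry_mult_adjoint_r k l T :
  entry E k l (mult T Us) = match l with O => RtoC 0 | S j => entry E k j T end.
Proof.
  unfold entry. change (inner (E k) (T (Us (E l) : H))
    = match l with O => RtoC 0 | S j => inner (E k) (T (E j)) end).
  rewrite adjoint_shift_basis. destruct l; [|reflexivity].
  rewrite (bop_map_zero T : T (zero : H) = (zero : H)). exact (inner_zero_r (E k)).
Qed.

Lemma entry_mult_adjoint_l k l T : entry E k l (mult Us T) = entry E (S k) l T.
Proof. symmetry. apply inner_shift_l. Qed.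

Lemma entry_one k l : entry E k l one = if Nat.eqb k l then RtoC 1 else RtoC 0.
Proof.
  unfold entry. change (inner (E k) (E l) = if Nat.eqb k l then RtoC 1 else RtoC 0).
  rewrite (basis_orthonormal E HE). destruct (Nat.eqb k l); reflexivity.
Qed.

Lemma entry_pow_shift m k l :
  entry E k l (pow_n U m) = if Nat.eqb k (l + m) then RtoC 1 else RtoC 0.
Proof.
  revert k. induction m as [|m IH]; intro k.
  - rewrite Nat.add_0_r. apply entry_one.
  - simpl pow_n. rewrite entry_mult_shift_l. destruct k as [|k].
    + destruct (Nat.eqb_spec 0 (l + S m)); [lia|reflexivity].
    + rewrite IH. replace (l + S m)%nat with (S (l + m)) by lia. reflexivity.
Qed.

Lemma entry_pow_adjoint m k l :
  entry E k l (pow_n Us m) = if Nat.eqb l (k + m) then RtoC 1 else RtoC 0.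
Proof.
  revert k. induction m as [|m IH]; intro k.
  - rewrite Nat.add_0_r, Nat.eqb_sym. apply entry_one.
  - simpl pow_n. rewrite entry_mult_adjoint_l, IH.
    replace (k + S m)%nat with (S k + m)%nat by lia. reflexivity.
Qed.

Lemma entry_commutator_weight n i k l T :
  entry E k l (commutator (weight E n i) T)
  = Cmult (RtoC ((1 + INR (min k n)) ^ i - (1 + INR (min l n)) ^ i)) (entry E k l T).
Proof.
  unfold commutator. rewrite entry_minus, entry_weight_l, entry_weight_r by assumption.
  apply injective_projections; simpl; ring.
Qed.

(** [a] and [b] are truncated weights at indices at distance at most [m]. Dividing by the smaller
    one is the worse case, so both quotients fall under [pow_shift_bound]. *)
Lemma shift_weight_quotient (p q m : nat) (i n : nat) :
  (p <= q)%nat -> (q <= p + m)%nat ->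
  let a := 1 + INR (min p n) in let b := 1 + INR (min q n) in
  0 <= (b ^ S i - a ^ S i) * / b ^ i /\
  (b ^ S i - a ^ S i) * / b ^ i
    <= (b ^ S i - a ^ S i) * / a ^ i <= (1 + INR m) ^ S i.
Proof.
  intros Hpq Hq a b.
  assert (Ha : 1 <= a) by (unfold a; pose proof (pos_INR (min p n)); lra).
  assert (Hab : a <= b) by (apply Rplus_le_compat_l, le_INR; lia).
  assert (Hb : b <= a + INR m).
  { unfold a, b. rewrite Rplus_assoc, <- plus_INR. apply Rplus_le_compat_l, le_INR. lia. }
  destruct (pow_shift_bound a b (INR m) i Ha Hab Hb) as [H0 H1].
  pose proof (pow_lt a i ltac:(lra)) as Hai. pose proof (pow_lt b i ltac:(lra)) as Hbi.
  pose proof (pow_incr a b i ltac:(lra)) as Hi.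
  pose proof (Rinv_0_lt_compat _ Hbi). pose proof (Rinv_le_contravar _ _ Hai Hi).
  repeat split.
  - apply Rmult_le_pos; lra.
  - apply Rmult_le_compat_l; lra.
  - apply Rmult_le_reg_r with (a ^ i); [assumption|].
    rewrite Rmult_assoc, Rinv_l, Rmult_1_r by lra. exact H1.
Qed.

(** The nonzero entries of [pow_n U m] sit at [(l + m, l)], where the commutator multiplies by the
    difference of the weights at [l + m] and [l]. So each product is [pow_n U m] times a diagonal
    operator, and the latter is bounded entry by entry. *)
Lemma shift_tame i n m :
  opnorm (mult (commutator (weight E n (S i)) (pow_n U m)) (weight_inv E n i))
    <= (1 + INR m) ^ S i /\
  opnorm (mult (weight_inv E n i) (commutator (weight E n (S i)) (pow_n U m))) <= (1 + INR m) ^ S i.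
Proof.
  set (a := fun l => 1 + INR (min l n)). set (b := fun l => 1 + INR (min (l + m) n)).
  (* Both weights are constant for indices from [n] on, so the truncation built into [diag_op] does
     not alter the entries. *)
  assert (Hmin : forall l, b (min l n) = b l /\ a (min l n) = a l).
  { intro l. unfold a, b. split; do 2 f_equal; lia. }
  assert (Hq : forall l, 0 <= (b l ^ S i - a l ^ S i) * / b l ^ i /\
    (b l ^ S i - a l ^ S i) * / b l ^ i
    <= (b l ^ S i - a l ^ S i) * / a l ^ i <= (1 + INR m) ^ S i).
  { intro l. apply (shift_weight_quotient l (l + m) m i n); lia. }
  assert (Hp : 0 <= (1 + INR m) ^ S i) by (left; apply weight_pow_pos).
  split.
  - assert (mult (commutator (weight E n (S i)) (pow_n U m)) (weight_inv E n i)
      = mult (pow_n U m) (diag_op E n (fun l => (b l ^ S i - a l ^ S i) * / a l ^ i))) as ->.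
    { apply (bop_ext_entry E HE). intros k l.
      rewrite entry_weight_inv_r, entry_mult_diag_op_r, entry_commutator_weight, entry_pow_shift
        by assumption.
      destruct (Hmin l) as [-> ->].
      destruct (Nat.eqb_spec k (l + m)) as [->|].
      - fold (a l). fold (b l). apply injective_projections; simpl; ring.
      - apply injective_projections; simpl; ring. }
    rewrite <- (Rmult_1_l ((1 + INR m) ^ _)). apply opnorm_mult_le;
      [apply opnorm_pow_n, opnorm_shift|].
    apply (opnorm_diag_op E HE); [assumption|]. intro l. destruct (Hq l) as [H0 [H1 H2]].
    rewrite Rabs_pos_eq; lra.
  - assert (mult (weight_inv E n i) (commutator (weight E n (S i)) (pow_n U m))
      = mult (pow_n U m) (diag_op E n (fun l => (b l ^ S i - a l ^ S i) * / b l ^ i))) as ->.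
    { apply (bop_ext_entry E HE). intros k l.
      rewrite entry_weight_inv_l, entry_mult_diag_op_r, entry_commutator_weight, entry_pow_shift
        by assumption.
      destruct (Hmin l) as [-> ->].
      destruct (Nat.eqb_spec k (l + m)) as [->|].
      - fold (a l). fold (b l). apply injective_projections; simpl; ring.
      - apply injective_projections; simpl; ring. }
    rewrite <- (Rmult_1_l ((1 + INR m) ^ _)). apply opnorm_mult_le;
      [apply opnorm_pow_n, opnorm_shift|].
    apply (opnorm_diag_op E HE); [assumption|]. intro l. destruct (Hq l) as [H0 [H1 H2]].
    rewrite Rabs_pos_eq; lra.
Qed.

(** Here the nonzero entries sit at [(k, k + m)], so the diagonal factor stands on the left, the
    difference changes sign and the two quotients trade places. *)
Lemma adjoint_shift_tame i n m :
  opnorm (mult (commutator (weight E n (S i)) (pow_n Us m)) (weight_inv E n i))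
    <= (1 + INR m) ^ S i /\
  opnorm (mult (weight_inv E n i) (commutator (weight E n (S i)) (pow_n Us m)))
    <= (1 + INR m) ^ S i.
Proof.
  set (a := fun l => 1 + INR (min l n)). set (b := fun l => 1 + INR (min (l + m) n)).
  assert (Hmin : forall l, b (min l n) = b l /\ a (min l n) = a l).
  { intro l. unfold a, b. split; do 2 f_equal; lia. }
  assert (Hq : forall l, 0 <= (b l ^ S i - a l ^ S i) * / b l ^ i /\
    (b l ^ S i - a l ^ S i) * / b l ^ i
    <= (b l ^ S i - a l ^ S i) * / a l ^ i <= (1 + INR m) ^ S i).
  { intro l. apply (shift_weight_quotient l (l + m) m i n); lia. }
  assert (Hp : 0 <= (1 + INR m) ^ S i) by (left; apply weight_pow_pos).
  split.
  - assert (mult (commutator (weight E n (S i)) (pow_n Us m)) (weight_inv E n i)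
      = mult (diag_op E n (fun l => - ((b l ^ S i - a l ^ S i) * / b l ^ i))) (pow_n Us m)) as ->.
    { apply (bop_ext_entry E HE). intros k l.
      rewrite entry_weight_inv_r, entry_mult_diag_op_l, entry_commutator_weight,
        entry_pow_adjoint by assumption.
      destruct (Hmin k) as [-> ->].
      destruct (Nat.eqb_spec l (k + m)) as [->|].
      - fold (a k). fold (b k). apply injective_projections; simpl; ring.
      - apply injective_projections; simpl; ring. }
    rewrite <- (Rmult_1_r ((1 + INR m) ^ _)). apply opnorm_mult_le;
      [|apply opnorm_pow_n, opnorm_adjoint_shift].
    apply (opnorm_diag_op E HE); [assumption|]. intro l. destruct (Hq l) as [H0 [H1 H2]].
    rewrite Rabs_Ropp, Rabs_pos_eq; lra.
  - assert (mult (weight_inv E n i) (commutator (weight E n (S i)) (pow_n Us m))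
      = mult (diag_op E n (fun l => - ((b l ^ S i - a l ^ S i) * / a l ^ i))) (pow_n Us m)) as ->.
    { apply (bop_ext_entry E HE). intros k l.
      rewrite entry_weight_inv_l, entry_mult_diag_op_l, entry_commutator_weight,
        entry_pow_adjoint by assumption.
      destruct (Hmin k) as [-> ->].
      destruct (Nat.eqb_spec l (k + m)) as [->|].
      - fold (a k). fold (b k). apply injective_projections; simpl; ring.
      - apply injective_projections; simpl; ring. }
    rewrite <- (Rmult_1_r ((1 + INR m) ^ _)). apply opnorm_mult_le;
      [|apply opnorm_pow_n, opnorm_adjoint_shift].
    apply (opnorm_diag_op E HE); [assumption|]. intro l. destruct (Hq l) as [H0 [H1 H2]].
    rewrite Rabs_Ropp, Rabs_pos_eq; lra.
Qed.

Definition rapid_coeffs (phi : Z -> C) : Prop :=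
  forall M, exists B, forall n, (1 + Rabs (IZR n)) ^ M * Cmod (phi n) <= B.

Lemma rapid_coeffs_nat phi : rapid_coeffs phi ->
  forall M, exists B, forall m, (1 + INR m) ^ M * Cmod (phi (Z.of_nat m)) <= B.
Proof.
  intros Hphi M. destruct (Hphi M) as [B HB]. exists B. intro m.
  specialize (HB (Z.of_nat m)). rewrite <- INR_IZR_INZ, Rabs_pos_eq in HB by apply pos_INR.
    exact HB.
Qed.

Lemma rapid_coeffs_neg phi : rapid_coeffs phi ->
  forall M, exists B, forall m, (1 + INR m) ^ M * Cmod (phi (- Z.of_nat (S m))%Z) <= B.
Proof.
  intros Hphi M. destruct (Hphi M) as [B HB]. exists B. intro m.
  specialize (HB (- Z.of_nat (S m))%Z).
  rewrite opp_IZR, Rabs_Ropp, <- INR_IZR_INZ, Rabs_pos_eq in HB by apply pos_INR.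
  eapply Rle_trans; [|exact HB]. apply Rmult_le_compat_r; [apply Cmod_ge_0|].
  apply pow_incr. split; [left; apply weight_pos|]. apply Rplus_le_compat_l, le_INR. lia.
Qed.

Lemma toeplitz_tame f T : rapid_coeffs (fourier_coeff f) -> is_toeplitz U Us f T -> tame E T.
Proof.
  intros Hf [T1 [T2 [H1 [H2 ->]]]]. apply tame_plus.
  - apply (tame_series E (fun m => pow_n U m) (fun m => fourier_coeff f (Z.of_nat m)));
      [|now apply rapid_coeffs_nat|exact H1].
    intros i n m. destruct (shift_tame i n m) as [Ha Hb].
    assert ((1 + INR m) ^ S i <= (2 + INR m) ^ S i) by (apply pow_incr; pose proof (pos_INR m);
      lra).
    split; lra.
  - apply (tame_series E (fun m => pow_n Us (S m)) (fun m => fourier_coeff f (- Z.of_nat (S m))));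
      [|now apply rapid_coeffs_neg|exact H2].
    intros i n m. replace (2 + INR m) with (1 + INR (S m)) by (rewrite S_INR; ring).
    apply adjoint_shift_tame.
Qed.

(** Different powers of a shift live on different diagonals, so a given entry sees at most one term
    of a Toeplitz series. *)
Lemma series_entry_single (X : nat -> bounded_op H) (a : nat -> C) T k l (z : C) m0 :
  is_series (fun m => scal (a m) (X m)) T ->
  (forall m, Cmult (a m) (entry E k l (X m)) = if Nat.eqb m m0 then z else RtoC 0) ->
  entry E k l T = z.
Proof.
  intros HT HX. apply (entry_limit_const E HE k l (sum_n (fun m => (scal (a m) (X m) : bounded_op
    H))) T z HT).
  exists m0. intros n Hn. rewrite entry_sum_n.
  induction n as [|n IH].
  - rewrite sum_O, entry_scal, HX. replace m0 with O by lia. reflexivity.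
  - rewrite sum_Sn, entry_scal, HX. destruct (Nat.eqb_spec (S n) m0) as [<-|Hm].
    + rewrite (sum_n_zero (G := C_AbelianGroup)); [apply Cplus_0_l|].
      intros j Hj. rewrite entry_scal, HX. destruct (Nat.eqb_spec j (S n)); [lia|reflexivity].
    + rewrite IH by lia. apply Cplus_0_r.
Qed.

Lemma toeplitz_entry f T k l : is_toeplitz U Us f T ->
  entry E k l T = fourier_coeff f (Z.of_nat k - Z.of_nat l).
Proof.
  intros [T1 [T2 [H1 [H2 ->]]]]. rewrite entry_plus.
  destruct (Nat.leb_spec l k) as [Hlk|Hlk].
  - rewrite (series_entry_single _ _ T1 k l (fourier_coeff f (Z.of_nat k - Z.of_nat l)) (k - l) H1).
    + rewrite (series_entry_single _ _ T2 k l (RtoC 0) 0 H2); [apply Cplus_0_r|].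
      intro m. rewrite entry_pow_adjoint.
      destruct (Nat.eqb_spec l (k + S m)); [lia|]. rewrite Cmult_0_r. now destruct (Nat.eqb m 0).
    + intro m. rewrite entry_pow_shift.
      destruct (Nat.eqb_spec k (l + m)) as [->|].
      * replace (l + m - l)%nat with m by lia. rewrite Nat.eqb_refl, Cmult_1_r. f_equal. lia.
      * destruct (Nat.eqb_spec m (k - l)); [lia|]. apply Cmult_0_r.
  - rewrite (series_entry_single _ _ T1 k l (RtoC 0) 0 H1).
    (* The second series starts with the first power of [Us], so the diagonal at distance [l - k]
       has index [l - k - 1]. *)
    + rewrite (series_entry_single _ _ T2 k l (fourier_coeff f (Z.of_nat k - Z.of_nat l)) (l - k
      - 1) H2);
        [apply Cplus_0_l|].
      intro m. rewrite entry_pow_adjoint.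
      destruct (Nat.eqb_spec l (k + S m)) as [->|].
      * replace (k + S m - k - 1)%nat with m by lia. rewrite Nat.eqb_refl, Cmult_1_r. f_equal. lia.
      * destruct (Nat.eqb_spec m (l - k - 1)); [lia|]. apply Cmult_0_r.
    + intro m. rewrite entry_pow_shift.
      destruct (Nat.eqb_spec k (l + m)); [lia|]. rewrite Cmult_0_r. now destruct (Nat.eqb m 0).
Qed.

End Shift.

(** * Fourier series of smooth functions *)

Lemma Riemann_sum_linear {V W : NormedModule R_AbsRing} (L : V -> W) (f : R -> V) (s : SF_seq) :
  is_linear L -> Riemann_sum (fun x => L (f x)) s = L (Riemann_sum f s).
Proof.
  intro HL. induction s as [x0|h s IH] using SF_cons_ind.
  - symmetry. exact (linear_zero L HL).
  - rewrite !Riemann_sum_cons, IH.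
    now rewrite (linear_plus L HL), (linear_scal L HL).
Qed.

(** Moves a complex constant, and later a matrix entry of a commutator, through an integral over a
    real parameter. *)
Lemma is_RInt_linear {V W : NormedModule R_AbsRing} (L : V -> W) (f : R -> V) (a b : R) (I : V) :
  is_linear L -> is_RInt f a b I -> is_RInt (fun x => L (f x)) a b (L I).
Proof.
  intros HL Hf. unfold is_RInt.
  apply (filterlim_ext (fun s => L (scal (sign (b - a)) (Riemann_sum f s)))).
  - intro s. rewrite (linear_scal L HL). now rewrite (Riemann_sum_linear L f s HL).
  - eapply filterlim_comp; [exact Hf|]. exact (linear_cont L I HL).
Qed.

Lemma is_derive_pair (f1 f2 : R -> R) (x d1 d2 : R) :
  is_derive f1 x d1 -> is_derive f2 x d2 ->
  is_derive (V := C_R_NormedModule) (fun t => (f1 t, f2 t)) x (d1, d2).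
Proof.
  intros H1 H2.
  apply (filterdiff_comp_2 (U := R_NormedModule) (V := R_NormedModule) (W := C_R_NormedModule)
    f1 f2 (fun u v => (u, v)) (fun y => scal y d1) (fun y => scal y d2) (fun u v => (u, v)) H1 H2).
  apply filterdiff_linear.
  apply (is_linear_prod (T := prod_NormedModule R_AbsRing R_NormedModule R_NormedModule));
    [apply is_linear_fst|apply is_linear_snd].
Qed.

Lemma is_derive_fst (f : R -> C) x (d : C) :
  is_derive (V := C_R_NormedModule) f x d -> is_derive (fun t => fst (f t)) x (fst d).
Proof.
  intro Hf. eapply filterdiff_ext_lin.
  - apply (filterdiff_comp' (U := R_NormedModule) (V := C_R_NormedModule) (W := R_NormedModule) f
    fst);
      [exact Hf|]. apply filterdiff_linear. apply is_linear_fst.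
  - reflexivity.
Qed.

Lemma is_derive_snd (f : R -> C) x (d : C) :
  is_derive (V := C_R_NormedModule) f x d -> is_derive (fun t => snd (f t)) x (snd d).
Proof.
  intro Hf. eapply filterdiff_ext_lin.
  - apply (filterdiff_comp' (U := R_NormedModule) (V := C_R_NormedModule) (W := R_NormedModule) f
    snd);
      [exact Hf|]. apply filterdiff_linear. apply is_linear_snd.
  - reflexivity.
Qed.

Lemma is_derive_Cmult (f g : R -> C) x (df dg : C) :
  is_derive (V := C_R_NormedModule) f x df -> is_derive (V := C_R_NormedModule) g x dg ->
  is_derive (V := C_R_NormedModule) (fun t => Cmult (f t) (g t)) x
    (Cplus (Cmult df (g x)) (Cmult (f x) dg)).
Proof.
  intros Hf Hg.
  pose proof (is_derive_fst _ _ _ Hf) as F1. pose proof (is_derive_snd _ _ _ Hf) as F2.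
  pose proof (is_derive_fst _ _ _ Hg) as G1. pose proof (is_derive_snd _ _ _ Hg) as G2.
  pose proof (is_derive_mult _ _ x _ _ F1 G1 Rmult_comm) as H11.
  pose proof (is_derive_mult _ _ x _ _ F2 G2 Rmult_comm) as H22.
  pose proof (is_derive_mult _ _ x _ _ F1 G2 Rmult_comm) as H12.
  pose proof (is_derive_mult _ _ x _ _ F2 G1 Rmult_comm) as H21.
  pose proof (is_derive_pair _ _ x _ _ (is_derive_minus _ _ x _ _ H11 H22) (is_derive_plus _ _ x
    _ _ H12 H21)) as Hp.
  match type of Hp with is_derive _ _ ?d => assert (Hd : d
    = Cplus (Cmult df (g x)) (Cmult (f x) dg)) end.
  { apply injective_projections; simpl; unfold minus, plus, opp, mult; simpl; ring. }
  rewrite <- Hd. exact Hp.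
Qed.

Lemma is_linear_Cmult (z : C) :
  is_linear (K := R_AbsRing) (U := C_R_NormedModule) (V := C_R_NormedModule) (Cmult z).
Proof.
  split.
  - intros x y. exact (Cmult_plus_distr_l z x y).
  - intros k x. apply injective_projections; simpl; unfold scal; simpl; unfold mult; simpl; ring.
  - exists (Cmod z + 1). pose proof (Cmod_ge_0 z). split; [lra|]. intro x.
    rewrite <- !Cmod_norm, Cmod_mult. pose proof (Cmod_ge_0 x). nra.
Qed.

Definition char (n : Z) (x : R) : C := (cos (2 * PI * IZR n * x), sin (2 * PI * IZR n * x)).

(** This is [2 * PI * i * n], the eigenvalue of differentiation on [char n]. *)
Definition freq (n : Z) : C := (0, 2 * PI * IZR n).

Lemma char_derive n x :
  is_derive (V := C_R_NormedModule) (char n) x (Cmult (freq n) (char n x)).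
Proof.
  assert (H1 : is_derive (fun t => cos (2 * PI * IZR n * t)) x (- (2 * PI * IZR n) * sin (2 * PI
    * IZR n * x)))
    by (auto_derive; [trivial|ring]).
  assert (H2 : is_derive (fun t => sin (2 * PI * IZR n * t)) x (2 * PI * IZR n * cos (2 * PI *
    IZR n * x)))
    by (auto_derive; [trivial|ring]).
  pose proof (is_derive_pair _ _ x _ _ H1 H2) as Hp.
  replace (Cmult (freq n) (char n x)) with
    (- (2 * PI * IZR n) * sin (2 * PI * IZR n * x), 2 * PI * IZR n * cos (2 * PI * IZR n * x));
      [exact Hp|].
  apply injective_projections; simpl; ring.
Qed.

Lemma char_plus n m x : char (n + m) x = Cmult (char n x) (char m x).
Proof.
  unfold char. rewrite plus_IZR.
  replace (2 * PI * (IZR n + IZR m) * x) with (2 * PI * IZR n * x + 2 * PI * IZR m * x) by ring.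
  rewrite cos_plus, sin_plus. apply injective_projections; simpl; ring.
Qed.

Lemma char_opp n x : char (- n) x = (cos (2 * PI * IZR n * x), - sin (2 * PI * IZR n * x)).
Proof.
  unfold char. rewrite opp_IZR. replace (2 * PI * - IZR n * x) with (- (2 * PI * IZR n * x)) by
    ring.
  now rewrite cos_neg, sin_neg.
Qed.

Lemma char_0_l x : char 0 x = RtoC 1.
Proof. unfold char. rewrite Rmult_0_r, Rmult_0_l, cos_0, sin_0. reflexivity. Qed.

Lemma Cmod_char n x : Cmod (char n x) = 1.
Proof.
  unfold char, Cmod; simpl. rewrite !Rmult_1_r.
  pose proof (sin2_cos2 (2 * PI * IZR n * x)) as Hs. unfold Rsqr in Hs.
  replace (_ + _) with 1 by lra. apply sqrt_1.
Qed.

Lemma cos_sin_period_nat (t : R) (k : nat) :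
  cos (t + 2 * PI * INR k) = cos t /\ sin (t + 2 * PI * INR k) = sin t.
Proof.
  replace (t + 2 * PI * INR k) with (t + 2 * INR k * PI) by ring.
  split; [apply cos_period|apply sin_period].
Qed.

Lemma char_periodic n x : char n (x + 1) = char n x.
Proof.
  unfold char. rewrite Rmult_plus_distr_l, Rmult_1_r.
  destruct (Z_le_gt_dec 0 n) as [Hn|Hn].
  - rewrite <- (Z2Nat.id n) by assumption. rewrite <- INR_IZR_INZ.
    destruct (cos_sin_period_nat (2 * PI * INR (Z.to_nat n) * x) (Z.to_nat n)) as [-> ->].
      reflexivity.
  - set (k := Z.to_nat (- n)).
    assert (Hk : IZR n = - INR k) by (unfold k; rewrite INR_IZR_INZ, Z2Nat.id, opp_IZR by lia;
      ring).
    rewrite Hk. set (t := 2 * PI * - INR k * x + 2 * PI * - INR k).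
    destruct (cos_sin_period_nat t k) as [H1 H2].
    replace (t + 2 * PI * INR k) with (2 * PI * - INR k * x) in * by (unfold t; ring).
    now rewrite H1, H2.
Qed.

Lemma fourier_coeff_char f n :
  fourier_coeff f n = RInt (V := C_R_CompleteNormedModule) (fun x => Cmult (f x) (char (- n) x))
    0 1.
Proof. unfold fourier_coeff. f_equal. apply functional_extensionality. intro x.
  now rewrite char_opp. Qed.

Lemma continuous_of_derive (f df : R -> C) :
  (forall x, is_derive (V := C_R_NormedModule) f x (df x)) ->
  forall x, continuous (U := C_R_NormedModule) f x.
Proof. intros Hf x. apply (ex_derive_continuous (V := C_R_NormedModule)). exists (df x).
  apply Hf. Qed.

Lemma is_derive_C_unique (f : R -> C) x (d d' : C) :
  is_derive (V := C_R_NormedModule) f x d -> is_derive (V := C_R_NormedModule) f x d' -> d = d'.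
Proof.
  intros H1 H2. apply injective_projections.
  - rewrite <- (is_derive_unique _ _ _ (is_derive_fst _ _ _ H1)).
    apply is_derive_unique, is_derive_fst, H2.
  - rewrite <- (is_derive_unique _ _ _ (is_derive_snd _ _ _ H1)).
    apply is_derive_unique, is_derive_snd, H2.
Qed.

Lemma derive_periodic (f df : R -> C) :
  (forall x, is_derive (V := C_R_NormedModule) f x (df x)) ->
  (forall x, f (x + 1) = f x) -> forall x, df (x + 1) = df x.
Proof.
  intros Hf Hp x. apply (is_derive_C_unique f x); [|apply Hf].
  apply (is_derive_ext (fun t => f (t + 1))); [exact Hp|].
  pose proof (is_derive_comp (V := C_R_NormedModule) f (fun t => t + 1) x (df (x + 1)) 1) as Hc.
  replace (df (x + 1)) with (scal (V := C_R_ModuleSpace) 1 (df (x + 1)));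
    [|apply (scal_one (V := C_R_ModuleSpace))].
  apply Hc; [apply Hf|]. auto_derive; [trivial|ring].
Qed.

Lemma RInt_char_mult_is_RInt (f df : R -> C) n :
  (forall x, is_derive (V := C_R_NormedModule) f x (df x)) ->
  is_RInt (V := C_R_NormedModule) (fun x => Cmult (f x) (char (- n) x)) 0 1 (fourier_coeff f n).
Proof.
  intro Hf. rewrite fourier_coeff_char.
  apply (RInt_correct (V := C_R_CompleteNormedModule)).
  apply (ex_RInt_continuous (V := C_R_CompleteNormedModule)). intros x _.
  apply (continuous_of_derive _ (fun x => Cplus (Cmult (df x) (char (- n) x)) (Cmult (f x) (Cmult
    (freq (- n)) (char (- n) x))))).
  intro y. apply is_derive_Cmult; [apply Hf|apply char_derive].
Qed.

(** Integration by parts: [f * char (- n)] agrees at 0 and 1, so its derivative has integral zero.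
    The second derivative [ddf] provides the continuity of that integrand. *)
Lemma fourier_coeff_derive (f df ddf : R -> C) n :
  (forall x, is_derive (V := C_R_NormedModule) f x (df x)) ->
  (forall x, is_derive (V := C_R_NormedModule) df x (ddf x)) ->
  (forall x, f (x + 1) = f x) ->
  fourier_coeff df n = Cmult (freq n) (fourier_coeff f n).
Proof.
  intros Hf Hdf Hp.
  pose proof (RInt_char_mult_is_RInt f df n Hf) as I0.
  pose proof (RInt_char_mult_is_RInt df ddf n Hdf) as I1.
  pose proof (is_RInt_linear _ _ _ _ _ (is_linear_Cmult (freq (- n))) I0) as I2.
  pose proof (is_RInt_plus _ _ _ _ _ _ I1 I2) as I3.
  set (h := fun x => Cmult (f x) (char (- n) x)).
  set (dh := fun x => Cplus (Cmult (df x) (char (- n) x)) (Cmult (f x) (Cmult (freq (- n)) (char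
    (- n) x)))).
  assert (Hh : forall x, is_derive (V := C_R_NormedModule) h x (dh x))
    by (intro x; apply is_derive_Cmult; [apply Hf|apply char_derive]).
  assert (Hdh : forall x, continuous (U := C_R_NormedModule) dh x).
  { apply (continuous_of_derive dh (fun x => Cplus (Cplus (Cmult (ddf x) (char (- n) x)) (Cmult
    (df x) (Cmult (freq (- n)) (char (- n) x))))
      (Cplus (Cmult (df x) (Cmult (freq (- n)) (char (- n) x))) (Cmult (f x) (Cmult (freq (- n))
        (Cmult (freq (- n)) (char (- n) x))))))).
    intro x. apply (is_derive_plus (V := C_R_NormedModule)).
    - apply is_derive_Cmult; [apply Hdf|apply char_derive].
    - apply is_derive_Cmult; [apply Hf|].
      pose proof (is_derive_Cmult (fun _ => freq (- n)) (char (- n)) x (RtoC 0) _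
        (is_derive_const (V := C_R_NormedModule) (freq (- n)) x) (char_derive (- n) x)) as Hc.
      replace (Cmult (freq (- n)) (Cmult (freq (- n)) (char (- n) x))) with
        (Cplus (Cmult (RtoC 0) (char (- n) x)) (Cmult (freq (- n)) (Cmult (freq (- n)) (char (-
          n) x))));
        [exact Hc|]. rewrite Cmult_0_l. apply Cplus_0_l. }
  pose proof (is_RInt_derive (V := C_R_CompleteNormedModule) h dh 0 1 (fun x _ => Hh x) (fun x _
    => Hdh x)) as I4.
  assert (H10 : h 1 = h 0).
  { unfold h. rewrite <- (Rplus_0_l 1), Hp, char_periodic. reflexivity. }
  rewrite H10, minus_eq_zero in I4.
  assert (I5 : is_RInt (V := C_R_NormedModule) dh 0 1 (plus (fourier_coeff df n) (Cmult (freq (-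
    n)) (fourier_coeff f n)))).
  { eapply is_RInt_ext; [|exact I3]. intros x _. unfold dh.
    apply injective_projections; simpl; unfold plus; simpl; ring. }
  pose proof (is_RInt_unique (V := C_R_CompleteNormedModule) _ _ _ _ I4) as E1.
  pose proof (is_RInt_unique (V := C_R_CompleteNormedModule) _ _ _ _ I5) as E2.
  rewrite E1 in E2. clear - E2.
  change (RtoC 0 = Cplus (fourier_coeff df n) (Cmult (freq (- n)) (fourier_coeff f n))) in E2.
  set (u := fourier_coeff df n) in *. set (v := fourier_coeff f n) in *.
  replace u with (Cplus (Cplus u (Cmult (freq (- n)) v)) (Cmult (freq n) v)).
  - rewrite <- E2. apply Cplus_0_l.
  - unfold freq. rewrite opp_IZR. apply injective_projections; simpl; ring.
Qed.

Lemma Cmod_freq n : Cmod (freq n) = 2 * PI * Rabs (IZR n).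
Proof.
  replace (freq n) with (Cmult Ci (RtoC (2 * PI * IZR n))) by (apply injective_projections;
    simpl; ring).
  rewrite Cmod_mult, Cmod_R, Rabs_mult.
  rewrite (Rabs_pos_eq (2 * PI)) by (pose proof PI_RGT_0; lra).
  replace (Cmod Ci) with 1; [ring|]. unfold Cmod; simpl.
  replace (_ + _) with 1 by ring. symmetry. apply sqrt_1.
Qed.

(** The coefficients of the [M]-th derivative are bounded, and they are [freq n ^ M] times those of
    [f]. The bound of order 0 is added to reach the weight [1 + t], through
    [(1 + t) ^ M <= 2 ^ M * (1 + t ^ M)]. *)
Lemma smooth_periodic_rapid_coeffs f : smooth_periodic f -> rapid_coeffs (fourier_coeff f).
Proof.
  intros [Hp [g [Hg0 Hg]]].
  assert (Hf : f = g O) by (apply functional_extensionality; intro; symmetry; apply Hg0).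
  rewrite Hf in *. clear f Hf Hg0.
  assert (Hgp : forall j x, g j (x + 1) = g j x).
  { induction j as [|j IH]; [exact Hp|]. apply (derive_periodic (g j)); auto. }
  assert (HM : forall j n, fourier_coeff (g j) n = Cmult (Cpow (freq n) j) (fourier_coeff (g O) n)).
  { induction j as [|j IH]; intro n.
    - simpl. now rewrite Cmult_1_l.
    - rewrite (fourier_coeff_derive (g j) (g (S j)) (g (S (S j)))), IH by auto.
      simpl. apply Cmult_assoc. }
  assert (HB : forall j, exists B, forall n, Cmod (fourier_coeff (g j) n) <= B).
  { intro j.
    destruct (bounded_continuity (V := C_R_NormedModule) (g j) 0 1) as [B HB].
    { intros x _. apply (continuous_of_derive (g j) (g (S j))). apply Hg. }
    exists B. intro n. rewrite Cmod_norm.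
    replace B with ((1 - 0) * B) by ring.
    apply (norm_RInt_le_const (V := C_R_NormedModule) (fun x => Cmult (g j x) (char (- n) x)) 0
      1); [lra| |].
    - intros x Hx. rewrite <- Cmod_norm, Cmod_mult, Cmod_char, Rmult_1_r, Cmod_norm. left.
      now apply HB.
    - apply (RInt_char_mult_is_RInt (g j) (g (S j))), Hg. }
  intro M. destruct (HB O) as [B0 HB0], (HB M) as [BM HBM].
  exists (2 ^ M * (B0 + BM)). intro n. specialize (HB0 n). specialize (HBM n).
  rewrite HM, Cmod_mult, Cmod_pow, Cmod_freq in HBM.
  set (t := Rabs (IZR n)) in *. set (v := Cmod (fourier_coeff (g O) n)) in *.
  assert (Ht : 0 <= t) by apply Rabs_pos. assert (Hv : 0 <= v) by apply Cmod_ge_0.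
  assert (H2 : 0 < 2 ^ M) by (apply pow_lt; lra).
  assert (Htm : t ^ M <= (2 * PI * t) ^ M).
  { apply pow_incr. pose proof PI2_1. unfold PI2 in *. split; [assumption|]. nra. }
  assert (Htm0 : 0 <= t ^ M) by now apply pow_le.
  assert (Hpow : (1 + t) ^ M <= 2 ^ M * (1 + t ^ M)).
  { destruct (Rle_lt_dec t 1).
    - apply Rle_trans with (2 ^ M); [apply pow_incr; lra|nra].
    - apply Rle_trans with ((2 * t) ^ M); [apply pow_incr; lra|]. rewrite Rpow_mult_distr. nra. }
  apply Rle_trans with (2 ^ M * (1 + t ^ M) * v); [apply Rmult_le_compat_r; assumption|].
  rewrite Rmult_assoc. apply Rmult_le_compat_l; [lra|].
  assert (t ^ M * v <= (2 * PI * t) ^ M * v) by (apply Rmult_le_compat_r; assumption). lra.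
Qed.

(** * Fourier series with rapidly decaying coefficients *)

Lemma taylor_remainder (f df ddf : R -> R) (K x y : R) :
  (forall t, is_derive f t (df t)) -> (forall t, is_derive df t (ddf t)) ->
  (forall t, Rabs (ddf t) <= K) ->
  Rabs (f y - f x - (y - x) * df x) <= K * (y - x) ^ 2.
Proof.
  intros Hf Hdf HK.
  assert (Hc : forall g dg : R -> R, (forall t, is_derive g t (dg t)) -> forall t, continuity_pt
    g t).
  { intros g dg Hg t. apply continuity_pt_filterlim. apply (ex_derive_continuous g).
    exists (dg t). apply Hg. }
  destruct (MVT_gen f x y df) as [c [Hcx Hcy]]; [intros; apply Hf|intros; now apply (Hc f df)|].
  destruct (MVT_gen df x c ddf) as [d [Hdx Hdc]]; [intros; apply Hdf|intros;
    now apply (Hc df ddf)|].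
  replace (f y - f x - (y - x) * df x) with (ddf d * ((c - x) * (y - x)))
    by (rewrite Hcy; replace (df c) with (df x + ddf d * (c - x)) by lra; ring).
  rewrite Rabs_mult, Rabs_mult.
  assert (H1 : Rabs (c - x) <= Rabs (y - x)).
  { unfold Rmin, Rmax in Hcx. destruct (Rle_dec x y); unfold Rabs; repeat destruct Rcase_abs; lra. }
  rewrite <- (pow2_abs (y - x)). specialize (HK d).
  pose proof (Rabs_pos (ddf d)). pose proof (Rabs_pos (c - x)).
  apply Rmult_le_compat; [assumption| |assumption|].
  - apply Rmult_le_pos; [assumption|apply Rabs_pos].
  - simpl. rewrite Rmult_1_r. apply Rmult_le_compat_r; [apply Rabs_pos|assumption].
Qed.

Lemma Cmod_le_sum (z : C) : Cmod z <= Rabs (fst z) + Rabs (snd z).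
Proof.
  replace z with (Cplus (RtoC (fst z)) (Cmult Ci (RtoC (snd z)))) at 1
    by (apply injective_projections; simpl; ring).
  eapply Rle_trans; [apply Cmod_triangle|]. rewrite Cmod_mult, !Cmod_R.
  assert (Cmod Ci = 1) as ->; [|lra].
  unfold Cmod; simpl. replace (_ + _) with 1 by ring. apply sqrt_1.
Qed.

(** Taylor estimates for cosine and sine; the constant is quadratic in [n], so two orders of decay
    of the coefficients pay for it. *)
Lemma char_remainder n x y :
  Cmod (Cminus (Cminus (char n y) (char n x)) (Cmult (RtoC (y - x)) (Cmult (freq n) (char n x))))
  <= 2 * (2 * PI * Rabs (IZR n)) ^ 2 * (y - x) ^ 2.
Proof.
  set (w := 2 * PI * IZR n).
  assert (Hw : (2 * PI * Rabs (IZR n)) ^ 2 = w ^ 2).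
  { unfold w. rewrite !Rpow_mult_distr, pow2_abs. reflexivity. }
  rewrite Hw.
  assert (Hb : forall u, - 1 <= u <= 1 -> Rabs (- w * (w * u)) <= w ^ 2).
  { intros u Hu. replace (- w * (w * u)) with (- (w ^ 2 * u)) by ring.
    rewrite Rabs_Ropp, Rabs_mult, Rabs_pos_eq by apply pow2_ge_0.
    pose proof (pow2_ge_0 w). assert (Rabs u <= 1) by (apply Rabs_le; lra). nra. }
  assert (H1 : Rabs (cos (w * y) - cos (w * x) - (y - x) * (- w * sin (w * x)))
    <= w ^ 2 * (y - x) ^ 2).
  { apply (taylor_remainder (fun t => cos (w * t)) (fun t => - w * sin (w * t)) (fun t => - w *
    (w * cos (w * t)))).
    - intro t. auto_derive; [trivial|ring].
    - intro t. auto_derive; [trivial|ring].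
    - intro t. apply Hb,  COS_bound. }
  assert (H2 : Rabs (sin (w * y) - sin (w * x) - (y - x) * (w * cos (w * x)))
    <= w ^ 2 * (y - x) ^ 2).
  { apply (taylor_remainder (fun t => sin (w * t)) (fun t => w * cos (w * t)) (fun t => - w * (w
    * sin (w * t)))).
    - intro t. auto_derive; [trivial|ring].
    - intro t. auto_derive; [trivial|ring].
    - intro t. apply Hb,  SIN_bound. }
  eapply Rle_trans; [apply Cmod_le_sum|].
  replace (2 * w ^ 2 * (y - x) ^ 2) with (w ^ 2 * (y - x) ^ 2 + w ^ 2 * (y - x) ^ 2) by ring.
  apply Rplus_le_compat.
  - eapply Rle_trans; [right|exact H1]. f_equal. simpl. fold w. ring.
  - eapply Rle_trans; [right|exact H2]. f_equal. simpl. fold w. ring.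
Qed.

Local Notation Cseries := (is_series (K := C_AbsRing) (V := C_NormedModule)).

Lemma Cseries_Cmod_le (u : nat -> C) (l : C) (B : R) :
  Cseries u l -> (forall n, Cmod (sum_n u n) <= B) -> Cmod l <= B.
Proof.
  intros Hu HB.
  apply (is_lim_seq_le (fun n => Cmod (sum_n u n)) (fun _ => B) (Cmod l) B);
    [exact HB| |apply is_lim_seq_const].
  eapply filterlim_comp; [exact Hu|]. exact (filterlim_norm (V := C_NormedModule) l).
Qed.

Lemma Cseries_Cmod_sqr_bound (u : nat -> C) (l : C) (B : R) : 0 <= B ->
  Cseries u l -> (forall k, Cmod (u k) <= B * / (1 + INR k) ^ 2) -> Cmod l <= 2 * B.
Proof.
  intros HB Hu Hk. apply (Cseries_Cmod_le u l); [exact Hu|]. intro n.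
  eapply Rle_trans; [exact (norm_sum_n_m (V := C_NormedModule) u 0 n)|].
  apply (sum_n_sqr_bound (fun k => Cmod (u k))); assumption.
Qed.

Lemma Cseries_exists (u : nat -> C) (B : R) :
  (forall k, Cmod (u k) <= B * / (1 + INR k) ^ 2) -> exists l, Cseries u l.
Proof.
  intro Hu. apply (ex_series_le (V := C_CompleteNormedModule) u (fun k => B * / (1 + INR k) ^ 2)).
  - exact Hu.
  - apply ex_series_inv_sqr.
Qed.

Lemma Cseries_unique (u : nat -> C) (l l' : C) : Cseries u l -> Cseries u l' -> l = l'.
Proof. intros H1 H2. exact (filterlim_locally_unique (V := C_NormedModule) _ l l' H1 H2). Qed.

Lemma Cseries_scal (c : C) (u : nat -> C) (l : C) :
  Cseries u l -> Cseries (fun k => Cmult c (u k)) (Cmult c l).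
Proof. exact (is_series_scal (V := C_NormedModule) c u l). Qed.

Lemma Cseries_minus (u v : nat -> C) (l m : C) :
  Cseries u l -> Cseries v m -> Cseries (fun k => Cminus (u k) (v k)) (Cminus l m).
Proof. exact (is_series_minus (V := C_NormedModule) u v l m). Qed.

(** The second-order remainders of the terms are summed, which bounds the remainder of [F] by a
    multiple of [(y - x) ^ 2]; given the decay of [a], pointwise convergence of both series is
    enough. The frequencies [mu] are general so that a series shifted by a character is covered
    too. *)
Lemma fourier_series_derive (a : nat -> C) (mu : nat -> Z) (B : R) (F dF : R -> C) :
  (forall k, (1 + INR k) ^ 2 * (Rabs (IZR (mu k)) ^ 2 * Cmod (a k)) <= B) ->
  (forall x, Cseries (fun k => Cmult (a k) (char (mu k) x)) (F x)) ->
  (forall x, Cseries (fun k => Cmult (a k) (Cmult (freq (mu k)) (char (mu k) x))) (dF x)) ->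
  forall x, is_derive (V := C_R_NormedModule) F x (dF x).
Proof.
  intros HB HF HdF x.
  set (K := 2 * (2 * PI) ^ 2 * B).
  assert (HB0 : 0 <= B).
  { eapply Rle_trans; [|apply (HB O)]. apply Rmult_le_pos; [apply pow2_ge_0|].
    apply Rmult_le_pos; [apply pow2_ge_0|apply Cmod_ge_0]. }
  assert (HK : 0 <= K).
  { unfold K. apply Rmult_le_pos; [|assumption]. apply Rmult_le_pos; [lra|apply pow2_ge_0]. }
  assert (Hrem : forall y, Cmod (Cminus (Cminus (F y) (F x)) (Cmult (RtoC (y - x)) (dF x)))
    <= 2 * (K * (y - x) ^ 2)).
  { intro y. eapply Cseries_Cmod_sqr_bound;
      [|exact (Cseries_minus _ _ _ _ (Cseries_minus _ _ _ _ (HF y) (HF x)) (Cseries_scal (RtoC (y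
        - x)) _ _ (HdF x)))|].
    - apply Rmult_le_pos; [assumption|apply pow2_ge_0].
    - intro k. cbv beta.
      replace (Cminus (Cminus (Cmult (a k) (char (mu k) y)) (Cmult (a k) (char (mu k) x)))
          (Cmult (RtoC (y - x)) (Cmult (a k) (Cmult (freq (mu k)) (char (mu k) x)))))
        with (Cmult (a k) (Cminus (Cminus (char (mu k) y) (char (mu k) x))
          (Cmult (RtoC (y - x)) (Cmult (freq (mu k)) (char (mu k) x))))) by ring.
      rewrite Cmod_mult. pose proof (char_remainder (mu k) x y) as Hc.
      rewrite Rpow_mult_distr in Hc.
      pose proof (weight_pow_pos k 2) as Hw. pose proof (Cmod_ge_0 (a k)) as Ha.
      pose proof (pow2_ge_0 (y - x)) as Hy.
      apply Rmult_le_reg_l with ((1 + INR k) ^ 2); [assumption|].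
      replace ((1 + INR k) ^ 2 * (K * (y - x) ^ 2 * / (1 + INR k) ^ 2)) with (K * (y - x) ^ 2)
        by (field; apply Rgt_not_eq, weight_pos).
      apply Rle_trans with ((1 + INR k) ^ 2 * (Cmod (a k) * (2 * ((2 * PI) ^ 2 * Rabs (IZR (mu
        k)) ^ 2) * (y - x) ^ 2))).
      + apply Rmult_le_compat_l; [lra|]. now apply Rmult_le_compat_l.
      + unfold K. specialize (HB k).
        replace ((1 + INR k) ^ 2 * (Cmod (a k) * (2 * ((2 * PI) ^ 2 * Rabs (IZR (mu k)) ^ 2) * (y
          - x) ^ 2)))
          with (2 * (2 * PI) ^ 2 * (y - x) ^ 2 * ((1 + INR k) ^ 2 * (Rabs (IZR (mu k)) ^ 2 * Cmod
            (a k)))) by ring.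
        replace (2 * (2 * PI) ^ 2 * B * (y - x) ^ 2) with (2 * (2 * PI) ^ 2 * (y - x) ^ 2 * B) by
          ring.
        apply Rmult_le_compat_l; [|assumption].
        apply Rmult_le_pos; [|assumption]. apply Rmult_le_pos; [lra|apply pow2_ge_0]. }
  split; [apply is_linear_scal_l|].
  intros x' Hx'. assert (x = x') as <- by (apply (is_filter_lim_locally_unique (V :=
    R_NormedModule)); exact Hx').
  intro eps.
  (* The remainder is at most [2 * K * (y - x) ^ 2], so this radius brings it below
     [eps * Rabs (y - x)]. *)
  assert (Hd : 0 < eps / (2 * K + 1)) by (apply Rdiv_lt_0_compat; [apply cond_pos|lra]).
  exists (mkposreal _ Hd). intros y Hy.
  change (Rabs (y - x) < eps / (2 * K + 1)) in Hy.
  assert (Hn : norm (V := C_R_NormedModule) (minus (G := C_R_NormedModule)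
      (minus (G := C_R_NormedModule) (F y) (F x)) (scal (V := C_R_ModuleSpace) (y - x) (dF x)))
    = Cmod (Cminus (Cminus (F y) (F x)) (Cmult (RtoC (y - x)) (dF x)))).
  { rewrite Cmod_norm. f_equal. apply injective_projections; simpl;
      unfold minus, plus, opp, scal; simpl; unfold mult; simpl; ring. }
  eapply Rle_trans; [right; exact Hn|]. eapply Rle_trans; [apply Hrem|].
  change (2 * (K * (y - x) ^ 2) <= eps * Rabs (y - x)). rewrite <- (pow2_abs (y - x)).
  pose proof (Rabs_pos (y - x)).
  assert (Rabs (y - x) * (2 * K + 1) <= eps).
  { apply Rle_trans with (eps / (2 * K + 1) * (2 * K + 1)); [apply Rmult_le_compat_r; lra|].
    right. field. lra. }
  simpl. nra.
Qed.

(** Even indices enumerate the nonnegative integers and odd ones the negative integers, turning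
    two-sided Fourier series into ordinary ones. *)
Definition int_of_nat (k : nat) : Z :=
  if Nat.even k then Z.of_nat (Nat.div2 k) else (- Z.of_nat (S (Nat.div2 k)))%Z.

Definition nat_of_int (n : Z) : nat :=
  if Z.leb 0 n then (2 * Z.to_nat n)%nat else (2 * Z.to_nat (- n - 1) + 1)%nat.

Lemma int_of_nat_of_int n : int_of_nat (nat_of_int n) = n.
Proof.
  unfold int_of_nat, nat_of_int. destruct (Z.leb_spec 0 n).
  - rewrite Nat.even_mul, Nat.div2_double. simpl. lia.
  - rewrite Nat.even_add, Nat.even_mul, Nat.add_1_r, Nat.div2_succ_double. simpl. lia.
Qed.

Lemma nat_of_int_of_nat k : nat_of_int (int_of_nat k) = k.
Proof.
  unfold int_of_nat, nat_of_int. pose proof (Nat.div2_odd k) as Hk.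
  rewrite <- Nat.negb_even in Hk. destruct (Nat.even k); simpl Nat.b2n in Hk.
  - destruct (Z.leb_spec 0 (Z.of_nat (Nat.div2 k))); lia.
  - destruct (Z.leb_spec 0 (- Z.of_nat (S (Nat.div2 k)))); lia.
Qed.

(** The enumeration changes the size of an index by bounded factors only, so rapid decay can be
    measured in either index. *)
Lemma int_of_nat_bounds k :
  Rabs (IZR (int_of_nat k)) <= 1 + INR k /\ 1 + INR k <= 2 * (1 + Rabs (IZR (int_of_nat k))).
Proof.
  unfold int_of_nat. pose proof (Nat.div2_odd k) as Hk.
  rewrite <- Nat.negb_even in Hk. set (m := Nat.div2 k) in *.
  pose proof (pos_INR m). pose proof (f_equal INR Hk) as HR. rewrite plus_INR, mult_INR in HR.
  destruct (Nat.even k); simpl in HR.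
  - rewrite <- INR_IZR_INZ, Rabs_pos_eq by assumption. lra.
  - rewrite opp_IZR, Rabs_Ropp, <- INR_IZR_INZ, Rabs_pos_eq by apply pos_INR.
    rewrite S_INR. lra.
Qed.

Definition rapid_seq (a : nat -> C) : Prop :=
  forall M, exists B, forall k, (1 + INR k) ^ M * Cmod (a k) <= B.

Lemma rapid_coeffs_seq phi : rapid_coeffs phi -> rapid_seq (fun k => phi (int_of_nat k)).
Proof.
  intros Hphi M. destruct (Hphi M) as [B HB]. exists (2 ^ M * B). intro k.
  specialize (HB (int_of_nat k)). destruct (int_of_nat_bounds k) as [_ Hk].
  apply Rle_trans with (2 ^ M * ((1 + Rabs (IZR (int_of_nat k))) ^ M * Cmod (phi (int_of_nat k)))).
  - rewrite <- Rmult_assoc, <- Rpow_mult_distr. apply Rmult_le_compat_r; [apply Cmod_ge_0|].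
    apply pow_incr. split; [left; apply weight_pos|assumption].
  - apply Rmult_le_compat_l; [apply pow_le; lra|assumption].
Qed.

Lemma rapid_seq_freq a : rapid_seq a -> rapid_seq (fun k => Cmult (freq (int_of_nat k)) (a k)).
Proof.
  intros Ha M. destruct (Ha (S M)) as [B HB]. exists (2 * PI * B). intro k. specialize (HB k).
  rewrite Cmod_mult, Cmod_freq. destruct (int_of_nat_bounds k) as [Hk _].
  pose proof PI_RGT_0. pose proof (Cmod_ge_0 (a k)). pose proof (weight_pow_pos k M).
  apply Rle_trans with (2 * PI * ((1 + INR k) ^ S M * Cmod (a k))); [|apply Rmult_le_compat_l; lra].
  simpl pow.
  replace ((1 + INR k) ^ M * (2 * PI * Rabs (IZR (int_of_nat k)) * Cmod (a k)))
    with (2 * PI * (Rabs (IZR (int_of_nat k)) * ((1 + INR k) ^ M * Cmod (a k)))) by ring.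
  rewrite (Rmult_assoc (1 + INR k)).
  apply Rmult_le_compat_l; [lra|]. apply Rmult_le_compat_r; [|assumption].
  apply Rmult_le_pos; lra.
Qed.

Lemma rapid_seq_sqr a : rapid_seq a -> exists B, forall k, Cmod (a k) <= B * / (1 + INR k) ^ 2.
Proof.
  intro Ha. destruct (Ha 2%nat) as [B HB]. exists B. intro k. specialize (HB k).
  pose proof (weight_pow_pos k 2). apply Rmult_le_reg_l with ((1 + INR k) ^ 2); [assumption|].
  replace ((1 + INR k) ^ 2 * (B * / (1 + INR k) ^ 2)) with B by (field;
    apply Rgt_not_eq, weight_pos).
  exact HB.
Qed.

(** Smoothness comes from termwise differentiation. The coefficients are found without exchanging
    integral and sum: after multiplication by [char (- n)], every mode except that of frequency [n]
    is the derivative of a periodic function, and the exceptional mode is the constant [phi n]. *)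
Lemma rapid_coeffs_smooth_periodic phi : rapid_coeffs phi ->
  exists f, smooth_periodic f /\ forall n, fourier_coeff f n = phi n.
Proof.
  intro Hphi.
  (* [a j] will be the sequence of coefficients of the [j]-th derivative. *)
  set (a := fix a (j : nat) : nat -> C := match j with
    | O => fun k => phi (int_of_nat k)
    | S i => fun k => Cmult (freq (int_of_nat k)) (a i k) end).
  assert (Ha : forall j, rapid_seq (a j)).
  { induction j as [|j IH]; [now apply rapid_coeffs_seq|now apply (rapid_seq_freq (a j))]. }
  assert (Hex : forall j x, exists l, Cseries (fun k => Cmult (a j k) (char (int_of_nat k) x)) l).
  { intros j x. destruct (rapid_seq_sqr (a j) (Ha j)) as [B HB].
    apply (Cseries_exists _ B). intro k. rewrite Cmod_mult, Cmod_char, Rmult_1_r. apply HB. }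
  set (g := fun j x => proj1_sig (constructive_indefinite_description _ (Hex j x))).
  assert (Hg : forall j x, Cseries (fun k => Cmult (a j k) (char (int_of_nat k) x)) (g j x)).
  { intros j x. unfold g. now destruct constructive_indefinite_description. }
  assert (Hdg : forall j x, is_derive (V := C_R_NormedModule) (g j) x (g (S j) x)).
  (* Of the four orders of decay, two make the series converge and two absorb the squared
     frequency. *)
  { intro j. destruct (Ha j 4%nat) as [B HB].
    apply (fourier_series_derive (a j) int_of_nat B (g j) (g (S j))).
    - intro k. eapply Rle_trans; [|apply (HB k)]. destruct (int_of_nat_bounds k) as [Hk _].
      replace ((1 + INR k) ^ 4 * Cmod (a j k)) with ((1 + INR k) ^ 2 * ((1 + INR k) ^ 2 * Cmod (a
        j k))) by ring.
      apply Rmult_le_compat_l; [apply pow2_ge_0|]. apply Rmult_le_compat_r; [apply Cmod_ge_0|].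
      apply pow_incr. split; [apply Rabs_pos|assumption].
    - apply Hg.
    - intro x. eapply is_series_ext; [|apply (Hg (S j) x)].
      intro k. simpl. ring. }
  assert (Hp : forall x, g O (x + 1) = g O x).
  { intro x. apply (Cseries_unique (fun k => Cmult (a O k) (char (int_of_nat k) x))); [|apply Hg].
    eapply is_series_ext; [|apply (Hg O (x + 1))]. intro k. simpl. now rewrite char_periodic. }
  exists (g O). split.
  { split; [exact Hp|]. exists g. split; [reflexivity|exact Hdg]. }
  intro n.
  (* An antiderivative of [g 0 * char (- n) - phi n] is given by a periodic Fourier series. *)
  set (mu := fun k => (int_of_nat k - n)%Z).
  set (b := fun k => if Z.eqb (mu k) 0 then RtoC 0 else Cdiv (a O k) (freq (mu k))).
  assert (Hfreq : forall m, m <> 0%Z -> freq m <> RtoC 0 /\ 1 <= Rabs (IZR m) <= Cmod (freq m)).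
  { intros m Hm.
    assert (H1 : 1 <= Rabs (IZR m)).
    { rewrite <- abs_IZR. apply IZR_le. lia. }
    assert (H2 : Rabs (IZR m) <= Cmod (freq m)).
    { rewrite Cmod_freq. pose proof PI2_1. unfold PI2 in *. nra. }
    split; [|tauto]. intro H0. rewrite H0, Cmod_0 in H2. lra. }
  assert (Hb : forall k, Rabs (IZR (mu k)) ^ 2 * Cmod (b k)
    <= Rabs (IZR (mu k)) * Cmod (a O k) /\ Cmod (b k) <= Cmod (a O k)).
  { intro k. unfold b. pose proof (Cmod_ge_0 (a O k)) as Hk.
    destruct (Z.eqb_spec (mu k) 0) as [->|Hm].
    - rewrite Cmod_0, Rabs_R0. lra.
    - destruct (Hfreq _ Hm) as [H0 [H1 H2]].
      rewrite Cmod_div by assumption.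
      set (t := Rabs (IZR (mu k))) in *. set (w := Cmod (freq (mu k))) in *.
        set (v := Cmod (a O k)) in *.
      assert (Hq : v / w * t <= v).
      { apply Rmult_le_reg_r with w; [lra|]. replace (v / w * t * w) with (v * t) by (field; lra).
        apply Rmult_le_compat_l; lra. }
      assert (0 <= v / w) by (apply Rmult_le_pos; [assumption|left; apply Rinv_0_lt_compat; lra]).
      split; nra. }
  assert (HbG : forall x, exists l, Cseries (fun k => Cmult (b k) (char (mu k) x)) l).
  { intro x. destruct (rapid_seq_sqr (a O) (Ha O)) as [B HB].
    apply (Cseries_exists _ B). intro k. rewrite Cmod_mult, Cmod_char, Rmult_1_r.
    eapply Rle_trans; [apply Hb|apply HB]. }
  set (G := fun x => proj1_sig (constructive_indefinite_description _ (HbG x))).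
  assert (HG : forall x, Cseries (fun k => Cmult (b k) (char (mu k) x)) (G x)).
  { intro x. unfold G. now destruct constructive_indefinite_description. }
  (* The constant [phi n] as a series supported on the index of [n]; subtracting it termwise cancels
     the mode whose frequency cannot be divided by. *)
  assert (Hsingle : Cseries (fun k => if Nat.eqb k (nat_of_int n) then phi n else RtoC 0) (phi n)).
  { apply (filterlim_ext_loc (fun _ => phi n)); [|apply filterlim_const].
    exists (nat_of_int n). intros N HN. symmetry. clear - HN.
    induction N as [|N IH].
    - rewrite sum_O. replace (nat_of_int n) with O by lia. reflexivity.
    - rewrite sum_Sn. destruct (Nat.eqb_spec (S N) (nat_of_int n)) as [He|He].
      + rewrite (sum_n_zero (G := C_AbelianGroup)); [apply Cplus_0_l|].
        intros j Hj. destruct (Nat.eqb_spec j (nat_of_int n)); [lia|reflexivity].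
      + rewrite IH by lia. apply Cplus_0_r. }
  assert (Hmu0 : forall k, mu k = 0%Z <-> k = nat_of_int n).
  { intro k. unfold mu. split; intro Hk.
    - rewrite <- (nat_of_int_of_nat k). f_equal. lia.
    - rewrite Hk, int_of_nat_of_int. lia. }
  assert (HdG : forall x, is_derive (V := C_R_NormedModule) G x (Cminus (Cmult (g O x) (char (-
    n) x)) (phi n))).
  (* Division by the frequency has gained [b] one order, so three orders suffice here; the factor
     [1 + Rabs (IZR n)] accounts for the shift of the frequencies by [n]. *)
  { destruct (Ha O 3%nat) as [B HB].
    apply (fourier_series_derive b mu ((1 + Rabs (IZR n)) * B) G).
    - intro k. destruct (Hb k) as [H1 _]. specialize (HB k).
      destruct (int_of_nat_bounds k) as [Hk _].
      assert (Hmu : Rabs (IZR (mu k)) <= (1 + Rabs (IZR n)) * (1 + INR k)).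
      { unfold mu. rewrite minus_IZR. pose proof (Rabs_triang (IZR (int_of_nat k)) (- IZR n)) as Ht.
        rewrite Rabs_Ropp in Ht. pose proof (Rabs_pos (IZR n)). pose proof (pos_INR k).
          unfold Rminus. nra. }
      pose proof (Cmod_ge_0 (a O k)) as Hak. pose proof (Rabs_pos (IZR n)).
        pose proof (weight_pos k).
      apply Rle_trans with ((1 + INR k) ^ 2 * ((1 + Rabs (IZR n)) * (1 + INR k) * Cmod (a O k))).
      + apply Rmult_le_compat_l; [apply pow2_ge_0|]. eapply Rle_trans; [exact H1|].
        now apply Rmult_le_compat_r.
      + replace ((1 + INR k) ^ 2 * ((1 + Rabs (IZR n)) * (1 + INR k) * Cmod (a O k)))
          with ((1 + Rabs (IZR n)) * ((1 + INR k) ^ 3 * Cmod (a O k))) by ring.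
        apply Rmult_le_compat_l; [lra|assumption].
    - exact HG.
    - intro x. rewrite (Cmult_comm (g O x)).
      eapply is_series_ext; [|exact (Cseries_minus _ _ _ _ (Cseries_scal (char (- n) x) _ _ (Hg O
        x)) Hsingle)].
      intro k. cbv beta.
      assert (Hc : Cmult (char (- n) x) (char (int_of_nat k) x) = char (mu k) x).
      { rewrite <- char_plus. f_equal. unfold mu. lia. }
      replace (Cmult (char (- n) x) (Cmult (a O k) (char (int_of_nat k) x))) with (Cmult (a O k)
        (char (mu k) x))
        by (rewrite <- Hc; ring).
      unfold b. destruct (Z.eqb_spec (mu k) 0) as [Hm|Hm].
      + rewrite (proj2 (Nat.eqb_eq k (nat_of_int n))) by now apply Hmu0.
        rewrite Hm, char_0_l. simpl. apply Hmu0 in Hm. rewrite Hm, int_of_nat_of_int. ring.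
      + rewrite (proj2 (Nat.eqb_neq k (nat_of_int n))) by (intro Hk; apply Hm; now apply Hmu0).
        destruct (Hfreq _ Hm) as [H0 _].
        match goal with |- ?p = ?q => change (@eq C p q) end. field. exact H0. }
  assert (HGp : G 1 = G 0).
  { apply (Cseries_unique (fun k => Cmult (b k) (char (mu k) 0))); [|apply HG].
    eapply is_series_ext; [|apply (HG 1)]. intro k. cbv beta.
    rewrite <- (Rplus_0_l 1), char_periodic. reflexivity. }
  pose proof (RInt_char_mult_is_RInt (g O) (g 1%nat) n (Hdg O)) as I0.
  pose proof (is_RInt_const (V := C_R_NormedModule) 0 1 (phi n)) as I1.
  pose proof (is_RInt_minus (V := C_R_NormedModule) _ _ _ _ _ _ I0 I1) as I2.
  assert (I3 : is_RInt (V := C_R_NormedModule) (fun x => Cminus (Cmult (g O x) (char (- n) x))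
    (phi n)) 0 1 (minus (G 1) (G 0))).
  { apply (is_RInt_derive (V := C_R_CompleteNormedModule) G).
    - intros x _. apply HdG.
    - intros x _.
      apply (continuous_minus (V := C_R_NormedModule)); [|apply continuous_const].
      apply (continuous_of_derive (fun x => Cmult (g O x) (char (- n) x)) (fun x => Cplus (Cmult
        (g 1%nat x) (char (- n) x)) (Cmult (g O x) (Cmult (freq (- n)) (char (- n) x))))).
      intro y. apply is_derive_Cmult; [apply Hdg|apply char_derive]. }
  rewrite HGp, minus_eq_zero in I3.
  pose proof (is_RInt_unique (V := C_R_CompleteNormedModule) _ _ _ _ I2) as E1.
  pose proof (is_RInt_unique (V := C_R_CompleteNormedModule) _ _ _ _ I3) as E2.
  assert (E3 : minus (fourier_coeff (g O) n) (scal (V := C_R_ModuleSpace) (1 - 0) (phi n)) = RtoC 0)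
    by exact (eq_trans (eq_sym E1) E2).
  rewrite Rminus_0_r in E3.
  assert (E4 : Cminus (fourier_coeff (g O) n) (phi n) = RtoC 0).
  { rewrite <- E3. apply injective_projections; simpl; unfold minus, plus, opp, scal; simpl;
    unfold mult; simpl; ring. }
  replace (fourier_coeff (g O) n) with (Cplus (Cminus (fourier_coeff (g O) n) (phi n)) (phi n))
    by ring.
  rewrite E4. apply Cplus_0_l.
Qed.

(** * The smooth Toeplitz algebra in terms of commutators *)

Lemma Cmult_m1 (z : C) : Cmult (RtoC (-1)) z = Copp z.
Proof. apply injective_projections; simpl; ring. Qed.

Lemma weight_le_succ k M : (1 + INR k) ^ M <= (1 + INR (S k)) ^ M.
Proof. apply pow_incr. split; [left; apply weight_pos|]. rewrite S_INR. lra. Qed.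

Lemma weight_succ_le k M : (1 + INR (S k)) ^ M <= 2 ^ M * (1 + INR k) ^ M.
Proof.
  rewrite <- Rpow_mult_distr. apply pow_incr. pose proof (pos_INR k).
  rewrite S_INR. lra.
Qed.

Lemma rapid_decay_transpose c : rapid_decay c -> rapid_decay (fun k l => c l k).
Proof.
  intros Hc M N. destruct (Hc N M) as [B HB]. exists B. intros k l.
  rewrite (Rmult_comm ((1 + INR k) ^ M)). apply HB.
Qed.

Lemma rapid_decay_succ_l c : rapid_decay c -> rapid_decay (fun k l => c (S k) l).
Proof.
  intros Hc M N. destruct (Hc M N) as [B HB]. exists B. intros k l.
  eapply Rle_trans; [|apply (HB (S k) l)].
  apply Rmult_le_compat_r; [apply Cmod_ge_0|].
  apply Rmult_le_compat_r; [left; apply weight_pow_pos|]. apply weight_le_succ.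
Qed.

Lemma rapid_decay_succ_r c : rapid_decay c -> rapid_decay (fun k l => c k (S l)).
Proof.
  intro Hc. apply (rapid_decay_transpose (fun k l => c l (S k))).
  apply (rapid_decay_succ_l (fun k l => c l k)), rapid_decay_transpose, Hc.
Qed.

Lemma rapid_decay_case_l (u : nat -> C) (v : nat -> nat -> C) : rapid_seq u -> rapid_decay v ->
  rapid_decay (fun k l => match k with O => u l | S j => v j l end).
Proof.
  intros Hu Hv M N. destruct (Hu N) as [B HB], (rapid_decay_bound v M N Hv) as [D [HD0 HD]].
  exists (Rmax B (2 ^ M * D)). intros [|k] l.
  - eapply Rle_trans; [|apply Rmax_l]. eapply Rle_trans; [|apply (HB l)].
    simpl. rewrite Rplus_0_r, pow1. lra.
  - eapply Rle_trans; [|apply Rmax_r].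
    apply Rle_trans with (2 ^ M * ((1 + INR k) ^ M * (1 + INR l) ^ N * Cmod (v k l))).
    + rewrite <- !Rmult_assoc. apply Rmult_le_compat_r; [apply Cmod_ge_0|].
      apply Rmult_le_compat_r; [left; apply weight_pow_pos|]. apply weight_succ_le.
    + apply Rmult_le_compat_l; [apply pow_le; lra|apply HD].
Qed.

Lemma rapid_decay_row c k : rapid_decay c -> rapid_seq (c k).
Proof.
  intros Hc M. destruct (Hc O M) as [B HB]. exists B. intro l.
  eapply Rle_trans; [|apply (HB k l)]. simpl. lra.
Qed.

Lemma rapid_decay_col c l : rapid_decay c -> rapid_seq (fun k => c k l).
Proof. intro Hc. apply (rapid_decay_row (fun l k => c k l) l), rapid_decay_transpose, Hc. Qed.

Lemma rapid_seq_plus u v : rapid_seq u -> rapid_seq v -> rapid_seq (fun k => Cplus (u k) (v k)).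
Proof.
  intros Hu Hv M. destruct (Hu M) as [B HB], (Hv M) as [D HD]. exists (B + D). intro k.
  specialize (HB k). specialize (HD k). pose proof (Cmod_triangle (u k) (v k)).
  pose proof (weight_pow_pos k M). nra.
Qed.

Lemma rapid_seq_scal z u : rapid_seq u -> rapid_seq (fun k => Cmult z (u k)).
Proof.
  intros Hu M. destruct (Hu M) as [B HB]. exists (Cmod z * B). intro k. specialize (HB k).
  rewrite Cmod_mult. pose proof (Cmod_ge_0 z). nra.
Qed.

Lemma rapid_seq_ext u v : (forall k, u k = v k) -> rapid_seq u -> rapid_seq v.
Proof. intros Huv Hu M. destruct (Hu M) as [B HB]. exists B. intro k. rewrite <- Huv. apply HB. Qed.

Lemma rapid_seq_cons z (u : nat -> C) : rapid_seq u ->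
  rapid_seq (fun k => match k with O => z | S j => u j end).
Proof.
  intros Hu M. destruct (Hu M) as [B HB]. exists (Rmax (Cmod z) (2 ^ M * B)). intros [|k].
  - eapply Rle_trans; [|apply Rmax_l]. simpl. rewrite Rplus_0_r, pow1. lra.
  - eapply Rle_trans; [|apply Rmax_r].
    apply Rle_trans with (2 ^ M * ((1 + INR k) ^ M * Cmod (u k))).
    + rewrite <- Rmult_assoc. apply Rmult_le_compat_r; [apply Cmod_ge_0|]. apply weight_succ_le.
    + apply Rmult_le_compat_l; [apply pow_le; lra|apply HB].
Qed.

Lemma rapid_coeffs_of_seqs (phi : Z -> C) :
  rapid_seq (fun m => phi (Z.of_nat m)) -> rapid_seq (fun m => phi (- Z.of_nat m)%Z) ->
  rapid_coeffs phi.
Proof.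
  intros Hp Hm M. destruct (Hp M) as [B HB], (Hm M) as [D HD]. exists (Rmax B D). intro n.
  destruct (Z_le_gt_dec 0 n).
  - eapply Rle_trans; [|apply Rmax_l]. specialize (HB (Z.to_nat n)).
    rewrite INR_IZR_INZ, Z2Nat.id in HB by assumption.
    rewrite Rabs_pos_eq by now apply IZR_le. exact HB.
  - eapply Rle_trans; [|apply Rmax_r]. specialize (HD (Z.to_nat (- n))).
    rewrite INR_IZR_INZ, Z2Nat.id, Z.opp_involutive, opp_IZR in HD by lia.
    rewrite <- Rabs_Ropp, Rabs_pos_eq; [exact HD|]. rewrite <- opp_IZR. apply IZR_le. lia.
Qed.

(** The solution is [c k l = - sum_j d (k + j) (l + j)]. Summing from infinity rather than from the
    boundary row or column is what makes [c] decay. *)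
Lemma rapid_diagonal_primitive (d : nat -> nat -> C) : rapid_decay d ->
  exists c, rapid_decay c /\ forall k l, c (S k) (S l) = Cplus (c k l) (d k l).
Proof.
  intro Hd.
  assert (Hbound : forall M N, exists B, 0 <= B /\ forall k l j,
    Cmod (d (k + j)%nat (l + j)%nat) <= B * / ((1 + INR k) ^ M * (1 + INR l) ^ N) * / (1 + INR j)
      ^ 2).
  (* [M] powers of the row index [k + j] dominate the weight in [k], and two more make the series in
     [j] converge; the column index pays only for [l]. *)
  { intros M N. destruct (rapid_decay_bound d (M + 2) N Hd) as [B [HB0 HB]].
    exists B. split; [assumption|]. intros k l j. specialize (HB (k + j)%nat (l + j)%nat).
    rewrite pow_add in HB. pose proof (Cmod_ge_0 (d (k + j)%nat (l + j)%nat)) as Hv.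
    set (v := Cmod (d (k + j)%nat (l + j)%nat)) in *.
    assert (H1 : (1 + INR k) ^ M <= (1 + INR (k + j)) ^ M).
    { apply pow_incr. split; [left; apply weight_pos|]. apply Rplus_le_compat_l, le_INR. lia. }
    assert (H2 : (1 + INR j) ^ 2 <= (1 + INR (k + j)) ^ 2).
    { apply pow_incr. split; [left; apply weight_pos|]. apply Rplus_le_compat_l, le_INR. lia. }
    assert (H3 : (1 + INR l) ^ N <= (1 + INR (l + j)) ^ N).
    { apply pow_incr. split; [left; apply weight_pos|]. apply Rplus_le_compat_l, le_INR. lia. }
    pose proof (weight_pow_pos k M). pose proof (weight_pow_pos j 2).
      pose proof (weight_pow_pos l N).
    set (p := (1 + INR k) ^ M) in *. set (q := (1 + INR j) ^ 2) in *.
      set (r := (1 + INR l) ^ N) in *.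
    assert (Hpqr : 0 < p * q * r) by (apply Rmult_lt_0_compat;
      [now apply Rmult_lt_0_compat|assumption]).
    apply Rmult_le_reg_l with (p * q * r); [assumption|].
    replace (p * q * r * (B * / (p * r) * / q)) with B by (field; lra).
    eapply Rle_trans; [|exact HB]. apply Rmult_le_compat_r; [assumption|].
    apply Rmult_le_compat; [|lra| |assumption].
    - left. now apply Rmult_lt_0_compat.
    - apply Rmult_le_compat; lra. }
  assert (Hex : forall k l, exists s, Cseries (fun j => d (k + j)%nat (l + j)%nat) s).
  { intros k l. destruct (Hbound O O) as [B [_ HB]].
    exact (Cseries_exists _ _ (HB k l)). }
  set (s := fun k l => (proj1_sig (constructive_indefinite_description _ (Hex k l)) : C)).
  assert (Hs : forall k l, Cseries (fun j => d (k + j)%nat (l + j)%nat) (s k l)).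
  { intros k l. unfold s. now destruct constructive_indefinite_description. }
  exists (fun k l => Cmult (RtoC (-1)) (s k l)). split.
  - apply rapid_decay_scal. intros M N. destruct (Hbound M N) as [B [HB0 HB]].
    exists (2 * B). intros k l.
    pose proof (weight_pow_pos k M). pose proof (weight_pow_pos l N).
    set (w := (1 + INR k) ^ M * (1 + INR l) ^ N).
    assert (Hw : 0 < w) by now apply Rmult_lt_0_compat.
    assert (Hb : Cmod (s k l) <= 2 * (B * / w)).
    { apply (Cseries_Cmod_sqr_bound (fun j => d (k + j)%nat (l + j)%nat)); [|apply Hs|apply HB].
      apply Rmult_le_pos; [assumption|left; now apply Rinv_0_lt_compat]. }
    apply Rle_trans with (w * (2 * (B * / w))); [apply Rmult_le_compat_l; lra|].
    right. field. lra.
  - intros k l.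
    assert (H1 : Cplus (s (S k) (S l)) (d k l) = s k l).
    { apply (Cseries_unique (fun j => d (k + j)%nat (l + j)%nat)); [|apply Hs].
      apply (is_series_decr_1 (V := C_NormedModule)). rewrite !Nat.add_0_r.
      replace (plus (Cplus (s (S k) (S l)) (d k l) : C_NormedModule) (opp (d k l : C_NormedModule)))
        with (s (S k) (S l)).
      - eapply is_series_ext; [|apply (Hs (S k) (S l))]. intro j. cbv beta. f_equal; lia.
      - change (s (S k) (S l) = Cplus (Cplus (s (S k) (S l)) (d k l)) (Copp (d k l))).
        generalize (s (S k) (S l)) (d k l). intros p q.
        change (@eq C p (Cplus (Cplus p q) (Copp q))). ring. }
    rewrite <- H1. rewrite !Cmult_m1. ring.
Qed.

Section Characterisation.

Context {H : HilbertSpace} (E : nat -> H) (HE : is_orthonormal_basis E).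
Context (U Us : bounded_op H) (HU : is_shift E U) (HUs : is_adjoint U Us).

Definition rapid_commutators (b : bounded_op H) : Prop :=
  rapid_op E (commutator U b) /\ rapid_op E (commutator Us b).

Lemma entry_commutator_shift k l (b : bounded_op H) :
  entry E k l (commutator U b)
  = Cminus (match k with O => RtoC 0 | S j => entry E j l b end) (entry E k (S l) b).
Proof.
  unfold commutator. rewrite entry_minus. f_equal.
  - now apply entry_mult_shift_l with (Us := Us).
  - now apply entry_mult_shift_r.
Qed.

Lemma entry_commutator_adjoint k l (b : bounded_op H) :
  entry E k l (commutator Us b)
  = Cminus (entry E (S k) l b) (match l with O => RtoC 0 | S j => entry E k j b end).
Proof.
  unfold commutator. rewrite entry_minus. f_equal.
  - now apply entry_mult_adjoint_l with (U := U).
  - now apply entry_mult_adjoint_r with (U := U).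
Qed.

(** The Toeplitz part is constant along diagonals, so it cancels except in row 0 for [U] and in
    column 0 for [Us], where Fourier coefficients of negative and positive index remain. The compact
    part contributes shifts and differences of a rapidly decaying matrix. *)
Lemma smooth_toeplitz_rapid_commutators a : smooth_toeplitz E U Us a -> rapid_commutators a.
Proof.
  intros [f [T [c [Hf [HT [Hc ->]]]]]].
  apply smooth_periodic_rapid_coeffs in Hf. apply smooth_compact_rapid_op in Hc; [|assumption].
  set (phi := fourier_coeff f) in *. set (g := fun k l => entry E k l c) in *.
  assert (He : forall k l, entry E k l (plus T c)
    = Cplus (phi (Z.of_nat k - Z.of_nat l)%Z) (g k l)).
  { intros k l. rewrite entry_plus. f_equal. now apply toeplitz_entry with (U := U) (Us := Us). }
  assert (Hdiff : rapid_decay (fun k l => Cplus (g k l) (Cmult (RtoC (-1)) (g (S k) (S l))))).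
  { apply rapid_decay_plus; [exact Hc|]. apply rapid_decay_scal.
    apply (rapid_decay_succ_l (fun k l => g k (S l))), rapid_decay_succ_r, Hc. }
  split.
  - apply (rapid_decay_ext (fun k l => match k with
      | O => Cmult (RtoC (-1)) (Cplus (phi (- Z.of_nat (S l))%Z) (g O (S l)))
      | S j => Cplus (g j l) (Cmult (RtoC (-1)) (g (S j) (S l))) end)).
    + intros k l. rewrite entry_commutator_shift, He. destruct k as [|k].
      * rewrite !Cmult_m1. change (Z.of_nat 0 - Z.of_nat (S l))%Z with (- Z.of_nat (S l))%Z. ring.
      * rewrite He. replace (Z.of_nat (S k) - Z.of_nat (S l))%Z with (Z.of_nat k - Z.of_nat l)%Z
        by lia.
        rewrite !Cmult_m1. ring.
    + apply rapid_decay_case_l; [|exact Hdiff]. apply rapid_seq_scal, rapid_seq_plus.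
      * exact (rapid_coeffs_neg phi Hf).
      * apply (rapid_decay_row (fun k l => g k (S l))), rapid_decay_succ_r, Hc.
  - apply (rapid_decay_ext (fun k l => match l with
      | O => Cplus (phi (Z.of_nat (S k))) (g (S k) O)
      | S j => Cmult (RtoC (-1)) (Cplus (g k j) (Cmult (RtoC (-1)) (g (S k) (S j)))) end)).
    + intros k l. rewrite entry_commutator_adjoint, He. destruct l as [|l].
      * rewrite Z.sub_0_r. ring.
      * rewrite He. replace (Z.of_nat (S k) - Z.of_nat (S l))%Z with (Z.of_nat k - Z.of_nat l)%Z
        by lia.
        rewrite !Cmult_m1. ring.
    + apply (rapid_decay_transpose (fun l k => match l with
        | O => Cplus (phi (Z.of_nat (S k))) (g (S k) O)
        | S j => Cmult (RtoC (-1)) (Cplus (g k j) (Cmult (RtoC (-1)) (g (S k) (S j)))) end)).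
      apply (rapid_decay_case_l (fun k => Cplus (phi (Z.of_nat (S k))) (g (S k) O))
        (fun j k => Cmult (RtoC (-1)) (Cplus (g k j) (Cmult (RtoC (-1)) (g (S k) (S j)))))).
      * apply rapid_seq_plus.
        -- intro M. destruct (rapid_coeffs_nat phi Hf M) as [B HB]. exists B. intro k.
           eapply Rle_trans; [|apply (HB (S k))]. apply Rmult_le_compat_r; [apply Cmod_ge_0|].
           apply weight_le_succ.
        -- apply (rapid_decay_col (fun k l => g (S k) l)), rapid_decay_succ_l, Hc.
      * apply rapid_decay_scal.
        exact (rapid_decay_transpose _ Hdiff).
Qed.

Lemma smooth_toeplitz_tame a : smooth_toeplitz E U Us a -> tame E a.
Proof.
  intros [f [T [c [Hf [HT [Hc ->]]]]]]. apply tame_plus.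
  - apply (toeplitz_tame E HE U Us HU HUs f); [now apply smooth_periodic_rapid_coeffs|exact HT].
  - apply rapid_op_tame; [assumption|]. now apply smooth_compact_rapid_op.
Qed.

(** Powers of the two shifts are contractions, so rapid decay makes both series absolutely
    convergent. *)
Lemma toeplitz_exists f : rapid_coeffs (fourier_coeff f) -> exists T, is_toeplitz U Us f T.
Proof.
  intro Hf.
  assert (Hs : forall (X : nat -> bounded_op H) (u : nat -> C),
    (forall m, opnorm (X m) <= 1) -> rapid_seq u ->
    exists T, is_series (fun m => scal (u m) (X m)) T).
  { intros X u HX Hu. destruct (rapid_seq_sqr u Hu) as [B HB].
    apply (ex_series_le (V := bop_CompleteNormedModule) (fun m => scal (u m) (X m))
      (fun m => B * / (1 + INR m) ^ 2)); [|apply ex_series_inv_sqr].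
    intro m. eapply Rle_trans; [exact (opnorm_scal_le (u m) (X m) 1 (HX m))|].
    rewrite Rmult_1_r. apply HB. }
  destruct (Hs (fun m => pow_n U m) (fun m => fourier_coeff f (Z.of_nat m))) as [T1 H1].
  { intro m. now apply opnorm_pow_n, (opnorm_shift E HE U Us). }
  { exact (rapid_coeffs_nat _ Hf). }
  destruct (Hs (fun m => pow_n Us (S m)) (fun m => fourier_coeff f (- Z.of_nat (S m)))) as [T2 H2].
  { intro m. now apply opnorm_pow_n, (opnorm_adjoint_shift E HE U Us). }
  { exact (rapid_coeffs_neg _ Hf). }
  exists (plus T1 T2), T1, T2. auto.
Qed.

(** The matrix of [b] has rapidly decaying increments along diagonals. Removing their primitive [c]
    leaves a matrix constant along diagonals, that of a Toeplitz operator, and [c] becomes the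
    matrix of the compact summand. *)
Lemma rapid_commutators_smooth_toeplitz b : rapid_commutators b -> smooth_toeplitz E U Us b.
Proof.
  intros [HbU HbUs]. unfold rapid_op in HbU, HbUs.
  set (e := fun k l => entry E k l b).
  (* Entry [(k + 1, l)] of [[U, b]] is minus the increment from [(k, l)] to [(k + 1, l + 1)]. *)
  assert (Hd : rapid_decay (fun k l => Cplus (e (S k) (S l)) (Cmult (RtoC (-1)) (e k l)))).
  { apply (rapid_decay_ext (fun k l => Cmult (RtoC (-1)) (entry E (S k) l (commutator U b)))).
    - intros k l. rewrite entry_commutator_shift, !Cmult_m1. unfold e. ring.
    - apply rapid_decay_scal. exact (rapid_decay_succ_l _ HbU). }
  destruct (rapid_diagonal_primitive _ Hd) as [c [Hc Hcs]].
  (* The value on a diagonal is read off where it meets column 0 or row 0. *)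
  set (phi := fun n => if Z.leb 0 n then Cminus (e (Z.to_nat n) O) (c (Z.to_nat n) O)
                       else Cminus (e O (Z.to_nat (- n))) (c O (Z.to_nat (- n)))).
  assert (Hphi : forall k l, Cminus (e k l) (c k l) = phi (Z.of_nat k - Z.of_nat l)%Z).
  { induction k as [|k IH]; intro l.
    - unfold phi. destruct (Z.leb_spec 0 (Z.of_nat 0 - Z.of_nat l)).
      + replace l with O by lia. reflexivity.
      + replace (Z.to_nat (- (Z.of_nat 0 - Z.of_nat l))) with l by lia. reflexivity.
    - destruct l as [|l].
      + unfold phi. destruct (Z.leb_spec 0 (Z.of_nat (S k) - Z.of_nat 0)); [|lia].
        replace (Z.to_nat (Z.of_nat (S k) - Z.of_nat 0)) with (S k) by lia. reflexivity.
      + replace (Z.of_nat (S k) - Z.of_nat (S l))%Z with (Z.of_nat k - Z.of_nat l)%Z by lia.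
        rewrite <- IH, Hcs, !Cmult_m1. ring. }
  (* Below the corner, column 0 of [b] is column 0 of [[Us, b]]; past the corner, row 0 of [b] is
     minus row 0 of [[U, b]]. The corner entry is put in front by [rapid_seq_cons]. *)
  assert (Hcol : rapid_seq (fun k => e k O)).
  { apply (rapid_seq_ext (fun k => match k with O => e O O | S j => e (S j) O end)).
    - now intros [|k].
    - apply (rapid_seq_cons (e O O) (fun j => e (S j) O)).
      apply (rapid_seq_ext (fun k => entry E k O (commutator Us b)));
        [|exact (rapid_decay_col _ O HbUs)].
      intro k. rewrite entry_commutator_adjoint. unfold e. ring. }
  assert (Hrow : rapid_seq (fun l => e O l)).
  { apply (rapid_seq_ext (fun l => match l with O => e O O | S j => e O (S j) end)).
    - now intros [|l].
    - apply (rapid_seq_cons (e O O) (fun j => e O (S j))).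
      apply (rapid_seq_ext (fun l => Cmult (RtoC (-1)) (entry E O l (commutator U b))));
        [|exact (rapid_seq_scal _ _ (rapid_decay_row _ O HbU))].
      intro l. rewrite entry_commutator_shift, !Cmult_m1. unfold e. ring. }
  assert (Hrc : rapid_coeffs phi).
  { apply rapid_coeffs_of_seqs.
    - apply (rapid_seq_ext (fun k => Cplus (e k O) (Cmult (RtoC (-1)) (c k O)))).
      + intro k. specialize (Hphi k O). rewrite Z.sub_0_r in Hphi. rewrite <- Hphi, !Cmult_m1. ring.
      + apply rapid_seq_plus; [exact Hcol|]. apply rapid_seq_scal. exact (rapid_decay_col _ O Hc).
    - apply (rapid_seq_ext (fun k => Cplus (e O k) (Cmult (RtoC (-1)) (c O k)))).
      + intro k. specialize (Hphi O k). rewrite Z.sub_0_l in Hphi. rewrite <- Hphi, !Cmult_m1. ring.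
      + apply rapid_seq_plus; [exact Hrow|]. apply rapid_seq_scal. exact (rapid_decay_row _ O Hc). }
  destruct (rapid_coeffs_smooth_periodic phi Hrc) as [f [Hf Hfc]].
  assert (Hfr : rapid_coeffs (fourier_coeff f)).
  { intro M. destruct (Hrc M) as [B HB]. exists B. intro n. rewrite Hfc. apply HB. }
  destruct (toeplitz_exists f Hfr) as [T HT].
  exists f, T, (minus b T). repeat split; [exact (proj1 Hf)|exact (proj2 Hf)|exact HT| |].
  - apply rapid_op_smooth_compact; [assumption|]. apply (rapid_decay_ext c); [|exact Hc].
    intros k l. rewrite entry_minus, (toeplitz_entry E HE U Us HU HUs f T k l HT), Hfc, <- Hphi.
    unfold e. ring.
  - rewrite plus_comm. symmetry. exact (plus_minus_cancel (G := bop_AbelianGroup) b T).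
Qed.

End Characterisation.

(** * Contour integrals of the resolvent *)

Lemma minus_minus_same {G : AbelianGroup} (x y z : G) :
  minus (minus x z) (minus y z) = minus x y.
Proof.
  unfold minus at 1. rewrite opp_minus. symmetry.
  transitivity (plus (minus x z) (minus z y)); [apply minus_trans|reflexivity].
Qed.

Lemma minus_minus_minus {G : AbelianGroup} (p q s : G) :
  minus q s = minus (minus p s) (minus p q).
Proof.
  unfold minus at 2. rewrite opp_minus, plus_comm.
  transitivity (plus (minus q p) (minus p s)); [apply minus_trans|reflexivity].
Qed.

Section Contour.

Context {H : HilbertSpace} (E : nat -> H) (HE : is_orthonormal_basis E).

(** With [x = z - a] one has [[w, a] = x w - w x], and [r] on both sides cancels [x]. *)
Lemma commutator_inverse (w a r : bounded_op H) (z : C) :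
  is_inverse (minus (scal z (one : bounded_op H)) a) r ->
  commutator w r = mult r (mult (commutator w a) r).
Proof.
  intros [Hxr Hrx]. set (x := minus (scal z (one : bounded_op H)) a) in *.
  assert (Hc : commutator w a = minus (mult x w : bounded_op H) (mult w x : bounded_op H)).
  { unfold commutator, x. apply bop_ext. intro v.
    change (minus (w (a v) : H) (a (w v) : H)
      = minus (minus (scal z (w v : H) : H) (a (w v) : H)) (w (minus (scal z (v : H) : H) (a v :
        H)) : H)).
    rewrite bop_map_minus, bop_map_scal.
    generalize (scal z (w v : H) : H) (w (a v) : H) (a (w v) : H). intros p q s.
    exact (minus_minus_minus (G := H) p q s). }
  rewrite Hc, mult_minus_distr_r, mult_minus_distr_l. unfold commutator. apply f_equal2.
  - transitivity (mult (mult r x) (mult w r)); [now rewrite Hrx, mult_one_l|now apply bop_ext].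
  - transitivity (mult (mult r w) (mult x r)); [now rewrite Hxr, mult_one_r|now apply bop_ext].
Qed.

Lemma commutator_scalar_minus (w a : bounded_op H) (z : C) :
  commutator w (minus (scal z (one : bounded_op H)) a) = opp (commutator w a).
Proof.
  assert (H1 : commutator w (scal z (one : bounded_op H)) = zero).
  { rewrite commutator_scal. apply bop_ext. intro v.
    change (scal z (minus (w v : H) (w v : H)) = zero). rewrite minus_eq_zero.
    exact (scal_zero_r_hilbert z). }
  pose proof (linear_plus _ (commutator_linear w) (scal z (one : bounded_op H)) (opp a)) as Hp.
  pose proof (linear_opp _ a (commutator_linear w)) as Ho.
  transitivity (plus (commutator w (scal z (one : bounded_op H))) (opp (commutator w a))).
  - etransitivity; [exact Hp|]. f_equal. exact Ho.
  - rewrite H1. apply plus_zero_l.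
Qed.

(** From the resolvent identity [r' - r = (z - z') r' r]. *)
Lemma inverse_difference_bound (a r r' : bounded_op H) (z z' : C) :
  is_inverse (minus (scal z (one : bounded_op H)) a) r ->
  is_inverse (minus (scal z' (one : bounded_op H)) a) r' ->
  opnorm (minus r' r) <= Cmod (Cminus z' z) * (opnorm r' * opnorm r).
Proof.
  intros [Hxr Hrx] [Hxr' Hrx'].
  assert (Hd : minus r' r = scal (Cminus z z') (mult r' r)).
  { set (x := minus (scal z (one : bounded_op H)) a) in *.
    set (x' := minus (scal z' (one : bounded_op H)) a) in *.
    assert (Hx : minus (G := bop_AbelianGroup) x x' = scal (Cminus z z') (one : bounded_op H)).
    { apply bop_ext. intro v.
      change (minus (minus (scal z (v : H) : H) (a v : H)) (minus (scal z' (v : H) : H) (a v :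
        H)) = scal (Cminus z z') (v : H)).
      rewrite (minus_minus_same (G := H)).
      unfold Cminus. rewrite <- scal_distr_hilbert. unfold minus. f_equal.
      symmetry. exact (scal_opp_l (V := H) z' v). }
    assert (Hm : mult (mult r' (minus (G := bop_AbelianGroup) x x')) r = minus r' r).
    { rewrite mult_minus_distr_l, mult_minus_distr_r. apply f_equal2.
      - transitivity (mult r' (mult x r)); [now apply bop_ext|]. now rewrite Hxr, mult_one_r.
      - now rewrite Hrx', mult_one_l. }
    rewrite <- Hm, Hx. apply bop_ext. intro v.
    exact (bop_map_scal r' (Cminus z z') (r v)). }
  rewrite Hd. eapply Rle_trans; [apply opnorm_scal_le, opnorm_mult|].
  right. f_equal. replace (Cminus z z') with (Copp (Cminus z' z)) by ring. apply Cmod_opp.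
Qed.

(** No bound on [r s] near [t] is assumed; the resolvent identity itself provides one as soon as
    [z s] is close to [z t]. *)
Lemma inverse_continuous (a : bounded_op H) (z : R -> C) (r : R -> bounded_op H) (t : R) :
  (forall s, is_inverse (minus (scal (z s) (one : bounded_op H)) a) (r s)) ->
  (forall eps : posreal, locally t (fun s => Cmod (Cminus (z s) (z t)) < eps)) ->
  filterlim r (locally t) (locally (r t)).
Proof.
  intros Hr Hz P [eps HP]. set (rho := opnorm (r t)).
  assert (Hrho : 0 <= rho) by apply opnorm_ge_0.
  assert (Hsq : 0 < (rho + 1) ^ 2) by (apply pow_lt; lra).
  (* The first radius makes [d * rho <= 1 / 2], so that [d * rho * n] is absorbed on the left; the
     second makes the remaining [2 * d * rho ^ 2] smaller than [eps]. *)
  assert (Hd1 : 0 < / (2 * (rho + 1))) by (apply Rinv_0_lt_compat; lra).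
  assert (Hd2 : 0 < eps / (2 * (rho + 1) ^ 2)) by (apply Rdiv_lt_0_compat; [apply cond_pos|lra]).
  generalize (filter_and _ _ (Hz (mkposreal _ Hd1)) (Hz (mkposreal _ Hd2))).
  unfold filtermap. apply filter_imp. intros s [H1 H2]. cbn [pos] in H1, H2. apply HP.
  change (opnorm (minus (r s) (r t)) < eps).
  pose proof (inverse_difference_bound a (r t) (r s) (z t) (z s) (Hr t) (Hr s)) as Hb.
  fold rho in Hb. set (d := Cmod (Cminus (z s) (z t))) in *.
  assert (Hd0 : 0 <= d) by apply Cmod_ge_0.
  assert (Hrs : opnorm (r s) <= opnorm (minus (r s) (r t)) + rho)
    by exact (norm_le_minus (V := bop_NormedModule) (r s) (r t)).
  set (n := opnorm (minus (r s) (r t))) in *.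
  assert (Hdr : d * (2 * (rho + 1)) < 1).
  { apply Rlt_le_trans with (/ (2 * (rho + 1)) * (2 * (rho + 1))); [apply Rmult_lt_compat_r; lra|].
    right. field. lra. }
  assert (Hde : d * (2 * (rho + 1) ^ 2) < eps).
  { apply Rlt_le_trans with (eps / (2 * (rho + 1) ^ 2) * (2 * (rho + 1) ^ 2));
    [apply Rmult_lt_compat_r; lra|].
    right. field. lra. }
  assert (Hn : n <= d * rho * n + d * rho * rho).
  { eapply Rle_trans; [exact Hb|]. apply Rle_trans with (d * ((n + rho) * rho)); [|right; ring].
    apply Rmult_le_compat_l; [assumption|]. now apply Rmult_le_compat_r. }
  assert (Hn0 : 0 <= n) by apply opnorm_ge_0.
  assert (d * rho <= 1 / 2) by nra.
  assert (d * rho * n <= 1 / 2 * n) by (apply Rmult_le_compat_r; assumption).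
  assert (d * rho * rho <= d * (rho + 1) ^ 2) by (rewrite Rmult_assoc; apply Rmult_le_compat_l;
    nra).
  lra.
Qed.

End Contour.

(** Extends an integrand from [[0, 1]] to the line without losing continuity; outside [[0, 1]] the
    arc need not be differentiable and the resolvent need not exist. *)
Definition clamp (t : R) : R := Rmax 0 (Rmin t 1).

Lemma clamp_range t : 0 <= clamp t <= 1.
Proof. unfold clamp, Rmax, Rmin. destruct (Rle_dec t 1);
    match goal with |- context [Rle_dec ?p ?q] => destruct (Rle_dec p q) end; lra. Qed.

Lemma clamp_id t : 0 <= t <= 1 -> clamp t = t.
Proof. intro Ht. unfold clamp. rewrite Rmin_left, Rmax_right by lra. reflexivity. Qed.

Lemma clamp_continuous t : filterlim clamp (locally t) (locally (clamp t)).
Proof.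
  apply filterlim_locally. intro eps. exists eps. intros s Hs.
  change (Rabs (s - t) < eps) in Hs. change (Rabs (clamp s - clamp t) < eps).
  eapply Rle_lt_trans; [|exact Hs]. unfold clamp, Rmax, Rmin.
  destruct (Rle_dec s 1), (Rle_dec t 1);
    repeat match goal with |- context [Rle_dec ?p ?q] => destruct (Rle_dec p q) end;
    unfold Rabs; repeat destruct Rcase_abs; lra.
Qed.

(** The two uniform structures carried by [C] are not convertible. *)
Lemma continuous_AbsRing_of_C {T : UniformSpace} (h : T -> C) t :
  continuous (U := C_NormedModule) h t -> continuous (U := AbsRing_NormedModule C_AbsRing) h t.
Proof.
  intro Hh. apply (filterlim_locally_ball_norm (U := AbsRing_NormedModule C_AbsRing)). intro eps.
  exact (proj1 (filterlim_locally_ball_norm (U := C_NormedModule) h (h t)) Hh eps).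
Qed.

Lemma continuous_AbsRing_of_R (h : R -> C) t :
  continuous (U := C_R_NormedModule) h t -> continuous (U := AbsRing_NormedModule C_AbsRing) h t.
Proof.
  intro Hh. apply (filterlim_locally_ball_norm (U := AbsRing_NormedModule C_AbsRing)). intro eps.
  pose proof (proj1 (filterlim_locally_ball_norm (U := C_R_NormedModule) h (h t)) Hh eps) as He.
  revert He. apply filter_imp. intros s Hs. unfold ball_norm in *.
  change (Cmod (Cminus (h s) (h t)) < eps). rewrite Cmod_norm. exact Hs.
Qed.

(** Makes complex-linear functionals, such as matrix entries, usable in [is_RInt_linear], which
    works over the reals. *)
Lemma restrict_scalars_linear {V : NormedModule C_AbsRing} (L : V -> C) :
  is_linear (V := C_NormedModule) L ->
  is_linear (K := R_AbsRing) (U := real_NormedModule V) (V := C_R_NormedModule) L.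
Proof.
  intro HL. split.
  - exact (linear_plus L HL).
  - intros k x. etransitivity; [exact (linear_scal L HL (RtoC k) x)|].
    apply injective_projections; simpl; unfold scal; simpl; unfold mult; simpl; ring.
  - destruct (linear_norm L HL) as [M [HM HLM]]. exists M. split; [assumption|].
    intro x. rewrite <- Cmod_norm. apply HLM.
Qed.

Section Toeplitz.

Context {H : HilbertSpace} (E : nat -> H) (HE : is_orthonormal_basis E).
Context (U Us : bounded_op H) (HU : is_shift E U) (HUs : is_adjoint U Us).

Lemma rapid_commutators_zero : rapid_commutators E U Us zero.
Proof.
  assert (Hz : forall w k l, entry E k l (commutator w zero) = RtoC 0).
  { intros w k l. rewrite <- (scal_zero_l (zero : bounded_op H)) at 1.
    rewrite commutator_scal, entry_scal. apply Cmult_0_l. }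
  split; intros M N; exists 0; intros k l; rewrite Hz, Cmod_0; lra.
Qed.

Lemma rapid_commutators_plus b c :
  rapid_commutators E U Us b -> rapid_commutators E U Us c -> rapid_commutators E U Us (plus b c).
Proof.
  intros [Hb1 Hb2] [Hc1 Hc2]. split.
  - apply (rapid_decay_ext _ _ (fun k l => eq_sym (eq_trans (f_equal (entry E k l)
    (commutator_plus U b c)) (entry_plus E k l _ _)))).
    now apply rapid_decay_plus.
  - apply (rapid_decay_ext _ _ (fun k l => eq_sym (eq_trans (f_equal (entry E k l)
    (commutator_plus Us b c)) (entry_plus E k l _ _)))).
    now apply rapid_decay_plus.
Qed.

Lemma rapid_commutators_scal (z : C) b :
  rapid_commutators E U Us b -> rapid_commutators E U Us (scal z b).
Proof.
  intros [Hb1 Hb2]. split.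
  - apply (rapid_decay_ext _ _ (fun k l => eq_sym (eq_trans (f_equal (entry E k l)
    (commutator_scal U z b)) (entry_scal E k l _ _)))).
    now apply rapid_decay_scal.
  - apply (rapid_decay_ext _ _ (fun k l => eq_sym (eq_trans (f_equal (entry E k l)
    (commutator_scal Us z b)) (entry_scal E k l _ _)))).
    now apply rapid_decay_scal.
Qed.

(** The map from [T] to an entry of [[w, T]] is continuous and linear, so it passes under the
    integral. On the compact parameter interval the speed, [f] and the resolvent are bounded, hence
    the entry bounds are uniform in the parameter. *)
Lemma arc_integral_rapid_commutators (a : bounded_op H) (r : C -> bounded_op H) (f : C -> C) (g :
  arc) :
  smooth_toeplitz E U Us a ->
  (forall t, 0 <= t <= 1 -> is_inverse (minus (scal (g t) (one : bounded_op H)) a) (r (g t))) ->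
  (forall t, 0 <= t <= 1 -> ex_derive (K := C_AbsRing) (V := C_NormedModule) f (g t)) ->
  exists I : bounded_op H,
    is_RInt (V := real_NormedModule bop_NormedModule)
      (fun t => scal (arc_der g t) (scal (f (g t)) (r (g t)))) 0 1 I /\
    rapid_commutators E U Us I.
Proof.
  intros Ha Hr Hf.
  assert (Hg : forall t, continuous (U := AbsRing_NormedModule C_AbsRing) (fun s => g (clamp s)) t).
  { intro t. apply continuous_AbsRing_of_R. eapply filterlim_comp; [apply clamp_continuous|].
    apply (ex_derive_continuous (V := C_R_NormedModule)). eexists.
    apply (arc_is_derive g), clamp_range. }
  assert (Hdg : forall t, continuous (U := AbsRing_NormedModule C_AbsRing) (fun s => arc_der g
    (clamp s)) t).
  { intro t. apply continuous_AbsRing_of_R. eapply filterlim_comp; [apply clamp_continuous|].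
    apply (arc_der_continuous g), clamp_range. }
  assert (Hfg : forall t, continuous (U := AbsRing_NormedModule C_AbsRing) (fun s => f (g (clamp
    s))) t).
  { intro t. apply continuous_AbsRing_of_C. eapply filterlim_comp; [apply Hg|].
    apply (ex_derive_continuous (K := C_AbsRing) (V := C_NormedModule) f), Hf, clamp_range. }
  assert (Hrg : forall t, continuous (U := bop_NormedModule (V := H)) (fun s => r (g (clamp s))) t).
  { intro t. apply (inverse_continuous a (fun s => g (clamp s))).
    - intro s. apply Hr, clamp_range.
    - intro eps. exact (proj1 (filterlim_locally_ball_norm (U := AbsRing_NormedModule C_AbsRing)
      _ _) (Hg t) eps). }
  set (F := fun t => scal (arc_der g (clamp t)) (scal (f (g (clamp t))) (r (g (clamp t))))).
  assert (HF : forall t, continuous (U := bop_NormedModule (V := H)) F t).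
  { intro t. apply (continuous_scal (V := bop_NormedModule (V := H))); [apply Hdg|].
    apply (continuous_scal (V := bop_NormedModule (V := H))); [apply Hfg|apply Hrg]. }
  destruct (ex_RInt_continuous (V := bop_real_CompleteNormedModule) F 0 1 (fun t _ => HF t)) as
    [I HI].
  exists I. split.
  { eapply is_RInt_ext; [|exact HI]. intros t Ht. unfold F.
    rewrite Rmin_left, Rmax_right in Ht by lra. rewrite clamp_id by lra. reflexivity. }
  destruct (bounded_continuity (V := bop_NormedModule (V := H)) (fun s => r (g (clamp s))) 0 1
    (fun t _ => Hrg t)) as [rho Hrho].
  destruct (bounded_continuity (V := AbsRing_NormedModule C_AbsRing) (fun s => arc_der g (clamp
    s)) 0 1 (fun t _ => Hdg t)) as [K1 HK1].
  destruct (bounded_continuity (V := AbsRing_NormedModule C_AbsRing) (fun s => f (g (clamp s))) 0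
    1 (fun t _ => Hfg t)) as [K2 HK2].
  pose proof (smooth_toeplitz_tame E HE U Us HU HUs a Ha) as Htame.
  assert (Hcomm : forall w, rapid_op E (commutator w a) -> rapid_op E (commutator w I)).
  { intros w Hw M N.
    destruct (tame_inverse_rapid E HE a (commutator w a) M N rho Htame Hw) as [B HB].
    (* [K1] bounds the speed and [K2] bounds [f], while [B] is the uniform weighted bound for the
       commutator of [w] with the resolvent. *)
    exists (K1 * (K2 * B)). intros k l.
    assert (HL : is_linear (U := bop_NormedModule) (V := C_NormedModule) (fun T => entry E k l
      (commutator w T)))
      by exact (is_linear_comp _ _ (commutator_linear w) (entry_linear E HE k l)).
    pose proof (is_RInt_linear _ _ _ _ _ (restrict_scalars_linear _ HL) HI) as HLI.
    set (q := (1 + INR k) ^ M * (1 + INR l) ^ N).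
    assert (Hq : 0 < q) by (apply Rmult_lt_0_compat; apply weight_pow_pos).
    assert (HLe : Cmod (entry E k l (commutator w I)) <= (1 - 0) * (K1 * (K2 * B) * / q)).
    { rewrite Cmod_norm.
      apply (norm_RInt_le_const (V := C_R_NormedModule) (fun t => entry E k l (commutator w (F
        t))) 0 1); [lra| |exact HLI].
      intros t Ht. rewrite <- Cmod_norm. unfold F.
      rewrite !commutator_scal, !entry_scal, !Cmod_mult.
      specialize (HK1 t Ht). specialize (HK2 t Ht). specialize (Hrho t Ht).
      change (Cmod (arc_der g (clamp t)) < K1) in HK1.
      change (Cmod (f (g (clamp t))) < K2) in HK2.
      change (opnorm (r (g (clamp t))) < rho) in Hrho.
      pose proof (Hr (clamp t) (clamp_range t)) as Hinv.
      specialize (HB (r (g (clamp t))) _ Hinv (Rlt_le _ _ Hrho) (fun w => commutator_scalar_minus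
        w a _) k l).
      fold q in HB. rewrite (commutator_inverse w a _ _ Hinv).
      set (v := Cmod (entry E k l _)) in *.
      assert (Hv : v <= B * / q).
      { apply Rmult_le_reg_l with q; [assumption|]. replace (q * (B * / q)) with B by (field;
        lra). exact HB. }
      replace (K1 * (K2 * B) * / q) with (K1 * (K2 * (B * / q))) by (field; lra).
      assert (0 <= v) by apply Cmod_ge_0.
      apply Rmult_le_compat; [apply Cmod_ge_0| |lra|].
      - apply Rmult_le_pos; [apply Cmod_ge_0|assumption].
      - apply Rmult_le_compat; [apply Cmod_ge_0|assumption|lra|assumption]. }
    apply Rle_trans with (q * ((1 - 0) * (K1 * (K2 * B) * / q))); [apply Rmult_le_compat_l; lra|].
    right. field. lra. }
  destruct (smooth_toeplitz_rapid_commutators E HE U Us HU HUs a Ha) as [H1 H2].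
  split; now apply Hcomm.
Qed.

Lemma arcs_integral_rapid_commutators (a : bounded_op H) (r : C -> bounded_op H) (f : C -> C) (p
  : list arc) :
  smooth_toeplitz E U Us a ->
  (forall g t, In g p -> 0 <= t <= 1 -> is_inverse (minus (scal (g t) (one : bounded_op H)) a) (r
    (g t))) ->
  (forall g t, In g p -> 0 <= t <= 1 -> ex_derive (K := C_AbsRing) (V := C_NormedModule) f
    (arc_fun g t)) ->
  exists I : bounded_op H,
    is_arcs_integral (fun zeta => scal (f zeta) (r zeta)) p I /\ rapid_commutators E U Us I.
Proof.
  intro Ha. induction p as [|g q IH]; intros Hr Hf.
  - exists zero. split; [reflexivity|apply rapid_commutators_zero].
  - destruct (arc_integral_rapid_commutators a r f g Ha) as [I1 [HI1 HR1]].
    + intros t Ht. apply Hr; [now left|assumption].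
    + intros t Ht. apply Hf; [now left|assumption].
    + destruct IH as [I2 [HI2 HR2]].
      * intros h t Hh. apply Hr. now right.
      * intros h t Hh. apply Hf. now right.
      * exists (plus I1 I2). split; [|now apply rapid_commutators_plus].
        exists I1, I2. auto.
Qed.

End Toeplitz.

Theorem theorem3p3 (H : HilbertSpace) (E : nat -> H) (HE : is_orthonormal_basis E)
    (U Us : bounded_op H) (HU : is_shift E U) (HUs : is_adjoint U Us)
    (a : bounded_op H) (Ha : smooth_toeplitz E U Us a)
    (f : C -> C) (Omega : C -> Prop) (HOmega : open Omega)
    (Hsp : forall z : C, spectrum (Cstar_generated U) a z -> Omega z)
    (Hf : holomorphic_on Omega f)
    (G : contour) (HG : is_contour_around G (spectrum (Cstar_generated U) a) Omega) :
  exists fa : bounded_op H, is_cauchy_integral f a G fa /\ smooth_toeplitz E U Us fa.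
Proof.
  (* The resolvent is picked by choice; off the spectrum it is the true inverse, and where no
     inverse exists its value is arbitrary. *)
  set (r := fun zeta => epsilon (inhabits zero)
    (is_inverse (minus (scal zeta (one : bounded_op H)) a))).
  assert (Hr : forall zeta, on_contour G zeta ->
    is_inverse (minus (scal zeta (one : bounded_op H)) a) (r zeta)).
  { intros zeta Hz. apply epsilon_spec.
    (* Lying off the spectrum is a doubly negated existence statement, so the inverse is extracted
       classically. *)
    destruct (NNPP _ (proj2 (contour_in _ _ _ HG zeta Hz))) as [b [_ Hb]]. now exists b. }
  destruct (arcs_integral_rapid_commutators E HE U Us HU HUs a r f (concat G) Ha) as [I [HI HR]].
  - intros g t Hg Ht. apply Hr. now exists g, t.
  - intros g t Hg Ht. apply Hf, (contour_in _ _ _ HG). now exists g, t.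
  - exists (scal (Cinv two_pi_i) I). split.
    + exists r, I. auto.
    + apply rapid_commutators_smooth_toeplitz; [assumption..|].
      now apply rapid_commutators_scal.
Qed.
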